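(* Let $0\leq k'\leq k$ and $0\leq \ell'\leq \ell$. Set $\mathcal{A}= \mathbb{C}\langle X_1,\ldots,X_k,Y_1,\ldots,Y_{\ell}\rangle$, $\mathcal{A}_1=\mathbb{C}\langle X_1,\ldots,X_k\rangle$, $\mathcal{A}_2=\mathbb{C}\langle Y_1,\ldots,Y_{\ell}\rangle$; let $\mathcal{I}_1$ be the ideal of $\mathcal{A}_1$ generated by $X_1,\ldots,X_{k'}$, $\mathcal{I}_2$ the ideal of $\mathcal{A}_2$ generated by $Y_1,\ldots,Y_{\ell'}$, and $\mathcal{I}$ the ideal of $\mathcal{A}$ generated by $\mathcal{I}_1\cup \mathcal{I}_2$. Let $(\mathbf{A}_N)_{N\geq 1}$ and $(\mathbf{B}_N)_{N\geq 1}$ be two deterministic sequences of $k$-tuples and $\ell$-tuples of $N\times N$ complex matrices, and assume there are maps $\tau:\mathcal{A}_1\cup\mathcal{A}_2\to\mathbb{C}$ and $\tau':\mathcal{I}_1\cup\mathcal{I}_2\to\mathbb{C}$ such that $\tau_{\mathbf{A}_N}(P)=\tau(P)+o(1)$ for all $P\in \mathcal{A}_1$; $\tau_{\mathbf{A}_N}(P)=\frac{1}{N}\tau'(P)+o(N^{-1})$ for all $P\in \mathcal{I}_1$; $\tau_{\mathbf{B}_N}(P)=\tau(P)+o(1)$ for all $P\in\mathcal{A}_2$; $\tau_{\mathbf{B}_N}(P)=\frac{1}{N}\tau'(P)+o(N^{-1})$ for all $P\in \mathcal{I}_2$. Let $(U_N)_{N\geq 1}$ be a sequence of Haar distributed unitary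 random matrices of size $N$. Then $\tau$ extends to a linear functional on $\mathcal{A}$ and $\tau'$ to a linear functional on $\mathcal{I}$ such that $\mathbb{E}[ \tau_{\mathbf{A}_N, U_N\mathbf{B}_NU_N^*}(P)]=\tau(P)+o(1)$ for all $P\in \mathcal{A}$ and $\mathbb{E}[ \tau_{\mathbf{A}_N, U_N\mathbf{B}_NU_N^*}(P)]=\frac{1}{N}\tau'(P)+o(N^{-1})$ for all $P\in \mathcal{I}$; moreover $(\mathcal{A}_1,\mathcal{I}_1)$ and $(\mathcal{A}_2,\mathcal{I}_2)$ are free of type $B$ in $(\mathcal{A},\tau,\mathcal{I},\tau')$. Furthermore, if all matrices of $\mathbf{A}_N$ and $\mathbf{B}_N$ are self-adjoint, then $\tau_{\mathbf{A}_N, U_N\mathbf{B}_NU_N^*}(P)=\tau(P)+o(1)$ almost surely for all $P\in \mathcal{A}$, and $\tau_{\mathbf{A}_N, U_N\mathbf{B}_NU_N^*}(P)=\frac{1}{N}\tau'(P)+o(N^{-1})$ almost surely for all $P\in \mathcal{I}$.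
   Context: $\operatorname{tr}_N=\frac1N\operatorname{Tr}$; $\tau_{\mathbf{A}_N}(P)=\operatorname{tr}_N(P(\mathbf{A}_N))$; $\tau_{\mathbf{A}_N,U_N\mathbf{B}_NU_N^*}(P)=\operatorname{tr}_N(P(\mathbf{A}_N,U_NB_N^{(1)}U_N^*,\dots,U_NB_N^{(\ell)}U_N^* ))$. Freeness of type $B$: let $\tau$ be a unital linear functional on a unital algebra $\mathcal{A}$, $\mathcal{I}$ an ideal of $\mathcal{A}$ and $\tau':\mathcal{I}\to\mathbb{C}$ linear. For unital subalgebras $\mathcal{A}_1,\mathcal{A}_2$ and subspaces $V_1\subset\mathcal{A}_1\cap\mathcal{I}$, $V_2\subset \mathcal{A}_2\cap\mathcal{I}$ invariant under the two-sided multiplication by $\mathcal{A}_1$, resp. $\mathcal{A}_2$, one says $(\mathcal{A}_1,V_1)$ and $(\mathcal{A}_2,V_2)$ are free of type $B$ in $(\mathcal{A},\tau,\mathcal{I},\tau')$ if $\mathcal{A}_1,\mathcal{A}_2$ are free with respect to $\tau$ and, whenever $a_n\in\mathcal{A}_{i_n},\dots,a_1\in\mathcal{A}_{i_1}$, $v\in V_h$, $b_1\in\mathcal{A}_{j_1},\dots,b_m\in\mathcal{A}_{j_m}$ with any two consecutive indices in the list $i_n,\dots,i_1,h,j_1,\dots,j_m$ different and $\tau(a_r)=\tau(b_s)=0$ for all $r,s$, one has $\tau'(a_n\cdots a_1vb_1\cdots b_m)=\tau(a_nb_m)\cdots\tau(a_1b_1)\tau'(v)$ if $n=m$ and $i_r=j_r$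 for all $r$, and $\tau'(a_n\cdots a_1vb_1\cdots b_m)=0$ otherwise. *)

(* Defs.v *)
From HB Require Import structures.
From mathcomp Require Import all_boot all_order all_algebra.
From mathcomp.multinomials Require Import monalg.
From mathcomp Require Import all_classical all_reals all_analysis.
From mathcomp Require Import complex.

Set Implicit Arguments.
Unset Strict Implicit.
Unset Printing Implicit Defensive.

Import Order.TTheory GRing.Theory Num.Theory.
Local Open Scope ring_scope.

(* C<X_1..X_k, Y_1..Y_l> with C = R[i]; the letters are 'I_k + 'I_l:   *)
(* inl i is X_(i+1), inr j is Y_(j+1).                                 *)

Definition letter (k l : nat) := ('I_k + 'I_l)%type.

Definition ncpoly (R : realType) (k l : nat) :=
  {malg R[i][{fmonom (letter k l)}]}.

Definition Xv (R : realType) (k l : nat) (i : 'I_k) : ncpoly R k l :=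
  << fmu (inl i : letter k l) >>.
Definition Yv (R : realType) (k l : nat) (j : 'I_l) : ncpoly R k l :=
  << fmu (inr j : letter k l) >>.

Definition inA1 (R : realType) (k l : nat) (p : ncpoly R k l) : Prop :=
  forall m : {fmonom (letter k l)}, p@_m != 0 -> all (fun x : letter k l => if x is inl _ then true else false) (m : seq _).
Definition inA2 (R : realType) (k l : nat) (p : ncpoly R k l) : Prop :=
  forall m : {fmonom (letter k l)}, p@_m != 0 -> all (fun x : letter k l => if x is inr _ then true else false) (m : seq _).

Inductive ideal_gen (A : pzRingType) (B S : A -> Prop) : A -> Prop :=
| ideal_gen0 : ideal_gen B S 0
| ideal_genD x y : ideal_gen B S x -> ideal_gen B S y -> ideal_gen B S (x + y)
| ideal_genM a g b : B a -> S g -> B b -> ideal_gen B S (a * g * b).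

Definition inI1 (R : realType) (k l k' : nat) : ncpoly R k l -> Prop :=
  ideal_gen (@inA1 R k l) (fun g => exists i : 'I_k, (i < k')%N /\ g = @Xv R k l i).
Definition inI2 (R : realType) (k l l' : nat) : ncpoly R k l -> Prop :=
  ideal_gen (@inA2 R k l) (fun g => exists j : 'I_l, (j < l')%N /\ g = @Yv R k l j).
Definition inI (R : realType) (k l k' l' : nat) : ncpoly R k l -> Prop :=
  ideal_gen (fun _ => True) (fun g => @inI1 R k l k' g \/ @inI2 R k l l' g).

Definition ev (R : realType) (k l N : nat) (M : letter k l -> 'M[R[i]]_N)
    (p : ncpoly R k l) : 'M[R[i]]_N :=
  \sum_(m <- finmap.enum_fset (msupp p)) p@_m *: \prod_(x <- (m : seq (letter k l))) M x.

Definition trN (R : realType) (N : nat) (M : 'M[R[i]]_N) : R[i] := \tr M / N%:R.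

Definition adjmx (R : realType) (N : nat) (M : 'M[R[i]]_N) : 'M[R[i]]_N :=
  (map_mx Num.conj M)^T.

Definition unitary (R : realType) (N : nat) (M : 'M[R[i]]_N) : Prop :=
  M *m adjmx M = 1%:M.

Definition selfadjoint (R : realType) (N : nat) (M : 'M[R[i]]_N) : Prop :=
  adjmx M = M.

Definition cvgC (R : realType) (u : nat -> R[i]) (c : R[i]) : Prop :=
  forall e : R[i], 0 < e -> exists N0 : nat, forall N, (N0 <= N)%N -> `|u N - c| < e.

Definition eq_o1 (R : realType) (u : nat -> R[i]) (c : R[i]) : Prop := cvgC u c.

Definition eq_oNinv (R : realType) (u : nat -> R[i]) (c : R[i]) : Prop :=
  cvgC (fun N => N%:R * (u N - c / N%:R)) 0.

Definition expC (R : realType) (d : measure_display) (Omega : measurableType d)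
    (P : probability Omega R) (X : Omega -> R[i]) : R[i] :=
  Complex (Rintegral P setT (fun w => complex.Re (X w))) (Rintegral P setT (fun w => complex.Im (X w))).

Definition bounded_continuous_mx (R : realType) (N : nat) (f : 'M[R[i]]_N -> R) : Prop :=
  (exists c : R, forall M, `|f M| <= c) /\
  (forall (M : 'M[R[i]]_N) (e : R), 0 < e -> exists2 dl : R, 0 < dl &
     forall M' : 'M[R[i]]_N, (forall i j, `|M' i j - M i j| < (dl%:C)%C) -> `|f M' - f M| < e).

(* U is a Haar distributed random unitary N x N matrix: it is a random
   variable (entries measurable), almost surely unitary, and its law is
   invariant under left multiplication by any fixed unitary matrix
   (equality of laws tested on bounded continuous functions). *)
Definition haar_unitary (R : realType) (d : measure_display) (Omega : measurableType d)
    (P : probability Omega R) (N : nat) (U : Omega -> 'M[R[i]]_N) : Prop :=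
  [/\ forall i j, measurable_fun setT (fun w => complex.Re (U w i j)) /\
                  measurable_fun setT (fun w => complex.Im (U w i j)),
      {ae P, forall w, unitary (U w)} &
      forall V : 'M[R[i]]_N, unitary V ->
        forall f : 'M[R[i]]_N -> R, bounded_continuous_mx f ->
          Rintegral P setT (fun w => f (V *m U w)) = Rintegral P setT (fun w => f (U w))].

(* sequences (i_r, a_r) : bool encodes the index (false = 1, true = 2) *)
Definition in_sub (A : Type) (A1 A2 : A -> Prop) (b : bool) : A -> Prop :=
  if b then A2 else A1.

Definition alternating (s : seq bool) : bool := sorted (fun x y => x != y) s.

Definition free_wrt (C : numFieldType) (A : lalgType C) (tau : A -> C)
    (A1 A2 : A -> Prop) : Prop :=
  forall s : seq (bool * A), s != [::] ->
    alternating (map fst s) ->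
    (forall x, x \in s -> in_sub A1 A2 x.1 x.2 /\ tau x.2 = 0) ->
    tau (\prod_(x <- s) x.2) = 0.

(* freeness of type B of (A1,V1), (A2,V2) in (A, tau, I, tau').
   as = [a_n; ...; a_1] (with their indices), v in V_h, bs = [b_1; ...; b_m]. *)
Definition free_typeB (C : numFieldType) (A : lalgType C) (tau : A -> C)
    (I : A -> Prop) (tau' : A -> C) (A1 V1 A2 V2 : A -> Prop) : Prop :=
  free_wrt tau A1 A2 /\
  forall (as_ : seq (bool * A)) (h : bool) (v : A) (bs : seq (bool * A)),
    alternating (map fst as_ ++ h :: map fst bs) ->
    (forall x, x \in as_ -> in_sub A1 A2 x.1 x.2 /\ tau x.2 = 0) ->
    (forall x, x \in bs -> in_sub A1 A2 x.1 x.2 /\ tau x.2 = 0) ->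
    in_sub V1 V2 h v ->
    tau' ((\prod_(x <- as_) x.2) * v * (\prod_(x <- bs) x.2)) =
      if (size as_ == size bs) && (map fst (rev as_) == map fst bs)
      then (\prod_(xy <- zip (rev as_) bs) tau (xy.1.2 * xy.2.2)) * tau' v
      else 0.

Definition lettermap (T : Type) (k l : nat) (Ma : 'I_k -> T) (Mb : 'I_l -> T)
    (x : letter k l) : T :=
  match x with inl i => Ma i | inr j => Mb j end.

(* Main.v *)
(* Invariance of the Haar measure under U -> VU, taken to first order at V = 1, gives the
   loop (Schwinger-Dyson) equations
     N^2 sum_(P = P1 Y P2) E[(tr P1 tr (Y P2) - tr (P1 Y) tr P2) F] = - E[merging terms],
   where Y runs over the letters of one kind in P, F is a product of normalized traces and
   the merging terms replace P and a factor of F by the trace of one longer word.  After a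
   cyclic rotation of a word mixing the two kinds of letters, the term with P1 empty is the
   trace of P itself and all other terms have strictly more factors, so the equations
   determine all mixed moments from the moments of A_N and B_N, up to O(N^-2) perturbations.
   This is purely algebraic, hence needs no norm bound nor self-adjointness: it yields the
   limits, their factorization, and, after multiplying by N, the same statements for words
   in the ideal.  The limiting equations kill alternating centred words, which gives type B
   freeness by traciality.  In the self-adjoint case the conjugate of a trace is again a
   trace, and the same recursion applied to centred traces shows that the fourth centred
   moment of Tr(P), P in the ideal, is O(N^-2), whence almost sure convergence. *)

(* The letters of the loop equations are not the variables but pairs of a kind and an element of the
   algebra of that kind. An alternating product of centred polynomials is then itself a word, so the
   limiting equations apply to it without expansion into monomials, and an element of an ideal is
   simply a marked letter. Invariance is differentiated along the unitaries [1 + eta E], with [E] an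
   orthogonal projection and [1 + eta] of modulus 1: rank one projections span all matrices, so
   neither exponentials nor skew-Hermitian directions are needed. The obstacle is the lack of any a
   priori bound on mixed moments: it forces all configurations with the same letters to be estimated
   together, by an inequality in which their sum occurs on both sides. Fourth moments are used
   because the recursion bounds the variance of [Tr(P)], for [P] in the ideal, only by O(1/N), which
   is not summable. *)
Require Import Defs.
From HB Require Import structures.
From mathcomp Require Import all_boot all_order all_algebra finmap.
From mathcomp.multinomials Require Import monalg.
From mathcomp Require Import all_classical all_reals all_analysis.
From mathcomp Require Import complex measurable_realfun.
From mathcomp Require Import ring lra zify.

Import Order.TTheory GRing.Theory Num.Theory.
Local Open Scope ring_scope.

Set Implicit Arguments.
Unset Strict Implicit.
Unset Printing Implicit Defensive.

(** * Moduli and asymptotics of complex sequences *)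

Section Modulus.
Variable R : realType.
Implicit Types x y z : R[i].

Definition nm (z : R[i]) : R := ComplexField.Normc.normc z.

Lemma norm_nm z : `|z| = ((nm z)%:C)%C.
Proof. by rewrite normc_def /nm; case: z. Qed.

Lemma nm_ge0 z : 0 <= nm z.
Proof. by rewrite -ler0c -norm_nm normr_ge0. Qed.

Lemma nmD x y : nm (x + y) <= nm x + nm y.
Proof. exact: le_normcD. Qed.

Lemma nmN x : nm (- x) = nm x.
Proof. exact: normcN. Qed.

Lemma nmB x y : nm (x - y) <= nm x + nm y.
Proof. by rewrite -(nmN y) nmD. Qed.

Lemma nmBC x y : nm (x - y) = nm (y - x).
Proof. by rewrite -nmN opprB. Qed.

Lemma nmM x y : nm (x * y) = nm x * nm y.
Proof. exact: ComplexField.Normc.normcM. Qed.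

Lemma nm0 : nm 0 = 0.
Proof. exact: ComplexField.Normc.normc0. Qed.

Lemma nm1 : nm 1 = 1.
Proof. exact: ComplexField.Normc.normc1. Qed.

Lemma nmV x : nm x^-1 = (nm x)^-1.
Proof. exact: ComplexField.Normc.normcV. Qed.

Lemma nm_eq0 x : (nm x == 0) = (x == 0).
Proof.
by apply/eqP/eqP=> [/ComplexField.Normc.eq0_normc //|->]; rewrite nm0.
Qed.

Lemma nm_real (r : R) : nm (r%:C)%C = `|r|.
Proof. by rewrite /nm /= expr0n addr0 sqrtr_sqr. Qed.

Lemma nm_nat n : nm n%:R = n%:R.
Proof.
have -> : (n%:R : R[i]) = ((n%:R : R)%:C)%C by rewrite raddfMn.
by rewrite nm_real ger0_norm.
Qed.

Lemma nmX x n : nm (x ^+ n) = nm x ^+ n.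
Proof. by elim: n => [|n IH]; rewrite ?expr0 ?nm1 // !exprS nmM IH. Qed.

Lemma nm_conj x : nm (Num.conj x) = nm x.
Proof.
by apply: complexI; rewrite -!norm_nm norm_conjC.
Qed.

Lemma Re_le_nm x : `|complex.Re x| <= nm x.
Proof. by rewrite -lecR -norm_nm normc_ge_Re. Qed.

Lemma Im_le_nm x : `|complex.Im x| <= nm x.
Proof.
have := Re_le_nm (x * 'i%C); rewrite ReiNIm normrN nmM.
by have -> : nm 'i%C = 1 :> R; rewrite ?mulr1 // /nm /= expr0n expr1n add0r sqrtr1.
Qed.

Lemma nm_le_ReIm x : nm x <= `|complex.Re x| + `|complex.Im x|.
Proof.
case: x => a b; rewrite /nm /= -(@ler_pXn2r _ 2) ?nnegrE ?sqrtr_ge0 ?addr_ge0 //.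
rewrite sqr_sqrtr ?addr_ge0 ?sqr_ge0 // sqrrD !real_normK ?num_real //.
by rewrite lerD2r lerDl mulrn_wge0 ?mulr_ge0.
Qed.

Lemma normr_lt z (e : R) : (`|z| < (e%:C)%C) = (nm z < e).
Proof. by rewrite norm_nm ltcR. Qed.

End Modulus.

Section Asymptotics.
Variable R : realType.
Implicit Types (u v : nat -> R[i]) (c d : R[i]).

Lemma cvgCP u c :
  cvgC u c <-> forall e : R, 0 < e -> exists N0 : nat, forall N, (N0 <= N)%N -> nm (u N - c) < e.
Proof.
split=> H e e0.
  have [|N0 HN] := H (e%:C)%C; first by rewrite ltcR.
  by exists N0 => N /HN; rewrite normr_lt.
have er : e = ((complex.Re e)%:C)%C by rewrite RRe_real // ger0_real // ltW.
move: e0; rewrite er ltcR => /H [N0 HN]; exists N0 => N /HN.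
by rewrite normr_lt.
Qed.

Lemma cvgC_cst c : cvgC (fun=> c) c.
Proof. by apply/cvgCP => e e0; exists 0%N => N _; rewrite subrr nm0. Qed.

Lemma cvgC_eq N0 u v c : (forall N, (N0 <= N)%N -> u N = v N) -> cvgC u c -> cvgC v c.
Proof.
move=> uv /cvgCP H; apply/cvgCP => e /H [N1 HN].
exists (maxn N0 N1) => N; rewrite geq_max => /andP[h0 h1].
by rewrite -uv // HN.
Qed.

Lemma cvgCD u v c d : cvgC u c -> cvgC v d -> cvgC (fun N => u N + v N) (c + d).
Proof.
move=> /cvgCP H /cvgCP H'; apply/cvgCP => e e0.
have e2 : 0 < e / 2 by lra.
have [N0 h0] := H _ e2; have [N1 h1] := H' _ e2.
exists (maxn N0 N1) => N; rewrite geq_max => /andP[/h0 a /h1 b].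
have -> : u N + v N - (c + d) = (u N - c) + (v N - d) by ring.
by apply: le_lt_trans (nmD _ _) _; lra.
Qed.

Lemma cvgC_bounded u c : cvgC u c -> exists K : R, forall N, nm (u N) <= K.
Proof.
move=> /cvgCP /(_ 1 ltr01) [N0 h0].
exists (nm c + 1 + \sum_(i < N0) nm (u i)) => N.
case: (ltnP N N0) => [lt|/h0 h].
  rewrite (bigD1 (Ordinal lt)) //=.
  have := nm_ge0 c.
  have : 0 <= \sum_(i < N0 | i != Ordinal lt) nm (u i) by apply: sumr_ge0 => i _; exact: nm_ge0.
  by lra.
have : 0 <= \sum_(i < N0) nm (u i) by apply: sumr_ge0 => i _; exact: nm_ge0.
have := nmD (u N - c) c; rewrite subrK; lra.
Qed.

Lemma cvgC0_bounded u v (K : R) :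
  (forall N, nm (u N) <= K) -> cvgC v 0 -> cvgC (fun N => u N * v N) 0.
Proof.
move=> uK /cvgCP H; apply/cvgCP => e e0.
have K0 : 0 <= K by apply: le_trans (uK 0%N); exact: nm_ge0.
have [|N0 h0] := H (e / (K + 1)); first by apply: divr_gt0 => //; lra.
exists N0 => N /h0; rewrite !subr0 nmM ltr_pdivlMr; last by lra.
move=> h; apply: le_lt_trans h; rewrite mulrC ler_wpM2l ?nm_ge0 //.
by have := uK N; lra.
Qed.

Lemma cvgC_sub0 u c : cvgC u c <-> cvgC (fun N => u N - c) 0.
Proof.
by split=> /cvgCP H; apply/cvgCP => e /H [N0 h]; exists N0 => N /h; rewrite subr0.
Qed.

Lemma cvgCM u v c d : cvgC u c -> cvgC v d -> cvgC (fun N => u N * v N) (c * d).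
Proof.
move=> uc vd; have [K hK] := cvgC_bounded vd.
apply/cvgC_sub0; rewrite -(addr0 0).
apply: (@cvgC_eq 0 (fun N => v N * (u N - c) + c * (v N - d))).
  by move=> N _; ring.
apply: cvgCD; first by apply: cvgC0_bounded hK _; case: (cvgC_sub0 u c) => + _; apply.
by apply: (@cvgC0_bounded (fun=> c) _ (nm c)) => //; case: (cvgC_sub0 v d) => + _; apply.
Qed.

Lemma cvgCZ a u c : cvgC u c -> cvgC (fun N => a * u N) (a * c).
Proof. exact: cvgCM (cvgC_cst a). Qed.

Lemma cvgCB u v c d : cvgC u c -> cvgC v d -> cvgC (fun N => u N - v N) (c - d).
Proof.
move=> uc vd; rewrite -mulN1r; apply: (@cvgC_eq 0 (fun N => u N + -1 * v N)).
  by move=> N _; rewrite mulN1r.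
exact: cvgCD uc (cvgCZ _ vd).
Qed.

Lemma cvgC_sum (I : eqType) (r : seq I) (F : I -> nat -> R[i]) (f : I -> R[i]) :
  (forall i, i \in r -> cvgC (F i) (f i)) ->
  cvgC (fun N => \sum_(i <- r) F i N) (\sum_(i <- r) f i).
Proof.
elim: r => [|i r IH] H.
  by rewrite big_nil; apply: (@cvgC_eq 0 (fun=> 0)) (cvgC_cst _) => N _; rewrite big_nil.
rewrite big_cons; apply: (@cvgC_eq 0 (fun N => F i N + \sum_(j <- r) F j N)).
  by move=> N _; rewrite big_cons.
apply: cvgCD; first by apply: H; rewrite mem_head.
by apply: IH => j jr; apply: H; rewrite inE jr orbT.
Qed.

Lemma cvgC_uniq u c d : cvgC u c -> cvgC u d -> c = d.
Proof.
move=> /cvgCP H /cvgCP H'; apply/eqP; rewrite -subr_eq0 -nm_eq0.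
apply/negPn/negP => n0.
have e0 : 0 < nm (c - d) / 2 by apply: divr_gt0 => //; rewrite lt_neqAle eq_sym n0 nm_ge0.
have [N0 h0] := H _ e0; have [N1 h1] := H' _ e0.
have := h0 _ (leq_maxl N0 N1); have := h1 _ (leq_maxr N0 N1).
set x := u _ => a b.
have := nmD (c - x) (x - d); rewrite (nmBC c) addrA subrK; lra.
Qed.

(* The index [0] is excluded so that [N] can be inverted. *)
Definition bigON (p : nat) (u : nat -> R[i]) : Prop :=
  exists K : R, forall N, (0 < N)%N -> nm (u N) * N%:R ^+ p <= K.

Lemma bigON_eq p u v : (forall N, (0 < N)%N -> u N = v N) -> bigON p u -> bigON p v.
Proof. by move=> uv [K h]; exists K => N N0; rewrite -uv // h. Qed.

Lemma bigON_nm p u v : (forall N, (0 < N)%N -> nm (v N) <= nm (u N)) -> bigON p u -> bigON p v.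
Proof.
move=> uv [K h]; exists K => N N0; apply: le_trans (h N N0).
by rewrite ler_wpM2r ?exprn_ge0 ?uv.
Qed.

Lemma bigOND p u v : bigON p u -> bigON p v -> bigON p (fun N => u N + v N).
Proof.
move=> [K h] [L h']; exists (K + L) => N N0; apply: le_trans (lerD (h N N0) (h' N N0)).
by rewrite -mulrDl ler_wpM2r ?exprn_ge0 ?nmD.
Qed.

Lemma bigONM p q u v : bigON p u -> bigON q v -> bigON (p + q) (fun N => u N * v N).
Proof.
move=> [K h] [L h']; exists (K * L) => N N0.
by rewrite nmM exprD mulrACA ler_pM ?mulr_ge0 ?nm_ge0 ?exprn_ge0 ?h ?h'.
Qed.

Lemma bigON_cst c : bigON 0 (fun=> c).
Proof. by exists (nm c) => N _; rewrite expr0 mulr1. Qed.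

Lemma bigONZ p c u : bigON p u -> bigON p (fun N => c * u N).
Proof. exact: bigONM (bigON_cst c). Qed.

Lemma bigONB p u v : bigON p u -> bigON p v -> bigON p (fun N => u N - v N).
Proof.
move=> hu hv; apply: bigON_eq (bigOND hu (bigONZ (-1) hv)) => N _.
by rewrite mulN1r.
Qed.

Lemma bigON0 p : bigON p (fun=> 0).
Proof. by exists 0 => N _; rewrite nm0 mul0r. Qed.

Lemma bigON_sum p (I : eqType) (r : seq I) (F : I -> nat -> R[i]) :
  (forall i, i \in r -> bigON p (F i)) -> bigON p (fun N => \sum_(i <- r) F i N).
Proof.
elim: r => [|i r IH] H.
  by apply: bigON_eq (bigON0 p) => N _; rewrite big_nil.
apply: (@bigON_eq _ (fun N => F i N + \sum_(j <- r) F j N)).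
  by move=> N _; rewrite big_cons.
apply: bigOND; first by apply: H; rewrite mem_head.
by apply: IH => j jr; apply: H; rewrite inE jr orbT.
Qed.

Lemma bigONW p q u : (q <= p)%N -> bigON p u -> bigON q u.
Proof.
move=> qp [K h]; exists K => N N0; apply: le_trans (h N N0).
rewrite ler_wpM2l ?nm_ge0 // ler_weXn2l // ?ler1n //.
Qed.

Lemma bigON_inv p : bigON p (fun N => (N%:R ^+ p)^-1).
Proof.
exists 1 => N N0; rewrite nmV nmX nm_nat mulVf // expf_neq0 //.
by rewrite pnatr_eq0 -lt0n.
Qed.

Lemma bigON_cvg0 u : bigON 1 u -> cvgC u 0.
Proof.
move=> [K h]; apply/cvgCP => e e0.
have [M hM] : exists M : nat, `|K| / e < M%:R.
  by exists (Num.bound (`|K| / e)); apply: archi_boundP; apply: divr_ge0 => //; exact: ltW.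
exists M.+1 => N MN; have N0 : (0 < N)%N by apply: leq_trans MN.
have NR : (0 : R) < N%:R by rewrite ltr0n.
have {}hM : `|K| / e < N%:R by apply: lt_trans hM _; rewrite ltr_nat.
move: hM; rewrite ltr_pdivrMr // => hM.
have := h N N0; rewrite expr1 subr0 => hK.
have := ler_norm K => hK'.
by rewrite -(ltr_pM2r NR); lra.
Qed.

Lemma cvgC_bigON u c : cvgC u c -> bigON 0 u.
Proof. by move=> /cvgC_bounded[K h]; exists K => N _; rewrite expr0 mulr1. Qed.

End Asymptotics.

(** * Abstract loop equations *)

Section Cuts.
Variable T : eqType.
Implicit Types (s : seq T) (G : seq (seq T)).

Fixpoint cuts s : seq (seq (seq T)) :=
  if s is t :: s' then
    flatten [seq ([:: t] :: c) :: (if c is w :: c' then [:: (t :: w) :: c'] else [::])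
            | c <- cuts s']
  else [:: [::]].

Lemma cutsP G : [::] \notin G -> G \in cuts (flatten G).
Proof.
move: {2}(flatten G) (erefl (flatten G)) => s; elim: s G => [|t s IH] [|[|t' w] G] //=.
move=> [-> {t'} fl] G0; rewrite fl /=.
have {}G0 : [::] \notin G by move: G0; rewrite inE.
case: w fl => [|a w] /= fl.
  apply/flattenP; exists ([:: [:: t] :: G] ++ (if G is w :: c' then [:: (t :: w) :: c'] else [::])).
    by apply/mapP; exists G; rewrite // -fl IH.
  by rewrite /= mem_head.
apply/flattenP; exists [:: [:: t] :: (a :: w) :: G; (t :: a :: w) :: G].
  by apply/mapP; exists ((a :: w) :: G); rewrite // -fl; apply: (IH ((a :: w) :: G)); rewrite ?inE.
by rewrite !inE eqxx orbT.
Qed.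

(** Reading the words of a configuration one after the other gives a permutation of [s], so cutting
    all permutations reaches every configuration. Repetitions in the list are harmless: it only
    serves as a finite index set for upper bounds. *)
Definition configs s : seq (seq (seq T)) :=
  [seq G <- flatten [seq cuts p | p <- permutations s] | ([::] \notin G) && perm_eq (flatten G) s].

Lemma mem_configs s G : (G \in configs s) = ([::] \notin G) && perm_eq (flatten G) s.
Proof.
rewrite mem_filter andb_idr // => /andP[G0 Gs].
apply/flattenP; exists (cuts (flatten G)); last exact: cutsP.
by apply/map_f; rewrite mem_permutations.
Qed.

End Cuts.

Section LoopEquations.
Variables (R : realType) (T : eqType) (mk kd : T -> bool).
Local Notation word := (seq T).
Local Notation config := (seq (seq T)).
(** In the application [x N G] is the expectation of the product of the normalized traces of the
    words of [G]. Pure words have deterministic traces, which is why they can be factored out. *)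
Variable x : nat -> config -> R[i].

Definition pure (w : word) := all kd w || all (predC kd) w.

(** Differentiating [tr Q] at a letter produces a commutator with that letter: the cyclic word [Q]
    is opened just before or just after it and [P] is inserted there. Hence the rotations by [i] and
    [i.+1], with opposite signs. *)
Definition merge_terms kappa (P Q : word) : seq (R[i] * word) :=
  flatten [seq [:: (1, P ++ rot i Q); (-1, P ++ rot i.+1 Q)]
          | i <- [seq i <- iota 0 (size Q) | nth false (map kd Q) i == kappa]].

Fixpoint merge_config (M : word -> seq (R[i] * word)) (G : config) : seq (R[i] * config) :=
  if G is Q :: G' then
    [seq (p.1, p.2 :: G') | p <- M Q] ++ [seq (p.1, Q :: p.2) | p <- merge_config M G']
  else [::].

Hypothesis x_perm : forall N G G', perm_eq G G' -> x N G = x N G'.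
Hypothesis x_rot : forall N u v G, x N ((u ++ v) :: G) = x N ((v ++ u) :: G).
Hypothesis x_pure : forall N W G, (0 < N)%N -> pure W -> x N (W :: G) = x N [:: W] * x N G.
Hypothesis x_nil : forall N, (0 < N)%N -> x N [::] = 1.
Hypothesis x_nilw : forall N, (0 < N)%N -> x N [:: [::]] = 1.
Hypothesis x_loop : forall N kappa P G, (0 < N)%N ->
  N%:R ^+ 2 * (\sum_(i <- iota 0 (size P) | nth false (map kd P) i == kappa)
    (x N (take i P :: drop i P :: G) - x N (take i.+1 P :: drop i.+1 P :: G)))
  + \sum_(p <- merge_config (merge_terms kappa P) G) p.1 * x N p.2 = 0.

(** The position 0 of the loop equation contributes the empty word next to the whole word, which is
    the unknown, minus the cut after the first letter. The equation is solved for this unknown. *)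
Lemma loop_split N (t : T) w G : (0 < N)%N -> kd (last t w) != kd t ->
  x N ((t :: w) :: G) = x N ([:: t] :: w :: G)
   - \sum_(i <- iota 1 (size w) | nth false (map kd (t :: w)) i == kd t)
       (x N (take i (t :: w) :: drop i (t :: w) :: G)
        - x N (take i.+1 (t :: w) :: drop i.+1 (t :: w) :: G))
   - N%:R ^- 2 * \sum_(p <- merge_config (merge_terms (kd t) (t :: w)) G) p.1 * x N p.2.
Proof.
move=> N0 _; have := x_loop (kd t) (t :: w) G N0.
rewrite [iota 0 _]/= big_cons [nth _ _ _]/= eqxx take0 drop0.
rewrite (x_pure _ N0 (_ : pure [::])) // x_nilw // mul1r [take 1 _]/= take0 [drop 1 _]/= drop0.
set A := x N _; set B := x N _; set S := bigop _ _ _; set M := bigop _ _ _ => E.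
have NR : (N%:R : R[i]) != 0 by rewrite pnatr_eq0 -lt0n.
have N2 : (N%:R ^+ 2 : R[i]) != 0 by rewrite expf_neq0.
apply: (mulfI N2); rewrite !mulrBr mulVKf //.
have : N%:R ^+ 2 * A = N%:R ^+ 2 * (A - B + S) + M - M + N%:R ^+ 2 * (B - S) by ring.
by rewrite E => ->; ring.
Qed.

Definition nontriv_split (P : word) (S : seq (R[i] * (word * word))) :=
  forall c, c \in S -> [/\ c.2.1 != [::], c.2.2 != [::] & perm_eq (c.2.1 ++ c.2.2) P].

Definition merging (P : word) (M : word -> seq (R[i] * word)) :=
  forall Q c, c \in M Q -> perm_eq c.2 (P ++ Q).

Lemma merge_termsP kappa P : merging P (merge_terms kappa P).
Proof.
move=> Q c /flattenP[/= l /mapP[i _ ->]].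
by rewrite !inE => /orP[] /eqP -> /=; rewrite perm_cat2l perm_rot.
Qed.


Lemma rot_nonpure P : ~~ pure P ->
  exists t w, [/\ perm_eq (t :: w) P, kd (last t w) != kd t &
                  forall N G, x N (P :: G) = x N ((t :: w) :: G)].
Proof.
rewrite /pure negb_or -!has_predC => /andP[/hasP[a aP /= ka] /hasP[b bP /=]].
rewrite negbK => kb; case/splitPr: aP bP => P1 P2 bP.
(* This rotation ends with the letter [a] of kind [false]. The letter that cyclically precedes the
   first letter of kind [true], at position [j], is therefore of kind [false] even when [j = 0]. *)
pose s := P2 ++ rcons P1 a.
have bs : b \in s by move: bP; rewrite /s -cat_rcons !mem_cat orbC.
have hs : has kd s by apply/hasP; exists b.
pose j := find kd s.
have js : (j < size s)%N by rewrite -has_find.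
have ds : drop j s = nth b s j :: drop j.+1 s by exact: drop_nth.
have kj : kd (nth b s j) by exact: nth_find.
exists (nth b s j), (drop j.+1 s ++ take j s); rewrite -cat_cons -ds; split.
- rewrite perm_catC cat_take_drop /s -cat_rcons perm_catC perm_refl //.
- rewrite kj eqb_id last_cat.
  case: (posnP j) => [j0|j0].
    rewrite j0 take0 /=.
    have -> : last (nth b s 0) (drop 1 s) = last b s.
      by case: (s) (js) => //= y l _; rewrite drop0.
    by rewrite /s last_cat last_rcons.
  have sj : size (take j s) = j by rewrite size_take js.
  rewrite -nth_last sj (set_nth_default b) ?sj ?prednK // nth_take ?prednK //.
  by rewrite before_find // prednK.
- by move=> N G; rewrite -cat_rcons x_rot -/s -(cat_take_drop j s) x_rot cat_take_drop.
Qed.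

Lemma loop_reduce P : ~~ pure P -> exists S M, [/\ nontriv_split P S, merging P M &
  forall N G, (0 < N)%N -> x N (P :: G) =
    \sum_(c <- S) c.1 * x N (c.2.1 :: c.2.2 :: G)
    - N%:R ^- 2 * \sum_(p <- merge_config M G) p.1 * x N p.2].
Proof.
move=> /rot_nonpure[t [w [tw lw xP]]].
pose I := [seq i <- iota 1 (size w) | nth false (map kd (t :: w)) i == kd t].
pose S : seq (R[i] * (word * word)) := (1, ([:: t], w)) ::
  flatten [seq [:: (-1, (take i (t :: w), drop i (t :: w)));
                   (1, (take i.+1 (t :: w), drop i.+1 (t :: w)))] | i <- I].
have w0 : w != [::] by apply: contra_neq lw => ->; rewrite /= .
exists S, (merge_terms (kd t) (t :: w)); split.
- move=> c; rewrite inE => /orP[/eqP -> //|/flattenP[l /mapP[i iI ->]]].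
  move: iI; rewrite mem_filter mem_iota => /andP[/eqP ki /andP[i1 iw]].
  (* A cut after the last letter would leave an empty word; it cannot occur, the last letter being
     of the other kind. *)
  have iw' : (i < size w)%N.
    move: iw; rewrite add1n ltnS leq_eqVlt => /orP[/eqP iE|//].
    case: i i1 iE ki => //= i _ iE; rewrite (nth_map t) -?iE // => ki.
    by move: lw; rewrite -nth_last -iE /= ki eqxx.
  rewrite !inE => /orP[] /eqP -> /=; rewrite cat_take_drop tw; split=> //.
  + by case: i i1 {ki iw iw'}.
  + by rewrite -size_eq0 size_drop /= subn_eq0 -ltnNge.
  + by rewrite -size_eq0 size_drop subn_eq0 -ltnNge.
- by move=> Q c /merge_termsP /permPl ->; rewrite perm_cat2r.
- move=> N G N0; rewrite xP loop_split // /S big_cons mul1r; congr (_ - _).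
  congr (_ + _); rewrite big_flatten big_map /= -big_filter -sumrN.
  by apply: eq_bigr => i _; rewrite !big_cons big_nil /= mul1r mulN1r addr0 opprB addrC.
Qed.

(* Marked letters stand for elements of the ideals: the normalized trace of a pure word
   containing one is O(1/N), and the weight compensates for this. *)
Definition wt (N : nat) (w : word) : nat := if has mk w then N else 1.
Definition wtc (N : nat) (G : config) : nat := (\prod_(w <- G) wt N w)%N.

Lemma wtc_cons N w G : wtc N (w :: G) = (wt N w * wtc N G)%N.
Proof. by rewrite /wtc big_cons. Qed.

Lemma wt_gt0 N w : (0 < N)%N -> (0 < wt N w)%N.
Proof. by rewrite /wt; case: ifP. Qed.

Lemma wt_perm N u v : perm_eq u v -> wt N u = wt N v.
Proof. by move=> uv; rewrite /wt (perm_has _ uv). Qed.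

Lemma wtc_perm N G G' : perm_eq G G' -> wtc N G = wtc N G'.
Proof. exact: perm_big. Qed.

Lemma wt_split N u v : (0 < N)%N -> (wt N (u ++ v) <= wt N u * wt N v)%N.
Proof. by move=> N0; rewrite /wt has_cat; case: (has _ u) (has _ v) => [] [] /=; nia. Qed.

(** The worst case is that of two marked words becoming one, which loses one factor [N]. Against the
    [N^-2] of the loop equation a gain of 1/N remains. *)
Lemma wt_merge N u v : (0 < N)%N -> (wt N u * wt N v <= N * wt N (u ++ v))%N.
Proof. by move=> N0; rewrite /wt has_cat; case: (has _ u) (has _ v) => [] [] /=; nia. Qed.

Lemma merge_configP P M G p : merging P M -> p \in merge_config M G ->
  [/\ P != [::] -> [::] \notin G -> [::] \notin p.2,
      perm_eq (flatten p.2) (P ++ flatten G) &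
      forall N, (0 < N)%N -> (wtc N (P :: G) <= N * wtc N p.2)%N].
Proof.
move=> hM; elim: G p => [//|Q G IH] p /=; rewrite mem_cat => /orP[] /mapP[q qM ->] /=.
  have qPQ := hM _ _ qM; split.
  - move=> P0; rewrite !inE !negb_or => /andP[_ ->]; rewrite andbT eq_sym -size_eq0.
    by rewrite (perm_size qPQ) size_cat addn_eq0 size_eq0 negb_and P0.
  - by rewrite catA perm_cat2r.
  - move=> N N0; rewrite !wtc_cons mulnA mulnA leq_mul2r (wt_perm _ qPQ).
    by rewrite wt_merge // orbT.
have [h1 h2 h3] := IH _ qM; split.
- by move=> P0; rewrite !inE !negb_or => /andP[-> /(h1 P0)].
- rewrite (perm_trans (_ : perm_eq _ (Q ++ (P ++ flatten G)))) ?perm_cat2l //.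
  by rewrite perm_catCA.
- move=> N N0; have := h3 N N0; rewrite !wtc_cons => h.
  by rewrite mulnCA [leqRHS]mulnCA leq_mul2l h orbT.
Qed.

Lemma bigON_wt p (a b : nat -> nat) (y : nat -> R[i]) :
  (forall N, (0 < N)%N -> (a N <= b N)%N) ->
  bigON p (fun N => (b N)%:R * y N) -> bigON p (fun N => (a N)%:R * y N).
Proof.
move=> ab; apply: bigON_nm => N N0.
by rewrite !nmM !nm_nat ler_wpM2r ?nm_ge0 // ler_nat ab.
Qed.

Lemma bigON_wt_inv p (a b : nat -> nat) (y : nat -> R[i]) :
  (forall N, (0 < N)%N -> (a N <= N * b N)%N) ->
  bigON p (fun N => (b N)%:R * y N) -> bigON p.+1 (fun N => N%:R ^- 2 * ((a N)%:R * y N)).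
Proof.
move=> ab [K h]; exists K => N N0; apply: le_trans (h N N0).
rewrite !nmM nmV nmX !nm_nat (exprS _ p).
have NR : (0 : R) < N%:R by rewrite ltr0n.
have := ab N N0; rewrite -(ler_nat R) natrM => H.
have -> : ((N%:R ^+ 2)^-1 * ((a N)%:R * nm (y N)) * (N%:R * N%:R ^+ p))
         = (a N)%:R / N%:R * nm (y N) * N%:R ^+ p :> R.
  move: (nm _) (_ ^+ p) (a N)%:R => c e f; field; exact: lt0r_neq0.
apply: ler_wpM2r; rewrite ?exprn_ge0 //; apply: ler_wpM2r; first exact: nm_ge0.
by rewrite ler_pdivrMr // mulrC.
Qed.

(** A split adds a word and keeps the letters, so it lowers this number; a merge raises it, so
    merges can never be treated by the induction. The subtraction is exact as soon as no word is
    empty. *)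
Definition defect (G : config) := (size (flatten G) - size G)%N.

Lemma size_config_le (G : config) : [::] \notin G -> (size G <= size (flatten G))%N.
Proof.
elim: G => //= w G IH; rewrite inE negb_or => /andP[w0 /IH].
by rewrite size_cat; case: w w0 => //= a w _; lia.
Qed.

Lemma defect_split (P u v : word) G : [::] \notin P :: G -> u != [::] -> v != [::] ->
  perm_eq (u ++ v) P ->
  [/\ [::] \notin u :: v :: G, perm_eq (flatten (u :: v :: G)) (flatten (P :: G)) &
      (defect (u :: v :: G) < defect (P :: G))%N].
Proof.
move=> PG u0 v0 uvP.
have /andP[P0 G0] : ([::] != P) && ([::] \notin G) by rewrite -negb_or -in_cons.
have ne : [::] \notin u :: v :: G by rewrite !inE !negb_or eq_sym u0 eq_sym v0.
have pe : perm_eq (flatten (u :: v :: G)) (flatten (P :: G)) by rewrite /= catA perm_cat2r.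
have H := size_config_le ne; have H0 := perm_size pe.
by split; [exact: ne|exact: pe|rewrite /defect; move: H H0 => /=; lia].
Qed.

Lemma nonpure_config (G : config) : ~~ all pure G ->
  exists P G', ~~ pure P /\ perm_eq G (P :: G').
Proof.
by rewrite -has_predC => /hasP[P PG nP]; exists P, (rem P G); rewrite perm_to_rem.
Qed.

(** The comparison function will itself contain the unknown moments, since no explicit rate is known
    at this stage. *)
Definition dominated (g : nat -> R) (u : nat -> R[i]) :=
  exists2 K : R, 0 <= K & forall N, (0 < N)%N -> nm (u N) <= K * g N.

Lemma dominated_sum (g : nat -> R) (I : eqType) (r : seq I) (F : I -> nat -> R[i]) :
  (forall N, 0 <= g N) ->
  (forall i, i \in r -> dominated g (F i)) -> dominated g (fun N => \sum_(i <- r) F i N).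
Proof.
move=> g0; elim: r => [|i r IH] H.
  by exists 0 => // N _; rewrite big_nil nm0 mul0r.
have [K K0 hK] := H i (mem_head _ _).
have [|L L0 hL] := IH; first by move=> j jr; apply: H; rewrite inE jr orbT.
exists (K + L) => [|N N0]; first exact: addr_ge0.
by rewrite big_cons (le_trans (nmD _ _)) // mulrDl lerD ?hK ?hL.
Qed.

Lemma dominatedZ (g : nat -> R) (c : R[i]) u : dominated g u -> dominated g (fun N => c * u N).
Proof.
move=> [K K0 h]; exists (nm c * K) => [|N N0]; first by rewrite mulr_ge0 ?nm_ge0.
by rewrite nmM -mulrA ler_wpM2l ?nm_ge0 ?h.
Qed.

Lemma dominatedB (g : nat -> R) u v :
  dominated g u -> dominated g v -> dominated g (fun N => u N - v N).
Proof.
move=> [K K0 h] [L L0 h']; exists (K + L) => [|N N0]; first exact: addr_ge0.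
by rewrite (le_trans (nmB _ _)) // mulrDl lerD ?h ?h'.
Qed.

Lemma dominated_eq (g : nat -> R) u v : (forall N, (0 < N)%N -> u N = v N) ->
  dominated g u -> dominated g v.
Proof. by move=> uv [K K0 h]; exists K => // N N0; rewrite -uv // h. Qed.

Lemma dominated_nm (g : nat -> R) u v : (forall N, (0 < N)%N -> nm (v N) <= nm (u N)) ->
  dominated g u -> dominated g v.
Proof. by move=> uv [K K0 h]; exists K => // N N0; apply: le_trans (h N N0); apply: uv. Qed.

(** Beyond [2 * K] the term [K * (b N / N)] is at most half of [b N] and is absorbed on the left,
    which gives [b N <= 2 * K]. The finitely many smaller indices are covered by a finite sum. *)
Lemma self_bounded (b : nat -> R) (K : R) : 0 <= K -> (forall N, 0 <= b N) ->
  (forall N, (0 < N)%N -> b N <= K * (1 + b N / N%:R)) -> exists L, forall N, b N <= L.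
Proof.
move=> K0 b0 h.
have [M hM] : exists M : nat, 2 * K < M%:R.
  by exists (Num.bound (2 * K)); apply: archi_boundP; apply: mulr_ge0.
exists (2 * K + \sum_(i < M.+1) b i) => N.
case: (ltnP N M.+1) => [lt|NM].
  rewrite (bigD1 (Ordinal lt)) //=.
  have : 0 <= \sum_(i < M.+1 | i != Ordinal lt) b i by apply: sumr_ge0.
  by lra.
have N0 : (0 < N)%N by apply: leq_trans NM.
have NR : (0 : R) < N%:R by rewrite ltr0n.
have : 0 <= \sum_(i < M.+1) b i by apply: sumr_ge0.
have KN : 2 * K <= N%:R by apply: (le_trans (ltW hM)); rewrite ler_nat ltnW.
suff : K * (b N / N%:R) <= b N / 2 by have := h N N0; rewrite mulrDr; lra.
rewrite mulrCA ler_wpM2l // ler_pdivrMr //; lra.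
Qed.

Definition wx N (G : config) : R[i] := (wtc N G)%:R * x N G.

Lemma wx_perm N G G' : perm_eq G G' -> wx N G = wx N G'.
Proof. by move=> h; rewrite /wx (x_perm _ h) (wtc_perm _ h). Qed.

Hypothesis wx_pure_bounded : forall W, pure W -> bigON 0 (fun N => wx N [:: W]).

Lemma wx_all_pure_bounded G : all pure G -> bigON 0 (fun N => wx N G).
Proof.
elim: G => [_|W G IH /= /andP[pW /IH hG]].
  apply: (@bigON_eq _ _ (fun=> 1)) (bigON_cst 1) => N N0.
  by rewrite /wx /wtc big_nil x_nil // mulr1.
have hW := wx_pure_bounded pW.
apply: bigON_eq (bigONM hW hG) => N N0.
by rewrite /wx (x_pure G N0 pW) !wtc_cons [wtc N [::]]/wtc big_nil muln1 natrM mulrACA.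
Qed.

Lemma bigON_dominated u : bigON 0 u -> dominated (fun=> 1) u.
Proof.
move=> [K h]; exists `|K| => // N N0; rewrite mulr1.
by apply: le_trans (ler_norm K); have := h N N0; rewrite expr0 mulr1.
Qed.

(* Splitting a word decreases the defect, while the merging terms cost a factor 1/N and
   stay in the finite set of configurations with the same letters: the sum [b N] of all
   of them satisfies [b N <= K * (1 + b N / N)]. *)
Lemma wx_bounded G : [::] \notin G -> bigON 0 (fun N => wx N G).
Proof.
move=> G0; pose s := flatten G.
pose b N := \sum_(H <- configs s) nm (wx N H).
have b0 N : 0 <= b N by apply: sumr_ge0 => H _; exact: nm_ge0.
pose g N := 1 + b N / N%:R.
have g0 N : 0 <= g N by rewrite addr_ge0 // divr_ge0.
have wxb H N : H \in configs s -> nm (wx N H) <= b N.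
  move=> Hs; rewrite /b (big_rem H) //= lerDl.
  by apply: sumr_ge0 => ? _; exact: nm_ge0.
have main n H : (defect H < n)%N -> H \in configs s -> dominated g (fun N => wx N H).
  elim: n H => [//|n IH] H Hn Hs.
  case: (boolP (all pure H)) => [/wx_all_pure_bounded /bigON_dominated[K K0 h]|].
    exists K => // N N0; apply: le_trans (h N N0) _; apply: ler_wpM2l => //.
    by rewrite /g lerDl divr_ge0.
  move=> /nonpure_config[P [G' [nP HP]]].
  have [PG0 PGs] : [::] \notin P :: G' /\ perm_eq (flatten (P :: G')) s.
    move: Hs; rewrite mem_configs (perm_mem HP) => /andP[-> Hs]; split=> //.
    by rewrite -(permPl (perm_flatten HP)).
  have dP : defect (P :: G') = defect H.
    by rewrite /defect (perm_size HP) (perm_size (perm_flatten HP)).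
  have [S [M [hS hM E]]] := loop_reduce nP.
  apply: (@dominated_eq _ (fun N => \sum_(c <- S) c.1 * ((wtc N (P :: G'))%:R * x N (c.2.1 :: c.2.2 :: G'))
     - \sum_(p <- merge_config M G') p.1 * (N%:R ^- 2 * ((wtc N (P :: G'))%:R * x N p.2)))).
    move=> N N0; rewrite (wx_perm _ HP) /wx E // mulrBr !mulr_sumr; congr (_ - _).
      by apply: eq_bigr => c _; rewrite mulrCA.
    apply: eq_bigr => p _.
    by rewrite mulrCA [RHS]mulrCA; congr (_ * _); exact: mulrCA.
  apply: dominatedB; apply: dominated_sum => // c cS; apply: dominatedZ.
    have [u0 v0 uvP] := hS _ cS.
    have [ne pe lt] := defect_split PG0 u0 v0 uvP.
    apply: dominated_nm (IH (c.2.1 :: c.2.2 :: G') _ _).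
    - move=> N N0; rewrite /wx !nmM !nm_nat ler_wpM2r ?nm_ge0 // ler_nat.
      rewrite !wtc_cons mulnA leq_mul2r; apply/orP; right.
      by rewrite -(wt_perm _ uvP) wt_split.
    - by apply: leq_trans lt _; rewrite dP -ltnS.
    - by rewrite mem_configs ne /= (permPl pe).
  move: PG0; rewrite inE negb_or eq_sym => /andP[P0 G'0].
  have [h1 h2 h3] := merge_configP hM cS.
  exists 1 => // N N0; rewrite mul1r.
  have cs : c.2 \in configs s by rewrite mem_configs h1 //= (permPl h2).
  have NR : (0 : R) < N%:R by rewrite ltr0n.
  have : nm (N%:R ^- 2 * ((wtc N (P :: G'))%:R * x N c.2)) <= nm (wx N c.2) / N%:R.
    rewrite /wx !nmM nmV nmX !nm_nat.
    have := h3 N N0; rewrite -(ler_nat R) natrM => h.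
    rewrite [leRHS](_ : _ = (N%:R ^+ 2)^-1 * (N%:R * (wtc N c.2)%:R * nm (x N c.2))).
      by rewrite ler_wpM2l ?invr_ge0 ?exprn_ge0 // ler_wpM2r // nm_ge0.
    by move: (nm _) (_%:R) NR => ? e ?; field; rewrite lt0r_neq0.
  move=> h; apply: le_trans h _; rewrite /g.
  apply: (@le_trans _ _ (b N / N%:R)); last by rewrite lerDr.
  by rewrite ler_wpM2r ?invr_ge0 // wxb.
have Gs : G \in configs s by rewrite mem_configs G0 perm_refl.
have [K K0 hK] : exists2 K : R, 0 <= K & forall N, (0 < N)%N -> b N <= K * g N.
  rewrite /b; move: (configs s) main => cs main.
  have {main} : forall H, H \in cs -> dominated g (fun N => wx N H).
    by move=> H; apply: main (ltnSn _).
  elim: cs => [|H cs IH] h.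
    by exists 0 => // N _; rewrite big_nil mul0r.
  have [K K0 hK] := h H (mem_head _ _).
  have [|L L0 hL] := IH; first by move=> J Jr; apply: h; rewrite inE Jr orbT.
  exists (K + L) => [|N N0]; first exact: addr_ge0.
  by rewrite big_cons mulrDl lerD ?hK ?hL.
have [L hL] := self_bounded K0 b0 hK.
exists L => N N0; rewrite expr0 mulr1; apply: le_trans (hL N); exact: wxb.
Qed.

(** The induction is that of the bound. Since boundedness is now available, the factor [N^-2] makes
    the merging terms vanish and only the splits contribute to the limit. It is used with [rho]
    equal to 1, and to [N] for words with a marked letter. *)
Lemma cvg_configs (rho : nat -> R[i]) (s : seq T) :
  (forall G, G \in configs s -> bigON 0 (fun N => rho N * x N G)) ->
  (forall G, G \in configs s -> all pure G -> exists c, cvgC (fun N => rho N * x N G) c) ->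
  forall G, G \in configs s -> exists c, cvgC (fun N => rho N * x N G) c.
Proof.
move=> bd pc.
have main n H : (defect H < n)%N -> H \in configs s -> exists c, cvgC (fun N => rho N * x N H) c.
  elim: n H => [//|n IH] H Hn Hs.
  case: (boolP (all pure H)) => [/pc|]; first exact.
  move=> /nonpure_config[P [G' [nP HP]]].
  have [PG0 PGs] : [::] \notin P :: G' /\ perm_eq (flatten (P :: G')) s.
    move: Hs; rewrite mem_configs (perm_mem HP) => /andP[-> Hs]; split=> //.
    by rewrite -(permPl (perm_flatten HP)).
  have dP : defect (P :: G') = defect H.
    by rewrite /defect (perm_size HP) (perm_size (perm_flatten HP)).
  have [S [M [hS hM E]]] := loop_reduce nP.
  (* The membership stands under the existential so that [choice] yields a limit for every [c]. *)
  have hT c : exists l, c \in S -> cvgC (fun N => rho N * x N (c.2.1 :: c.2.2 :: G')) l.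
    case: (boolP (c \in S)) => [cS|_]; last by exists 0.
    have [u0 v0 uvP] := hS _ cS.
    have [ne pe lt] := defect_split PG0 u0 v0 uvP.
    have [||l hl] := IH (c.2.1 :: c.2.2 :: G').
    - by apply: leq_trans lt _; rewrite dP -ltnS.
    - by rewrite mem_configs ne /= (permPl pe).
    by exists l.
  have [f hf] := choice hT.
  exists (\sum_(c <- S) c.1 * f c - \sum_(p <- merge_config M G') 0).
  apply: (@cvgC_eq _ 1 (fun N => \sum_(c <- S) c.1 * (rho N * x N (c.2.1 :: c.2.2 :: G'))
     - \sum_(p <- merge_config M G') p.1 * (N%:R ^- 2 * (rho N * x N p.2)))).
    move=> N N0; rewrite (x_perm _ HP) E // mulrBr !mulr_sumr; congr (_ - _).
      by apply: eq_bigr => c _; rewrite mulrCA.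
    apply: eq_bigr => p _.
    by rewrite mulrCA [RHS]mulrCA; congr (_ * _); exact: mulrCA.
  apply: cvgCB; apply: cvgC_sum => c cS; first by apply: cvgCZ; exact: hf.
  apply: bigON_cvg0; apply: (@bigONW _ 2) => //; apply: bigONZ.
  move: PG0; rewrite inE negb_or eq_sym => /andP[P0 G'0].
  have [h1 h2 h3] := merge_configP hM cS.
  apply: (@bigONM _ 2 0) (bd _ _); first exact: bigON_inv.
  by rewrite mem_configs h1 //= (permPl h2).
by move=> G; apply: main (ltnSn _).
Qed.

(* [kap N G Fs] is the abstract form of E[prod_(w in G) tr w * prod_(f in Fs) (tr f - E tr f)]. *)
Fixpoint kap N (G Fs : config) : R[i] :=
  if Fs is f :: Fs' then kap N (f :: G) Fs' - x N [:: f] * kap N G Fs' else x N G.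

(** Covariance of the traces of [G] with the product of the centred traces. It vanishes when all
    words of [G] are pure, which is what starts the induction on the defect. *)
Definition ckap N (G Fs : config) : R[i] := kap N G Fs - x N G * kap N [::] Fs.

Lemma kap_perm N G G' Fs : perm_eq G G' -> kap N G Fs = kap N G' Fs.
Proof.
elim: Fs G G' => [|f Fs IH] G G' h /=; first exact: x_perm.
by rewrite (IH _ _ h) (IH (f :: G) (f :: G')) // perm_cons.
Qed.

Lemma kap_pure N W G Fs : (0 < N)%N -> pure W -> kap N (W :: G) Fs = x N [:: W] * kap N G Fs.
Proof.
move=> N0 pW; elim: Fs G => [|f Fs IH] G /=; first exact: x_pure.
rewrite (@kap_perm N (f :: W :: G) (W :: f :: G)); last first.
  by apply/permP => a /=; rewrite addnCA.
by rewrite !IH; ring.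
Qed.

Lemma kap_all_pure N G Fs : (0 < N)%N -> all pure G -> kap N G Fs = x N G * kap N [::] Fs.
Proof.
move=> N0; elim: G => [_|W G IH /= /andP[pW /IH hG]]; first by rewrite x_nil // mul1r.
by rewrite (kap_pure G Fs N0 pW) hG mulrA -(x_pure G N0 pW).
Qed.

(** A centred trace has the same derivative as the trace itself, its mean being constant.
    Differentiating [f] removes it from the centred list and leaves a merged word that is no longer
    centred. *)
Fixpoint merge_centered (M : word -> seq (R[i] * word)) (Fs : config) :
    seq (R[i] * (word * config)) :=
  if Fs is f :: Fs' then
    [seq (p.1, (p.2, Fs')) | p <- M f] ++
    [seq (p.1, (p.2.1, f :: p.2.2)) | p <- merge_centered M Fs']
  else [::].

Lemma kap_reduce P S M :
  (forall N G, (0 < N)%N -> x N (P :: G) =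
    \sum_(c <- S) c.1 * x N (c.2.1 :: c.2.2 :: G)
    - N%:R ^- 2 * \sum_(p <- merge_config M G) p.1 * x N p.2) ->
  forall N G Fs, (0 < N)%N -> kap N (P :: G) Fs =
    \sum_(c <- S) c.1 * kap N (c.2.1 :: c.2.2 :: G) Fs
    - N%:R ^- 2 * (\sum_(p <- merge_config M G) p.1 * kap N p.2 Fs
                   + \sum_(p <- merge_centered M Fs) p.1 * kap N (p.2.1 :: G) p.2.2).
Proof.
move=> E N G Fs N0; elim: Fs G => [|f Fs IH] G /=; first by rewrite big_nil addr0 E.
rewrite (@kap_perm N (f :: P :: G) (P :: f :: G)); last first.
  by apply/permP => a /=; rewrite addnCA.
rewrite !IH /= !big_cat !big_map /=.
set X1 := bigop _ _ _; set X2 := bigop _ _ _; set X3 := bigop _ _ _; set X4 := bigop _ _ _.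
set Y1 := bigop _ _ _; set Y2 := bigop _ _ _; set Y3 := bigop _ _ _.
set Z1 := bigop _ _ _; set Z2 := bigop _ _ _; set Z3 := bigop _ _ _.
have -> : Z1 = X1 - x N [:: f] * Y1.
  rewrite /Z1 /X1 /Y1 mulr_sumr -sumrB; apply: eq_bigr => c _.
  rewrite mulrBr (@kap_perm N (f :: c.2.1 :: c.2.2 :: G) (c.2.1 :: c.2.2 :: f :: G)).
    by ring.
  by apply/permP => a /=; lia.
have -> : Z2 = X3 - x N [:: f] * Y2.
  by rewrite /Z2 /X3 /Y2 mulr_sumr -sumrB; apply: eq_bigr => c _; ring.
have -> : Z3 = X4 - x N [:: f] * Y3.
  rewrite /Z3 /X4 /Y3 mulr_sumr -sumrB; apply: eq_bigr => c _.
  rewrite mulrBr (@kap_perm N (f :: c.2.1 :: G) (c.2.1 :: f :: G)).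
    by ring.
  by apply/permP => a /=; lia.
by move: (_ ^- 2) => u; ring.
Qed.

(** The subtracted product obeys the loop equation of [x], multiplied by the constant [kap N [::]
    Fs]. So the covariance obeys the same equation, with the derivatives of the centred factors as a
    source. *)
Lemma ckap_reduce P S M :
  (forall N G, (0 < N)%N -> x N (P :: G) =
    \sum_(c <- S) c.1 * x N (c.2.1 :: c.2.2 :: G)
    - N%:R ^- 2 * \sum_(p <- merge_config M G) p.1 * x N p.2) ->
  forall N G Fs, (0 < N)%N -> ckap N (P :: G) Fs =
    \sum_(c <- S) c.1 * ckap N (c.2.1 :: c.2.2 :: G) Fs
    - N%:R ^- 2 * (\sum_(p <- merge_config M G) p.1 * ckap N p.2 Fs
                   + \sum_(p <- merge_centered M Fs) p.1 * kap N (p.2.1 :: G) p.2.2).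
Proof.
move=> E N G Fs N0; rewrite /ckap (kap_reduce E) // E //.
under [X in _ = X - _]eq_bigr do rewrite mulrBr mulrA.
under [X in _ = _ - _ * (X + _)]eq_bigr do rewrite mulrBr mulrA.
rewrite !sumrB -!mulr_suml.
by move: (_ ^- 2) => u; ring.
Qed.

Lemma kap_bounded G Fs : [::] \notin G -> [::] \notin Fs ->
  bigON 0 (fun N => (wtc N G * wtc N Fs)%:R * kap N G Fs).
Proof.
elim: Fs G => [|f Fs IH] G G0 F0 /=.
  apply: bigON_eq (wx_bounded G0) => N N0.
  by rewrite /wx [wtc N [::]]/wtc big_nil muln1.
have /andP[f0 F1] : ([::] != f) && ([::] \notin Fs) by rewrite -negb_or -in_cons.
have fG0 : [::] \notin f :: G by rewrite inE negb_or f0.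
have f10 : [::] \notin [:: f] by rewrite inE f0.
apply: bigON_eq (bigONB (IH _ fG0 F1) (bigONM (wx_bounded f10) (IH _ G0 F1))) => N N0.
by rewrite /wx !wtc_cons [wtc N [::]]/wtc big_nil muln1 !natrM; ring.
Qed.

Lemma merge_centeredP P M Fs p : merging P M -> p \in merge_centered M Fs ->
  [/\ P != [::] -> p.2.1 != [::], [::] \notin Fs -> [::] \notin p.2.2,
      size p.2.2 = (size Fs).-1 &
      forall N, (0 < N)%N -> (wt N P * wtc N Fs <= N * (wt N p.2.1 * wtc N p.2.2))%N].
Proof.
move=> hM; elim: Fs p => [//|f Fs IH] p /=; rewrite mem_cat => /orP[] /mapP[q qM ->] /=.
  have qPQ := hM _ _ qM; split=> //.
  - by move=> P0; rewrite -size_eq0 (perm_size qPQ) size_cat addn_eq0 size_eq0 negb_and P0.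
  - by rewrite inE negb_or => /andP[].
  - move=> N N0; rewrite !wtc_cons !mulnA leq_mul2r (wt_perm _ qPQ).
    by rewrite wt_merge // orbT.
have [h1 h2 h3 h4] := IH _ qM; split=> //.
- by rewrite !inE !negb_or => /andP[-> /h2].
- by rewrite h3; case: Fs {IH} qM h3 h2 h4.
- move=> N N0; have := h4 N N0; rewrite !wtc_cons => h.
  by rewrite mulnCA (mulnCA (wt N q.2.1)) [leqRHS]mulnCA leq_mul2l h orbT.
Qed.

(* The loop equation for a word of [G] splits it (induction on the defect), merges two
   words of [G] (gain 1/N over the previous bound) or merges it with a centred word
   (gain 1/N, one centred word less). *)
Lemma ckap_step s p :
  (forall Fs K, size Fs = s -> [::] \notin Fs -> [::] \notin K ->
     bigON p (fun N => (wtc N K * wtc N Fs)%:R * kap N K Fs)) ->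
  forall Fs G, size Fs = s.+1 -> [::] \notin Fs -> [::] \notin G ->
     bigON p.+1 (fun N => (wtc N G * wtc N Fs)%:R * ckap N G Fs).
Proof.
move=> hk Fs G sF F0.
(* The order is improved one unit at a time: merges inside [G] gain 1/N over the estimate of order
   [q]. The source terms, known to order [p] and gaining 1/N as well, limit the improvement to
   [p.+1]. *)
have main q : (q <= p.+1)%N -> forall G, [::] \notin G ->
    bigON q (fun N => (wtc N G * wtc N Fs)%:R * ckap N G Fs).
  elim: q => [_|q IHq qp] {}G G0.
    have h1 := kap_bounded G0 F0; have h2 := wx_bounded G0.
    have h3 := kap_bounded (_ : [::] \notin ([::] : config)) F0.
    apply: bigON_eq (bigONB h1 (bigONM h2 (h3 isT))) => N N0.
    by rewrite /ckap /wx [wtc N [::]]/wtc big_nil mul1n natrM; ring.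
  have [n] := ubnP (defect G); elim: n G G0 => [//|n IH] G G0 Gn.
  case: (boolP (all pure G)) => [pG|].
    apply: bigON_eq (bigON0 _ _) => N N0.
    by rewrite /ckap (kap_all_pure Fs N0 pG) subrr mulr0.
  move=> /nonpure_config[P [G' [nP HP]]].
  have PG0 : [::] \notin P :: G' by rewrite -(perm_mem HP).
  have dP : defect (P :: G') = defect G.
    by rewrite /defect (perm_size HP) (perm_size (perm_flatten HP)).
  have [S [M [hS hM E]]] := loop_reduce nP.
  pose a N := (wtc N (P :: G') * wtc N Fs)%N.
  apply: (@bigON_eq _ _ (fun N => \sum_(c <- S) c.1 * ((a N)%:R * ckap N (c.2.1 :: c.2.2 :: G') Fs)
     - (\sum_(p <- merge_config M G') p.1 * (N%:R ^- 2 * ((a N)%:R * ckap N p.2 Fs))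
       + \sum_(p <- merge_centered M Fs) p.1 * (N%:R ^- 2 * ((a N)%:R * kap N (p.2.1 :: G') p.2.2))))).
    move=> N N0; rewrite [in RHS]/ckap (kap_perm _ _ HP) (wtc_perm _ HP) (x_perm _ HP) -/(a N).
    rewrite -/(ckap N (P :: G') Fs) (ckap_reduce E) //.
    rewrite mulrBr mulrCA !mulrDr !mulr_sumr; congr (_ - (_ + _)); apply: eq_bigr => c _;
      by rewrite ?(mulrCA c.1).
  have /andP[P0 G'0] : ([::] != P) && ([::] \notin G') by rewrite -negb_or -in_cons.
  rewrite eq_sym in P0.
  apply: bigONB; first (apply: bigON_sum => c cS; apply: bigONZ).
    have [u0 v0 uvP] := hS _ cS.
    have [ne pe lt] := defect_split PG0 u0 v0 uvP.
    apply: (@bigON_wt _ a (fun N => wtc N (c.2.1 :: c.2.2 :: G') * wtc N Fs)%N).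
      move=> N N0; rewrite /a leq_mul2r; apply/orP; right.
      rewrite !wtc_cons mulnA leq_mul2r; apply/orP; right.
      by rewrite -(wt_perm _ uvP) wt_split.
    by apply: IH => //; apply: leq_trans lt _; rewrite dP -ltnS.
  apply: bigOND; apply: bigON_sum => c cS; apply: bigONZ.
    have [h1 h2 h3] := merge_configP hM cS.
    apply: (@bigON_wt_inv _ a (fun N => wtc N c.2 * wtc N Fs)%N).
      by move=> N N0; rewrite mulnA leq_mul2r; apply/orP; right; exact: h3.
    by apply: IHq; [exact: ltnW|exact: h1].
  have [h1 h2 h3 h4] := merge_centeredP hM cS.
  apply: (@bigON_wt_inv _ a (fun N => wtc N (c.2.1 :: G') * wtc N c.2.2)%N).
    move=> N N0; rewrite /a !wtc_cons; have := h4 N N0 => h.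
    have -> : (wt N P * wtc N G' * wtc N Fs = wt N P * wtc N Fs * wtc N G')%N by rewrite mulnAC.
    by rewrite (mulnAC (wt N c.2.1)) mulnA leq_mul2r h orbT.
  apply: (@bigONW _ p); first by rewrite -ltnS.
  apply: hk; [by rewrite h3 sF|exact: h2|].
  by rewrite inE negb_or eq_sym h1.
exact: main.
Qed.

Lemma kap_ckap N G Fs : kap N G Fs = ckap N G Fs + x N G * kap N [::] Fs.
Proof. by rewrite /ckap subrK. Qed.

Lemma kap0_ckap N f Fs : kap N [::] (f :: Fs) = ckap N [:: f] Fs.
Proof. by []. Qed.

Lemma ckap1 Fs G : size Fs = 1 -> [::] \notin Fs -> [::] \notin G ->
  bigON 1 (fun N => (wtc N G * wtc N Fs)%:R * ckap N G Fs).
Proof.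
apply: ckap_step => -[|//] K _ _ K0; exact: kap_bounded.
Qed.

(** A single centred trace has mean zero, so [kap] and [ckap] agree for one centred word and the
    order 1 of the covariance feeds the next step. *)
Lemma ckap2 Fs G : size Fs = 2 -> [::] \notin Fs -> [::] \notin G ->
  bigON 2 (fun N => (wtc N G * wtc N Fs)%:R * ckap N G Fs).
Proof.
apply: ckap_step => -[|f [|//]] K // _ f0 K0.
apply: bigON_eq (ckap1 _ f0 K0) => // N N0.
by rewrite kap_ckap /= x_nil // mulr1 subrr mulr0 addr0.
Qed.

(** For two centred words [kap] also contains their covariance, which is only of order 1. The step
    thus starts from order 1 and again ends at order 2. *)
Lemma ckap3 Fs G : size Fs = 3 -> [::] \notin Fs -> [::] \notin G ->
  bigON 2 (fun N => (wtc N G * wtc N Fs)%:R * ckap N G Fs).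
Proof.
apply: ckap_step => -[|f [|g [|//]]] K // _ fg0 K0.
have : [::] \notin [:: f] /\ [::] \notin [:: g].
  by move: fg0; rewrite !inE !negb_or => /andP[-> ->].
move=> [f0 g0].
have h := bigONM (wx_bounded K0) (ckap1 (erefl : size [:: g] = 1) g0 f0).
apply: bigON_eq (bigOND (bigONW _ (ckap2 _ fg0 K0)) h) => // N N0.
rewrite [in RHS]kap_ckap kap0_ckap /wx !wtc_cons [wtc N [::]]/wtc big_nil !muln1 !natrM.
by ring.
Qed.

Lemma fourth_moment_bound f Fs : size Fs = 3 -> [::] \notin f :: Fs ->
  bigON 2 (fun N => (wtc N (f :: Fs))%:R * kap N [::] (f :: Fs)).
Proof.
move=> s3; rewrite inE negb_or => /andP[f0 F0].
apply: bigON_eq (ckap3 s3 F0 (_ : [::] \notin [:: f])) => [N N0|]; last by rewrite inE.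
by rewrite kap0_ckap !wtc_cons [wtc N [::]]/wtc big_nil muln1.
Qed.
End LoopEquations.

(** * Polynomial functions and Haar expectations *)

Section ReIm.
Variable R : rcfType.
Implicit Types x y : R[i].
Lemma cReD x y : complex.Re (x + y) = complex.Re x + complex.Re y.
Proof. by case: x; case: y. Qed.
Lemma cImD x y : complex.Im (x + y) = complex.Im x + complex.Im y.
Proof. by case: x; case: y. Qed.
Lemma cReB x y : complex.Re (x - y) = complex.Re x - complex.Re y.
Proof. by case: x; case: y. Qed.
Lemma cImB x y : complex.Im (x - y) = complex.Im x - complex.Im y.
Proof. by case: x; case: y. Qed.
Lemma cReM x y : complex.Re (x * y) = complex.Re x * complex.Re y - complex.Im x * complex.Im y.
Proof. by case: x; case: y. Qed.
Lemma cImM x y : complex.Im (x * y) = complex.Re x * complex.Im y + complex.Im x * complex.Re y.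
Proof. by case: x => a b; case: y => c d /=. Qed.
Lemma cRe_conj x : complex.Re (Num.conj x) = complex.Re x.
Proof. by case: x. Qed.
Lemma cIm_conj x : complex.Im (Num.conj x) = - complex.Im x.
Proof. by case: x. Qed.
Lemma complex_ext x y : complex.Re x = complex.Re y -> complex.Im x = complex.Im y -> x = y.
Proof. by case: x => a b; case: y => c d /= -> ->. Qed.
End ReIm.

Section PolynomialFunctions.
Variables (R : realType) (N : nat).
Local Notation M := 'M[R[i]]_N.

(** All functions to be integrated belong to this class. Measurability, a bound on the unitary group
    and stability under [X |-> V X] are obtained for it by induction on the construction. *)
Inductive polyfun : (M -> R[i]) -> Prop :=
| pf_cst c : polyfun (fun=> c)
| pf_entry i j : polyfun (fun X => X i j)
| pf_conj i j : polyfun (fun X => Num.conj (X i j))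
| pf_add f g : polyfun f -> polyfun g -> polyfun (fun X => f X + g X)
| pf_mul f g : polyfun f -> polyfun g -> polyfun (fun X => f X * g X).

Lemma pf_sub f g : polyfun f -> polyfun g -> polyfun (fun X => f X - g X).
Proof.
move=> hf hg; have -> : (fun X => f X - g X) = (fun X => f X + -1 * g X).
  by apply/funext => X; rewrite mulN1r.
by apply: pf_add => //; apply: pf_mul => //; apply: pf_cst.
Qed.

Lemma pf_sum (I : Type) (r : seq I) (P : pred I) (F : I -> M -> R[i]) :
  (forall i, polyfun (F i)) -> polyfun (fun X => \sum_(i <- r | P i) F i X).
Proof.
move=> h; elim: r => [|i r IH].
  by under eq_fun do rewrite big_nil; exact: pf_cst.
under eq_fun do rewrite big_cons.
by case: (P i) => //; apply: pf_add.
Qed.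

Lemma pf_conjf f : polyfun f -> polyfun (fun X => Num.conj (f X)).
Proof.
elim=> [c|i j|i j|{}f g _ hf _ hg|{}f g _ hf _ hg].
- exact: pf_cst.
- exact: pf_conj.
- by under eq_fun do rewrite conjCK; exact: pf_entry.
- by under eq_fun do rewrite rmorphD; exact: pf_add.
- by under eq_fun do rewrite rmorphM; exact: pf_mul.
Qed.

Definition pf_mx p q (F : M -> 'M[R[i]]_(p, q)) := forall i j, polyfun (fun X => F X i j).

Lemma pf_mx_cst p q (B : 'M[R[i]]_(p, q)) : pf_mx (fun=> B).
Proof. by move=> i j; exact: pf_cst. Qed.

Lemma pf_mx_id : pf_mx (fun X => X).
Proof. by move=> i j; exact: pf_entry. Qed.

Lemma pf_mx_adj : pf_mx (fun X => adjmx X).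
Proof. by move=> i j; under eq_fun do rewrite !mxE; exact: pf_conj. Qed.

Lemma pf_mx_mul p q r (F : M -> 'M[R[i]]_(p, q)) (G : M -> 'M[R[i]]_(q, r)) :
  pf_mx F -> pf_mx G -> pf_mx (fun X => F X *m G X).
Proof.
move=> hF hG i j; under eq_fun do rewrite mxE.
by apply: pf_sum => k; apply: pf_mul.
Qed.

Lemma pf_mx_add p q (F G : M -> 'M[R[i]]_(p, q)) :
  pf_mx F -> pf_mx G -> pf_mx (fun X => F X + G X).
Proof. by move=> hF hG i j; under eq_fun do rewrite mxE; apply: pf_add. Qed.

Lemma pf_trN (F : M -> M) : pf_mx F -> polyfun (fun X => trN (F X)).
Proof.
move=> hF; rewrite /trN; under eq_fun do rewrite /mxtrace.
by apply: pf_mul; [apply: pf_sum => i; exact: hF|exact: pf_cst].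
Qed.

Lemma pf_shift f (V : M) : polyfun f -> polyfun (fun X => f (V *m X)).
Proof.
have h : pf_mx (fun X => V *m X) by apply: pf_mx_mul; [exact: pf_mx_cst|exact: pf_mx_id].
elim=> [c|i j|i j|{}f g _ hf _ hg|{}f g _ hf _ hg].
- exact: pf_cst.
- exact: h.
- by apply: pf_conjf; exact: h.
- exact: pf_add.
- exact: pf_mul.
Qed.

Lemma unitary_entry (X : M) i j : unitary X -> nm (X i j) <= 1.
Proof.
move=> /matrixP /(_ i i); rewrite !mxE eqxx /=.
under eq_bigr do rewrite !mxE -normCK.
move=> h; have : `|X i j| ^+ 2 <= 1.
  rewrite -[leRHS]h (bigD1 j) //= lerDl; apply: sumr_ge0 => k _; exact: exprn_ge0.
by rewrite expr_le1 // norm_nm (_ : 1 = ((1 : R)%:C)%C) // lecR.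
Qed.

Lemma pf_bounded f : polyfun f -> exists K : R, forall X : M, (forall i j, nm (X i j) <= 2) -> nm (f X) <= K.
Proof.
elim=> [c|i j|i j|{}f g _ [K hf] _ [L hg]|{}f g _ [K hf] _ [L hg]].
- by exists (nm c).
- by exists 2.
- by exists 2 => X h; rewrite nm_conj.
- exists (K + L) => X h; apply: le_trans (nmD _ _) _; exact: lerD (hf _ h) (hg _ h).
- exists (K * L) => X h; rewrite nmM; apply: ler_pM; rewrite ?nm_ge0 //.
    exact: hf.
  exact: hg.
Qed.

(** Invariance of the law is tested only on bounded continuous functions of arbitrary matrices,
    whereas polynomials are unbounded. Truncating the real and imaginary parts of the entries to
    [-1, 1] changes no unitary matrix and turns polynomials into legitimate test functions. *)
Definition clipr (r : R) : R := Num.max (-1) (Num.min 1 r).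
Definition clip (X : M) : M := \matrix_(i, j) Complex (clipr (complex.Re (X i j))) (clipr (complex.Im (X i j))).

Lemma clipr_le1 r : `|clipr r| <= 1.
Proof.
rewrite ler_norml /clipr le_max lexx /= ge_max ge_min lexx /= andbT.
by rewrite lerN10 || apply: le_trans (lerN10 _) _.
Qed.

Lemma clipr_id r : `|r| <= 1 -> clipr r = r.
Proof.
rewrite ler_norml => /andP[h1 h2]; rewrite /clipr.
by rewrite (min_idPr h2) (max_idPr h1).
Qed.

Lemma clipr_lip r s : `|clipr r - clipr s| <= `|r - s|.
Proof.
have cases t : [\/ t <= -1 /\ clipr t = -1, 1 <= t /\ clipr t = 1 | -1 <= t <= 1 /\ clipr t = t].
  rewrite /clipr; case: (lerP 1 t) => h1.
    by constructor 2; split=> //; apply/max_idPr; exact: lerN10 || apply: le_trans (lerN10 _) _.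
  case: (lerP t (-1)) => h2; first by constructor 1.
  by constructor 3; rewrite !ltW.
have a1 := ler_norm (r - s); have a2 := ler_norm (s - r); rewrite distrC in a2.
rewrite ler_norml; case: (cases r) => -[+ ->]; case: (cases s) => -[+ ->] => h1 h2; apply/andP; split; lra.
Qed.

Lemma clip_unitary X : unitary X -> clip X = X.
Proof.
move=> hX; apply/matrixP => i j; rewrite mxE.
have h := unitary_entry i j hX.
rewrite !clipr_id; first by case: (X i j).
  exact: le_trans (Im_le_nm _) h.
exact: le_trans (Re_le_nm _) h.
Qed.

Lemma bc_cst (c : R) : bounded_continuous_mx (fun _ : M => c).
Proof.
split; first by exists `|c|.
by move=> X e e0; exists 1 => // X' _; rewrite subrr normr0.
Qed.

Lemma bcD (f g : M -> R) : bounded_continuous_mx f -> bounded_continuous_mx g ->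
  bounded_continuous_mx (fun X => f X + g X).
Proof.
move=> [[K hK] cf] [[L hL] cg]; split.
  by exists (K + L) => X; apply: le_trans (ler_normD _ _) _; rewrite lerD.
move=> X e e0; have e2 : 0 < e / 2 by lra.
have [a a0 ha] := cf X _ e2; have [b b0 hb] := cg X _ e2.
exists (Num.min a b); first by rewrite lt_min a0 b0.
move=> X' h; have -> : f X' + g X' - (f X + g X) = (f X' - f X) + (g X' - g X) by ring.
apply: le_lt_trans (ler_normD _ _) _.
have h1 : `|f X' - f X| < e / 2.
  by apply: ha => i j; apply: lt_le_trans (h i j) _; rewrite lecR ge_min lexx.
have h2 : `|g X' - g X| < e / 2.
  by apply: hb => i j; apply: lt_le_trans (h i j) _; rewrite lecR ge_min lexx orbT.
lra.
Qed.

Lemma bcM (f g : M -> R) : bounded_continuous_mx f -> bounded_continuous_mx g ->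
  bounded_continuous_mx (fun X => f X * g X).
Proof.
move=> [[K hK] cf] [[L hL] cg]; split.
  by exists (K * L) => X; rewrite normrM ler_pM.
have K0 : 0 <= K by apply: le_trans (hK 0).
have L0 : 0 <= L by apply: le_trans (hL 0).
move=> X e e0; have e1 : 0 < e / (2 * (L + 1)) by apply: divr_gt0 => //; lra.
have e2 : 0 < e / (2 * (K + 1)) by apply: divr_gt0 => //; lra.
have [a a0 ha] := cf X _ e1; have [b b0 hb] := cg X _ e2.
exists (Num.min a b); first by rewrite lt_min a0 b0.
move=> X' h.
have -> : f X' * g X' - f X * g X = (f X' - f X) * g X' + f X * (g X' - g X) by ring.
apply: le_lt_trans (ler_normD _ _) _; rewrite !normrM.
have h1 : `|f X' - f X| < e / (2 * (L + 1)).
  by apply: ha => i j; apply: lt_le_trans (h i j) _; rewrite lecR ge_min lexx.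
have h2 : `|g X' - g X| < e / (2 * (K + 1)).
  by apply: hb => i j; apply: lt_le_trans (h i j) _; rewrite lecR ge_min lexx orbT.
have h3 : `|f X' - f X| * `|g X'| <= e / (2 * (L + 1)) * L by rewrite ler_pM // ltW.
have h4 : `|f X| * `|g X' - g X| <= K * (e / (2 * (K + 1))) by rewrite ler_pM // ltW.
have aux (C : R) : 0 <= C -> e / (2 * (C + 1)) * C < e / 2.
  move=> C0; have -> : e / (2 * (C + 1)) * C = e / 2 * (C / (C + 1)) by field; lra.
  rewrite -[ltRHS]mulr1 ltr_pM2l ?divr_gt0 //.
  by rewrite ltr_pdivrMr ?mul1r; lra.
have h5 := aux L L0; have h6 := aux K K0; rewrite [X in X < _]mulrC in h6.
lra.
Qed.

Lemma bcN (f : M -> R) : bounded_continuous_mx f -> bounded_continuous_mx (fun X => - f X).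
Proof.
move=> h; have := bcM (bc_cst (-1)) h; congr bounded_continuous_mx.
by apply/funext => X; rewrite mulN1r.
Qed.

Lemma bc_clip_entry (p : R[i] -> R) (i j : 'I_N) :
  (forall z, `|p z| <= nm z) -> (forall x y, p (x - y) = p x - p y) ->
  bounded_continuous_mx (fun X : M => clipr (p (X i j))).
Proof.
move=> hp pB; split; first by exists 1 => X; exact: clipr_le1.
move=> X e e0; exists e => // X' h; apply: le_lt_trans (clipr_lip _ _) _.
by rewrite -pB; apply: le_lt_trans (hp _) _; rewrite -normr_lt.
Qed.

Lemma pf_clip_bc f : polyfun f ->
  bounded_continuous_mx (fun X => complex.Re (f (clip X))) /\
  bounded_continuous_mx (fun X => complex.Im (f (clip X))).
Proof.
have hRe (i j : 'I_N) := @bc_clip_entry _ i j (@Re_le_nm R) (@cReB R).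
have hIm (i j : 'I_N) := @bc_clip_entry _ i j (@Im_le_nm R) (@cImB R).
elim=> [c|i j|i j|{}f g _ [f1 f2] _ [g1 g2]|{}f g _ [f1 f2] _ [g1 g2]].
- by split; exact: bc_cst.
- by split; under eq_fun do rewrite mxE /=; [exact: hRe|exact: hIm].
- split; under eq_fun do rewrite mxE /=; first exact: hRe.
  by apply: bcN; exact: hIm.
- split; [under eq_fun do rewrite cReD|under eq_fun do rewrite cImD]; exact: bcD.
- split; [under eq_fun do rewrite cReM|under eq_fun do rewrite cImM].
    by apply: bcD; [exact: bcM|apply: bcN; exact: bcM].
  by apply: bcD; exact: bcM.
Qed.
End PolynomialFunctions.

(** * Expectations of polynomial functions of a Haar unitary matrix *)

Section HaarExpectation.
Variables (R : realType) (d : measure_display) (Omega : measurableType d).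
Variables (Pr : probability Omega R) (N : nat).
Local Notation M := 'M[R[i]]_N.

Definition measC (X : Omega -> R[i]) :=
  measurable_fun setT (fun w => complex.Re (X w)) /\ measurable_fun setT (fun w => complex.Im (X w)).

Lemma pf_meas (W : Omega -> M) f : (forall i j, measC (fun w => W w i j)) ->
  polyfun f -> measC (fun w => f (W w)).
Proof.
move=> hW; elim=> [c|i j|i j|{}f g _ [f1 f2] _ [g1 g2]|{}f g _ [f1 f2] _ [g1 g2]].
- by split=> /=; exact: measurable_cst.
- exact: hW.
- split => /=; first by under eq_fun do rewrite cRe_conj; case: (hW i j).
  under eq_fun do rewrite cIm_conj.
  by apply: (@measurableT_comp _ _ _ _ _ _ (@GRing.opp R)) => //; case: (hW i j).
- split; [under eq_fun do rewrite cReD|under eq_fun do rewrite cImD]; exact: measurable_funD.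
- split; [under eq_fun do rewrite cReM|under eq_fun do rewrite cImM].
    by apply: measurable_funB; exact: measurable_funM.
  by apply: measurable_funD; exact: measurable_funM.
Qed.

Lemma clip_meas (W : Omega -> M) : (forall i j, measC (fun w => W w i j)) ->
  forall i j, measC (fun w => clip (W w) i j).
Proof.
have h (f : Omega -> R) : measurable_fun setT f -> measurable_fun setT (fun w => clipr (f w)).
  move=> mf; apply: measurable_maxr; first exact: measurable_cst.
  by apply: measurable_minr; first exact: measurable_cst.
by move=> hW i j; split; under eq_fun do rewrite mxE /=; apply: h; case: (hW i j).
Qed.

Lemma expC_ae (X Y : Omega -> R[i]) : measC X -> measC Y ->
  {ae Pr, forall w, X w = Y w} -> expC Pr X = expC Pr Y.
Proof.
move=> [X1 X2] [Y1 Y2] XY; rewrite /expC; congr Complex; rewrite /Rintegral; congr fine;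
  apply: ae_eq_integral => //; try exact/measurable_EFinP.
  by apply: filterS XY => w -> _.
by apply: filterS XY => w -> _.
Qed.

Lemma bounded_meas_integrable (f : Omega -> R) (K : R) : measurable_fun setT f ->
  (forall w, `|f w| <= K) -> Pr.-integrable setT (EFin \o f).
Proof.
move=> mf fK; apply: measurable_bounded_integrable => //; first by rewrite ltey_eq fin_num_measure.
by exists K; split; [exact: num_real|move=> x Kx w _; apply: le_trans (fK w) (ltW Kx)].
Qed.

Definition bmeasC (X : Omega -> R[i]) := measC X /\ exists K : R, forall w, nm (X w) <= K.

Lemma bmeasC_int X : bmeasC X ->
  Pr.-integrable setT (EFin \o (fun w => complex.Re (X w))) /\
  Pr.-integrable setT (EFin \o (fun w => complex.Im (X w))).
Proof.
move=> [[h1 h2] [K hK]]; split; apply: (@bounded_meas_integrable _ K) => // w.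
  exact: le_trans (Re_le_nm _) (hK w).
exact: le_trans (Im_le_nm _) (hK w).
Qed.

Lemma Rintegral_prob_cst (r : R) : Rintegral Pr setT (fun=> r) = r.
Proof.
rewrite Rintegral_cst // -[RHS]mulr1; congr (_ * _).
exact: (congr1 fine (@probability_setT _ _ _ Pr)).
Qed.

Lemma expC_cst c : expC Pr (fun=> c) = c.
Proof. by rewrite /expC !Rintegral_prob_cst; case: c. Qed.

Lemma expCD X Y : bmeasC X -> bmeasC Y -> expC Pr (fun w => X w + Y w) = expC Pr X + expC Pr Y.
Proof.
move=> /bmeasC_int[x1 x2] /bmeasC_int[y1 y2].
apply: complex_ext; rewrite ?cReD ?cImD /expC /=.
  by under eq_Rintegral do rewrite cReD; exact: RintegralD.
by under eq_Rintegral do rewrite cImD; exact: RintegralD.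
Qed.

Lemma expCZ c X : bmeasC X -> expC Pr (fun w => c * X w) = c * expC Pr X.
Proof.
move=> /bmeasC_int[x1 x2].
have i1 (r : R) : Pr.-integrable setT (EFin \o (fun w => r * complex.Re (X w))).
  exact: (integrableZl _ r x1).
have i2 (r : R) : Pr.-integrable setT (EFin \o (fun w => r * complex.Im (X w))).
  exact: (integrableZl _ r x2).
apply: complex_ext; rewrite ?cReM ?cImM /expC /=.
  under eq_Rintegral do rewrite cReM.
  by rewrite RintegralB // !RintegralZl.
under eq_Rintegral do rewrite cImM.
by rewrite RintegralD // !RintegralZl.
Qed.

(** The factor 2 comes from treating the real and the imaginary part separately. *)
Lemma expC_bound X (K : R) : measC X -> (forall w, nm (X w) <= K) -> nm (expC Pr X) <= 2 * K.
Proof.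
move=> mX hK; have [x1 x2] : _ /\ _ := bmeasC_int (conj mX (ex_intro _ K hK)).
have aux (f : Omega -> R) : Pr.-integrable setT (EFin \o f) -> (forall w, `|f w| <= K) ->
    `|Rintegral Pr setT f| <= K.
  move=> fi fK; apply: le_trans (le_normr_Rintegral _ fi) _ => //.
  have -> : K = Rintegral Pr setT (fun=> K).
    by rewrite Rintegral_prob_cst.
  apply: le_Rintegral => //.
    exact: integrable_norm.
  by apply: (@bounded_meas_integrable _ `|K|) => //; exact: measurable_cst.
apply: le_trans (nm_le_ReIm _) _; rewrite mulr_natl mulr2n; apply: lerD; apply: aux => // w.
  exact: le_trans (Re_le_nm _) (hK w).
exact: le_trans (Im_le_nm _) (hK w).
Qed.

Lemma expC_conj X : bmeasC X -> expC Pr (fun w => Num.conj (X w)) = Num.conj (expC Pr X).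
Proof.
move=> /bmeasC_int[x1 x2]; apply: complex_ext; rewrite ?cRe_conj ?cIm_conj /expC /=.
  by apply: eq_Rintegral => w _; rewrite cRe_conj.
under eq_Rintegral do rewrite cIm_conj -mulN1r.
by rewrite RintegralZl // mulN1r.
Qed.

Variable U : Omega -> M.
Hypothesis HU : haar_unitary Pr U.

(** Squared Hilbert-Schmidt norm of [X X* - 1]. Being a polynomial function, it makes unitarity a
    measurable condition. *)
Definition udefect (X : M) : R[i] :=
  \sum_i \sum_j ((X *m adjmx X - 1%:M) i j * Num.conj ((X *m adjmx X - 1%:M) i j)).

Lemma udefectP X : reflect (unitary X) (complex.Re (udefect X) == 0).
Proof.
have ge0 : 0 <= udefect X.
  by apply: sumr_ge0 => i _; apply: sumr_ge0 => j _; rewrite mul_conjC_ge0.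
have -> : (complex.Re (udefect X) == 0) = (udefect X == 0).
  rewrite -[in RHS](RRe_real (ger0_real ge0)).
  by apply/eqP/eqP => [->//|[]].
apply: (iffP idP) => [h|h].
  apply/eqP; rewrite -subr_eq0; apply/eqP/matrixP => i j; rewrite [RHS]mxE.
  move: h; rewrite psumr_eq0; last first.
    by move=> i' _; apply: sumr_ge0 => j' _; rewrite mul_conjC_ge0.
  move=> /allP /(_ i (mem_index_enum _)) /=.
  rewrite psumr_eq0; last by move=> j' _; rewrite mul_conjC_ge0.
  by move=> /allP /(_ j (mem_index_enum _)) /=; rewrite mul_conjC_eq0 => /eqP.
rewrite /udefect; under eq_bigr => i _.
  under eq_bigr => j _ do rewrite h subrr mxE mul0r.
  rewrite big1 //; over.
by rewrite big1.
Qed.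

Lemma pf_udefect : polyfun udefect.
Proof.
have h : pf_mx (fun X : M => X *m adjmx X - 1%:M).
  apply: pf_mx_add; last exact: pf_mx_cst.
  by apply: pf_mx_mul; [exact: pf_mx_id|exact: pf_mx_adj].
apply: pf_sum => i; apply: pf_sum => j; apply: pf_mul; first exact: h.
by apply: pf_conjf; exact: h.
Qed.

(* A version of [U] that is unitary everywhere and not only almost surely. *)
Definition unitarized (w : Omega) : M :=
  if complex.Re (udefect (U w)) == 0 then U w else 1%:M.

Lemma adjmx1 : adjmx (1%:M : M) = 1%:M.
Proof. by apply/matrixP => i j; rewrite !mxE eq_sym rmorph_nat. Qed.

Lemma unitarizedP w : unitary (unitarized w).
Proof.
rewrite /unitarized; case: udefectP => // _.
by rewrite /unitary adjmx1 mulmx1.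
Qed.

Lemma unitarized_ae : {ae Pr, forall w, unitarized w = U w}.
Proof.
by case: HU => _ h _; apply: filterS h => w /udefectP h; rewrite /unitarized h.
Qed.

Lemma U_meas i j : measC (fun w => U w i j).
Proof. by case: HU => h _ _; exact: h. Qed.

Lemma unitarized_meas i j : measC (fun w => unitarized w i j).
Proof.
have mb : measurable_fun setT (fun w => complex.Re (udefect (U w)) == 0).
  apply: measurable_fun_eqr; last exact: measurable_cst.
  by case: (pf_meas U_meas pf_udefect).
have e w : unitarized w i j = if complex.Re (udefect (U w)) == 0 then U w i j else 1%:M i j.
  by rewrite /unitarized; case: ifP.
have [u1 u2] := U_meas i j.
split; under eq_fun do rewrite e fun_if.
  by apply: measurable_fun_ifT => //; exact: measurable_cst.
by apply: measurable_fun_ifT => //; exact: measurable_cst.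
Qed.

(** With the everywhere unitary version, identities and bounds valid on the unitary group can be
    used pointwise, without exceptional sets. *)
Definition haarE (f : M -> R[i]) : R[i] := expC Pr (fun w => f (unitarized w)).

Lemma haarE_expC f : polyfun f -> expC Pr (fun w => f (U w)) = haarE f.
Proof.
move=> hf; apply: expC_ae; [exact: pf_meas U_meas hf|exact: pf_meas unitarized_meas hf|].
by apply: filterS unitarized_ae => w ->.
Qed.

Lemma unitary_bounded (f : M -> R[i]) : polyfun f ->
  exists K : R, forall X, unitary X -> nm (f X) <= K.
Proof.
move=> /pf_bounded[K hK]; exists K => X hX; apply: hK => i j.
by apply: le_trans (unitary_entry _ _ hX) _; rewrite ler1n.
Qed.

Lemma pf_bmeasC f : polyfun f -> bmeasC (fun w => f (unitarized w)).
Proof.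
move=> hf; split; first exact: pf_meas unitarized_meas hf.
by have [K hK] := unitary_bounded hf; exists K => w; apply: hK; exact: unitarizedP.
Qed.

Lemma haarE_eq f g : (forall X, unitary X -> f X = g X) -> haarE f = haarE g.
Proof.
move=> fg; rewrite /haarE; congr expC; apply/funext => w; apply: fg; exact: unitarizedP.
Qed.

Lemma haarED f g : polyfun f -> polyfun g -> haarE (fun X => f X + g X) = haarE f + haarE g.
Proof. by move=> hf hg; apply: expCD; exact: pf_bmeasC. Qed.

Lemma haarEZ c f : polyfun f -> haarE (fun X => c * f X) = c * haarE f.
Proof. by move=> hf; apply: expCZ; exact: pf_bmeasC. Qed.

Lemma haarE_cst c : haarE (fun=> c) = c.
Proof. exact: expC_cst. Qed.

Lemma haarEB f g : polyfun f -> polyfun g -> haarE (fun X => f X - g X) = haarE f - haarE g.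
Proof.
move=> hf hg; rewrite -[in RHS]mulN1r -haarEZ // -haarED //; last first.
  by apply: pf_mul => //; exact: pf_cst.
by apply: haarE_eq => X _; rewrite mulN1r.
Qed.

Lemma haarE_sum (I : Type) (r : seq I) (P : pred I) (F : I -> M -> R[i]) :
  (forall i, polyfun (F i)) ->
  haarE (fun X => \sum_(i <- r | P i) F i X) = \sum_(i <- r | P i) haarE (F i).
Proof.
move=> h; elim: r => [|i r IH].
  by under [in LHS]eq_fun do rewrite big_nil; rewrite big_nil haarE_cst.
under [in LHS]eq_fun do rewrite big_cons; rewrite big_cons.
by case: (P i) => //; rewrite haarED // ?IH //; exact: pf_sum.
Qed.

Lemma haarE_bound f (K : R) : polyfun f -> (forall X, unitary X -> nm (f X) <= K) ->
  nm (haarE f) <= 2 * K.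
Proof.
move=> hf hK; apply: expC_bound; first by case: (pf_bmeasC hf).
by move=> w; apply: hK; exact: unitarizedP.
Qed.

Lemma unitaryM (X Y : M) : unitary X -> unitary Y -> unitary (X *m Y).
Proof.
rewrite /unitary => hX hY.
have -> : adjmx (X *m Y) = adjmx Y *m adjmx X by rewrite /adjmx map_mxM trmx_mul.
by rewrite mulmxA -(mulmxA X) hY mulmx1.
Qed.

Lemma haarE_shift f (V : M) : unitary V -> polyfun f -> haarE (fun X => f (V *m X)) = haarE f.
Proof.
move=> hV hf.
have hs := pf_shift V hf.
have mV i j : measC (fun w => (V *m U w) i j).
  apply: (pf_meas U_meas (f := fun X => (V *m X) i j)).
  by apply: pf_mx_mul; [exact: pf_mx_cst|exact: pf_mx_id].
rewrite -!haarE_expC //.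
have [_ hu inv] := HU.
have e1 : expC Pr (fun w => f (V *m U w)) = expC Pr (fun w => f (clip (V *m U w))).
  apply: expC_ae; [exact: pf_meas mV hf|exact: pf_meas (clip_meas mV) hf|].
  by apply: filterS hu => w hw; rewrite clip_unitary //; exact: unitaryM.
have e2 : expC Pr (fun w => f (U w)) = expC Pr (fun w => f (clip (U w))).
  apply: expC_ae; [exact: pf_meas U_meas hf|exact: pf_meas (clip_meas U_meas) hf|].
  by apply: filterS hu => w hw; rewrite clip_unitary.
have [bc1 bc2] := pf_clip_bc hf.
by rewrite e1 e2 /expC (inv _ hV _ bc1) (inv _ hV _ bc2).
Qed.
End HaarExpectation.

(** * The loop equations of a Haar unitary matrix *)

Section Jets.
Variables (R : realType) (N : nat).
Local Notation M := 'M[R[i]]_N.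

(** This makes [1 + eta E] unitary for every orthogonal projection [E], since it acts as [1 + eta]
    on the range of [E] and as the identity on the orthogonal complement. *)
Definition admissible (eta : R[i]) := nm (1 + eta) = 1.

Lemma admissible0 : admissible 0.
Proof. by rewrite /admissible addr0 nm1. Qed.

Lemma admissible_le2 eta : admissible eta -> nm eta <= 2.
Proof.
move=> h; have -> : eta = (1 + eta) - 1 by rewrite addrC addKr.
by apply: le_trans (nmB _ _) _; rewrite h nm1; lra.
Qed.

(** Thus [Num.conj eta] is [- eta] up to second order, which is why the adjoint of a rotation has
    derivative [- E]. *)
Lemma admissible_conj eta : admissible eta -> Num.conj eta + eta = - (eta * Num.conj eta).
Proof.
move=> h; have : (1 + eta) * Num.conj (1 + eta) = 1.
  by rewrite -normCK norm_nm h expr1n.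
rewrite rmorphD rmorph1 => E.
have -> : Num.conj eta + eta = (1 + eta) * (1 + Num.conj eta) - 1 - eta * Num.conj eta by ring.
by rewrite E subrr sub0r.
Qed.

Lemma admissible_small (e : R) : 0 < e -> exists eta, [/\ admissible eta, eta != 0 & nm eta < e].
Proof.
(* Here [1 + eta] is the Cayley transform [(1 + i t) / (1 - i t)], so that [eta = 2 i t / (1 - i t)]
   has modulus at most [2 t = e / 2]. *)
move=> e0; pose t := e / 4; have t0 : 0 < t by rewrite /t; lra.
pose z : R[i] := Complex 1 (- t); pose y : R[i] := Complex 1 t.
have nz : nm z = nm y by rewrite /nm /= sqrrN.
have y1 : 1 <= nm y.
  by have := Re_le_nm y; rewrite /= normr1.
have z0 : z != 0 by rewrite -nm_eq0 nz gt_eqF //; lra.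
have yz : y = z + Complex 0 (2 * t).
  by apply: complex_ext; rewrite ?cReD ?cImD /=; ring.
exists (y / z - 1); split.
- rewrite /admissible addrC subrK nmM nmV nz divff // gt_eqF //; lra.
- rewrite subr_eq0; apply: contraTneq z0 => h; rewrite negbK.
  have {}h : y = z by rewrite -[RHS]mul1r -h mulfVK // -nm_eq0 nz gt_eqF //; lra.
  by move: yz; rewrite h => /(congr1 (@complex.Im R)); rewrite cImD /=; lra.
- have -> : y / z - 1 = Complex 0 (2 * t) / z by rewrite {1}yz mulrDl divff // addrC addKr.
  rewrite nmM nmV nz; have -> : nm (Complex 0 (2 * t)) = 2 * t.
    by rewrite /nm /= expr0n add0r sqrtr_sqr ger0_norm //; lra.
  rewrite ltr_pdivrMr; last lra.
  by apply: (@lt_le_trans _ _ (e * 1)); [rewrite /t|rewrite ler_pM2l]; lra.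
Qed.

(* First-order expansion at [eta = 0] along the unit circle centred at [-1],
   uniform over the unitary group. *)
Definition jet (f : R[i] -> M -> R[i]) (g : M -> R[i]) :=
  exists K : R, forall eta X, admissible eta -> unitary X ->
    [/\ nm (f 0 X) <= K, nm (g X) <= K & nm (f eta X - f 0 X - eta * g X) <= K * nm eta ^+ 2].

Lemma jet_eq f g g' : (forall X, unitary X -> g X = g' X) -> jet f g -> jet f g'.
Proof.
by move=> gg [K hK]; exists K => eta X ae uX; rewrite -gg //; apply: hK.
Qed.

Lemma jet_cst (h : M -> R[i]) : polyfun h -> jet (fun=> h) (fun=> 0).
Proof.
move=> /unitary_bounded[K hK]; exists `|K| => eta X ae uX; split.
- exact: le_trans (hK _ uX) (ler_norm _).
- by rewrite nm0.
- by rewrite subrr mulr0 subr0 nm0 mulr_ge0 // exprn_ge0 // nm_ge0.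
Qed.

Lemma jetD f g f' g' : jet f g -> jet f' g' ->
  jet (fun eta X => f eta X + f' eta X) (fun X => g X + g' X).
Proof.
move=> [K hK] [L hL]; exists (K + L) => eta X ae uX.
have [a1 a2 a3] := hK _ _ ae uX; have [b1 b2 b3] := hL _ _ ae uX; split.
- by apply: le_trans (nmD _ _) _; rewrite lerD.
- by apply: le_trans (nmD _ _) _; rewrite lerD.
- have -> : f eta X + f' eta X - (f 0 X + f' 0 X) - eta * (g X + g' X) =
    (f eta X - f 0 X - eta * g X) + (f' eta X - f' 0 X - eta * g' X) by ring.
  by apply: le_trans (nmD _ _) _; rewrite mulrDl lerD.
Qed.

Lemma jet_sum (I : Type) (r : seq I) (f : I -> R[i] -> M -> R[i]) g :
  (forall i, jet (f i) (g i)) ->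
  jet (fun eta X => \sum_(i <- r) f i eta X) (fun X => \sum_(i <- r) g i X).
Proof.
move=> h; elim: r => [|i r IH].
  have -> : (fun (eta : R[i]) X => \sum_(i <- [::]) f i eta X) = (fun _ _ => 0).
    by apply/funext => eta; apply/funext => X; rewrite big_nil.
  by apply: jet_eq (jet_cst (pf_cst _ 0)) => X _; rewrite big_nil.
have -> : (fun (eta : R[i]) X => \sum_(i <- i :: r) f i eta X) =
    (fun eta X => f i eta X + \sum_(i <- r) f i eta X).
  by apply/funext => eta; apply/funext => X; rewrite big_cons.
by apply: jet_eq (jetD (h i) IH) => X _; rewrite big_cons.
Qed.

Lemma jetM f g f' g' : jet f g -> jet f' g' ->
  jet (fun eta X => f eta X * f' eta X) (fun X => g X * f' 0 X + f 0 X * g' X).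
Proof.
(* The remainder has three parts, at most 7, 3 and 1 times [K * L * nm eta ^+ 2]. As [nm eta <= 2],
   the 7 is [1 + 2 + 4] from the full expansion of [f'], and the 3 is [1 + 2] from the first-order
   part of [f]. *)
move=> [K hK] [L hL]; exists (11 * (K * L)) => eta X ae uX.
have [a1 a2 a3] := hK _ _ ae uX; have [b1 b2 b3] := hL _ _ ae uX.
have K0 : 0 <= K by apply: le_trans a1; exact: nm_ge0.
have L0 : 0 <= L by apply: le_trans b1; exact: nm_ge0.
have KL0 : 0 <= K * L by exact: mulr_ge0.
have e2 := admissible_le2 ae; have e0 := nm_ge0 eta.
have p1 : nm (f 0 X) * nm (f' 0 X) <= K * L by rewrite ler_pM ?nm_ge0.
have p2 : nm (g X) * nm (f' 0 X) <= K * L by rewrite ler_pM ?nm_ge0.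
have p3 : nm (f 0 X) * nm (g' X) <= K * L by rewrite ler_pM ?nm_ge0.
have p4 : nm (g X) * nm (g' X) <= K * L by rewrite ler_pM ?nm_ge0.
split.
- by rewrite nmM; lra.
- by apply: le_trans (nmD _ _) _; rewrite !nmM; lra.
have -> : f eta X * f' eta X - f 0 X * f' 0 X - eta * (g X * f' 0 X + f 0 X * g' X) =
  (f eta X - f 0 X - eta * g X) * f' eta X
  + ((f 0 X + eta * g X) * (f' eta X - f' 0 X - eta * g' X) + eta ^+ 2 * (g X * g' X)) by ring.
set r := f eta X - _ - _ in a3 *; set s := f' eta X - f' 0 X - _ in b3 *.
have hf' : nm (f' eta X) <= 7 * L.
  have -> : f' eta X = s + (f' 0 X + eta * g' X) by rewrite /s; ring.
  apply: le_trans (nmD _ _) _; have := nmD (f' 0 X) (eta * g' X); rewrite nmM.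
  have q1 : nm eta * nm (g' X) <= 2 * L by rewrite ler_pM ?nm_ge0.
  have q2 : L * nm eta ^+ 2 <= L * 4.
    by rewrite ler_wpM2l // (_ : 4 = 2 ^+ 2 :> R) ?ler_pXn2r ?nnegrE //; ring.
  by lra.
have hf0 : nm (f 0 X + eta * g X) <= 3 * K.
  have := nmD (f 0 X) (eta * g X); rewrite nmM.
  have q1 : nm eta * nm (g X) <= 2 * K by rewrite ler_pM ?nm_ge0.
  by lra.
apply: le_trans (nmD _ _) _; have := nmD ((f 0 X + eta * g X) * s) (eta ^+ 2 * (g X * g' X)).
rewrite [nm (eta ^+ 2 * _)]nmM nmX !nmM.
have t1 : nm r * nm (f' eta X) <= K * nm eta ^+ 2 * (7 * L) by rewrite ler_pM ?nm_ge0.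
have t2 : nm (f 0 X + eta * g X) * nm s <= 3 * K * (L * nm eta ^+ 2) by rewrite ler_pM ?nm_ge0.
have t3 : nm eta ^+ 2 * (nm (g X) * nm (g' X)) <= nm eta ^+ 2 * (K * L).
  by rewrite ler_wpM2l // exprn_ge0.
by lra.
Qed.

Definition mjet p q (F : R[i] -> M -> 'M[R[i]]_(p, q)) (G : M -> 'M[R[i]]_(p, q)) :=
  forall i j, jet (fun eta X => F eta X i j) (fun X => G X i j).

Lemma mjet_eq p q (F : R[i] -> M -> 'M[R[i]]_(p, q)) G G' :
  (forall X, unitary X -> G X = G' X) -> mjet F G -> mjet F G'.
Proof. by move=> GG h i j; apply: jet_eq (h i j) => X uX; rewrite GG. Qed.

Lemma mjet_cst p q (H : M -> 'M[R[i]]_(p, q)) : pf_mx H -> mjet (fun=> H) (fun=> 0).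
Proof. by move=> h i j; apply: jet_eq (jet_cst (h i j)) => X _; rewrite mxE. Qed.

Lemma mjetM p q r (F : R[i] -> M -> 'M[R[i]]_(p, q)) G (F' : R[i] -> M -> 'M[R[i]]_(q, r)) G' :
  mjet F G -> mjet F' G' ->
  mjet (fun eta X => F eta X *m F' eta X) (fun X => G X *m F' 0 X + F 0 X *m G' X).
Proof.
move=> h h' i j.
have -> : (fun eta X => (F eta X *m F' eta X) i j) =
    (fun eta X => \sum_k F eta X i k * F' eta X k j).
  by apply/funext => eta; apply/funext => X; rewrite mxE.
apply: jet_eq (jet_sum _ (fun k => jetM (h i k) (h' k j))) => X _.
by rewrite !mxE big_split.
Qed.

Lemma jet_trN (F : R[i] -> M -> M) G : mjet F G ->
  jet (fun eta X => trN (F eta X)) (fun X => trN (G X)).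
Proof.
move=> h; rewrite /trN.
apply: jet_eq (jetM (jet_sum _ (fun i => h i i)) (jet_cst (pf_cst _ _))) => X _.
by rewrite mulr0 addr0.
Qed.

Lemma adjmxM (X Y : M) : adjmx (X *m Y) = adjmx Y *m adjmx X.
Proof. by rewrite /adjmx map_mxM trmx_mul. Qed.

Variable E : M.
Hypotheses (EE : E *m E = E) (adjE : adjmx E = E).

Definition rotation (eta : R[i]) : M := 1%:M + eta *: E.

Lemma rotation0 : rotation 0 = 1%:M.
Proof. by rewrite /rotation scale0r addr0. Qed.

Lemma adj_rotation eta : adjmx (rotation eta) = 1%:M + Num.conj eta *: E.
Proof.
apply/matrixP => i j; rewrite -[in RHS]adjE.
by rewrite !mxE rmorphD rmorphM rmorph_nat eq_sym.
Qed.

Lemma rotation_unitary eta : admissible eta -> unitary (rotation eta).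
Proof.
move=> ae; rewrite /unitary adj_rotation /rotation mulmxDl mul1mx mulmxDr mulmx1.
rewrite -scalemxAl -scalemxAr EE scalerA -addrA -!scalerDl.
by rewrite addrA admissible_conj // addNr scale0r addr0.
Qed.

Lemma mjet_rotation : mjet (fun eta _ => rotation eta) (fun=> E).
Proof.
move=> i j; exists (nm ((1%:M : M) i j) + nm (E i j)) => eta X ae uX; split.
- by rewrite rotation0 lerDl nm_ge0.
- by rewrite lerDr nm_ge0.
- have h (a b : R[i]) : a + b - a - b = 0 by ring.
  rewrite rotation0 /rotation !mxE h nm0.
  by rewrite mulr_ge0 ?exprn_ge0 ?addr_ge0 ?nm_ge0.
Qed.

Lemma mjet_adj_rotation : mjet (fun eta _ => adjmx (rotation eta)) (fun=> - E).
Proof.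
move=> i j; exists (nm ((1%:M : M) i j) + nm (E i j)) => eta X ae uX; split.
- by rewrite adj_rotation rmorph0 scale0r addr0 lerDl nm_ge0.
- by rewrite mxE nmN lerDr nm_ge0.
- have h (a b c : R[i]) : a + c * b - a - eta * - b = (c + eta) * b by ring.
  rewrite !adj_rotation rmorph0 scale0r addr0 !mxE h.
  rewrite admissible_conj // nmM nmN nmM nm_conj -expr2 mulrC ler_wpM2r ?exprn_ge0 ?nm_ge0 //.
  by rewrite lerDr nm_ge0.
Qed.
End Jets.

(** * Words in conjugated matrices and their derivatives under rotations *)

Section WordDerivations.
Variables (R : realType) (N : nat) (T : eqType) (kd : T -> bool).
Local Notation M := 'M[R[i]]_N.
Variable Am : T -> M.

Definition lm (X : M) (t : T) : M := if kd t then X *m Am t *m adjmx X else Am t.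
Definition wm (X : M) (w : seq T) : M := \prod_(t <- w) lm X t.
Definition trp (X : M) (G : seq (seq T)) : R[i] := \prod_(w <- G) trN (wm X w).

Lemma wm_cons X t w : wm X (t :: w) = lm X t *m wm X w.
Proof. by rewrite /wm big_cons. Qed.

Lemma wm_nil X : wm X [::] = 1%:M.
Proof. by rewrite /wm big_nil. Qed.

Lemma wm_cat X u v : wm X (u ++ v) = wm X u *m wm X v.
Proof. by rewrite /wm big_cat. Qed.

Lemma trp_cons X w G : trp X (w :: G) = trN (wm X w) * trp X G.
Proof. by rewrite /trp big_cons. Qed.

Lemma pf_lm t : pf_mx (fun X => lm X t).
Proof.
rewrite /lm; case: (kd t); last exact: pf_mx_cst.
apply: pf_mx_mul; last exact: pf_mx_adj.
by apply: pf_mx_mul; [exact: pf_mx_id|exact: pf_mx_cst].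
Qed.

Lemma pf_wm w : pf_mx (fun X => wm X w).
Proof.
elim: w => [|t w IH] i j.
  by under eq_fun do rewrite wm_nil; exact: pf_cst.
under eq_fun do rewrite wm_cons.
by apply: pf_mx_mul => //; exact: pf_lm.
Qed.

Lemma pf_trp G : polyfun (fun X => trp X G).
Proof.
elim: G => [|w G IH]; first by rewrite /trp; under eq_fun do rewrite big_nil; exact: pf_cst.
under eq_fun do rewrite trp_cons.
by apply: pf_mul => //; apply: pf_trN; exact: pf_wm.
Qed.

(* Derivative of a letter when conjugated letters move by [Y |-> H Y - Y H]. *)
Definition dlm (H X : M) (t : T) : M := if kd t then H *m lm X t - lm X t *m H else 0.

Fixpoint dwm (H X : M) (w : seq T) : M :=
  if w is t :: w' then dlm H X t *m wm X w' + lm X t *m dwm H X w' else 0.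

Fixpoint dtrp (H X : M) (G : seq (seq T)) : R[i] :=
  if G is w :: G' then trN (dwm H X w) * trp X G' + trN (wm X w) * dtrp H X G' else 0.

Lemma trND (A B : M) : trN (A + B) = trN A + trN B.
Proof. by rewrite /trN mxtraceD mulrDl. Qed.

Lemma trNZ c (A : M) : trN (c *: A) = c * trN A.
Proof. by rewrite /trN mxtraceZ mulrA. Qed.

(** Linearity in the direction matters because invariance yields information for projections only,
    which has to be extended to all matrices. *)
Lemma dlmP c (H H' X : M) t : dlm (c *: H + H') X t = c *: dlm H X t + dlm H' X t.
Proof.
rewrite /dlm; case: (kd t); last by rewrite scaler0 addr0.
by rewrite mulmxDl mulmxDr -scalemxAl -scalemxAr scalerBr opprD addrACA.
Qed.

Lemma dwmP c (H H' X : M) w : dwm (c *: H + H') X w = c *: dwm H X w + dwm H' X w.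
Proof.
elim: w => [|t w IH] /=; first by rewrite scaler0 addr0.
by rewrite dlmP IH mulmxDl mulmxDr -scalemxAl -scalemxAr scalerDr addrACA.
Qed.

Lemma dtrpP c (H H' X : M) G : dtrp (c *: H + H') X G = c * dtrp H X G + dtrp H' X G.
Proof.
elim: G => [|w G IH] /=; first by rewrite mulr0 addr0.
by rewrite dwmP IH trND trNZ; ring.
Qed.

Lemma pf_dwm H w : pf_mx (fun X => dwm H X w).
Proof.
elim: w => [|t w IH] /=; first exact: pf_mx_cst.
apply: pf_mx_add; apply: pf_mx_mul; rewrite //; [|exact: pf_wm|exact: pf_lm].
rewrite /dlm; case: (kd t); last exact: pf_mx_cst.
apply: pf_mx_add; first by apply: pf_mx_mul; [exact: pf_mx_cst|exact: pf_lm].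
move=> i j; under eq_fun do rewrite mxE -mulN1r.
apply: pf_mul; first exact: pf_cst.
by apply: pf_mx_mul; [exact: pf_lm|exact: pf_mx_cst].
Qed.

Lemma pf_dtrp H G : polyfun (fun X => dtrp H X G).
Proof.
elim: G => [|w G IH] /=; first exact: pf_cst.
apply: pf_add; apply: pf_mul => //; try exact: pf_trp.
  by apply: pf_trN; exact: pf_dwm.
by apply: pf_trN; exact: pf_wm.
Qed.

Section Rotation.
Variable E : M.
Hypotheses (EE : E *m E = E) (adjE : adjmx E = E).

Lemma mjet_lm t : mjet (fun eta X => lm (rotation E eta *m X) t) (fun X => dlm E X t).
Proof.
rewrite /dlm /lm; case: (kd t); last by apply: mjet_cst; exact: pf_mx_cst.
have pl : pf_mx (fun X : M => X *m Am t *m adjmx X).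
  apply: pf_mx_mul; last exact: pf_mx_adj.
  by apply: pf_mx_mul; [exact: pf_mx_id|exact: pf_mx_cst].
have h := mjetM (mjetM (mjet_rotation E) (mjet_cst pl)) (mjet_adj_rotation adjE).
have -> : (fun eta X => rotation E eta *m X *m Am t *m adjmx (rotation E eta *m X)) =
  (fun eta X => rotation E eta *m (X *m Am t *m adjmx X) *m adjmx (rotation E eta)).
  by apply/funext => eta; apply/funext => X; rewrite adjmxM !mulmxA.
apply: mjet_eq h => X _.
by rewrite rotation0 adjmx1 mulmx1 mulmx0 addr0 mul1mx mulmxN.
Qed.

Lemma mjet_wm w : mjet (fun eta X => wm (rotation E eta *m X) w) (fun X => dwm E X w).
Proof.
elim: w => [|t w IH] /=.
  have -> : (fun eta X => wm (rotation E eta *m X) [::]) = (fun _ _ => 1%:M).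
    by apply/funext => eta; apply/funext => X; rewrite wm_nil.
  by apply: mjet_cst; exact: pf_mx_cst.
have -> : (fun eta X => wm (rotation E eta *m X) (t :: w)) =
   (fun eta X => lm (rotation E eta *m X) t *m wm (rotation E eta *m X) w).
  by apply/funext => eta; apply/funext => X; rewrite wm_cons.
by apply: mjet_eq (mjetM (mjet_lm t) IH) => X _; rewrite rotation0 mul1mx.
Qed.

Lemma jet_trp G : jet (fun eta X => trp (rotation E eta *m X) G) (fun X => dtrp E X G).
Proof.
elim: G => [|w G IH] /=.
  have -> : (fun eta X => trp (rotation E eta *m X) [::]) = (fun _ _ => 1).
    by apply/funext => eta; apply/funext => X; rewrite /trp big_nil.
  by apply: jet_cst; exact: pf_cst.
have -> : (fun eta X => trp (rotation E eta *m X) (w :: G)) =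
   (fun eta X => trN (wm (rotation E eta *m X) w) * trp (rotation E eta *m X) G).
  by apply/funext => eta; apply/funext => X; rewrite trp_cons.
by apply: jet_eq (jetM (jet_trN (mjet_wm w)) IH) => X _; rewrite rotation0 mul1mx.
Qed.
End Rotation.
End WordDerivations.

Section Adjoint.
Variables (R : realType) (N : nat).

Lemma adjmxZ (c : R[i]) (H : 'M[R[i]]_N) : adjmx (c *: H) = Num.conj c *: adjmx H.
Proof. by apply/matrixP => i j; rewrite !mxE rmorphM. Qed.

Lemma adjmx_rank1 (u : 'cV[R[i]]_N) :
  adjmx (u *m (map_mx Num.conj u)^T) = u *m (map_mx Num.conj u)^T.
Proof.
apply/matrixP => i j; rewrite mxE [LHS]mxE mxE rmorph_sum mxE; apply: eq_bigr => e _.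
by rewrite [_^T _ _]mxE [_^T _ _]mxE mxE [map_mx _ _ _ _]mxE rmorphM /= conjCK mulrC.
Qed.
End Adjoint.

(** * Vanishing of expected derivatives in all directions *)

Section HaarDerivation.
Variables (R : realType) (d : measure_display) (Omega : measurableType d).
Variables (Pr : probability Omega R) (N : nat).
Local Notation M := 'M[R[i]]_N.
Variable U : Omega -> M.
Hypothesis HU : haar_unitary Pr U.
Local Notation haarE := (haarE Pr U).

(** The expectation of [f eta] does not depend on [eta], so [eta] times the expectation of [g] is,
    up to sign, that of a remainder of size O(eta^2). A sufficiently small nonzero [eta] contradicts
    a nonzero expectation. *)
Lemma jet_expectation (f : R[i] -> M -> R[i]) g :
  (forall eta, admissible eta -> polyfun (f eta)) -> polyfun g -> jet f g ->
  (forall eta, admissible eta -> haarE (f eta) = haarE (f 0)) -> haarE g = 0.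
Proof.
move=> pf pg [K hK] inv; apply/eqP; rewrite -nm_eq0; apply/negPn/negP => n0.
have {}n0 : 0 < nm (haarE g) by rewrite lt_neqAle eq_sym n0 nm_ge0.
have [eta [ae eta0 small]] : exists eta : R[i], [/\ admissible eta, eta != 0 &
    nm eta < nm (haarE g) / (2 * (`|K| + 1))].
  by apply: admissible_small; rewrite divr_gt0 // mulr_gt0 // ltr_wpDl.
have pf0 := pf 0 (@admissible0 R); have pfe := pf eta ae.
have p1 := pf_sub pfe pf0.
have p2 : polyfun (fun X => eta * g X) by apply: pf_mul => //; exact: pf_cst.
have pr := pf_sub p1 p2.
have : haarE (fun X => f eta X - f 0 X - eta * g X) = - (eta * haarE g).
  by rewrite (haarEB HU p1 p2) (haarEB HU pfe pf0) inv // subrr sub0r haarEZ.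
have hb : nm (haarE (fun X => f eta X - f 0 X - eta * g X)) <= 2 * (K * nm eta ^+ 2).
  by apply: haarE_bound => // X uX; have [] := hK _ _ ae uX.
move=> E; move: hb; rewrite E nmN nmM.
have e0 : 0 < nm eta by rewrite lt_neqAle eq_sym nm_eq0 eta0 nm_ge0.
rewrite (_ : 2 * (K * nm eta ^+ 2) = nm eta * (2 * (K * nm eta))); last by ring.
rewrite ler_pM2l // => hb.
move: small; rewrite ltr_pdivlMr; last by rewrite mulr_gt0 // ltr_wpDl.
have := ler_norm K => hK2.
have : K * nm eta <= `|K| * nm eta by rewrite ler_wpM2r // nm_ge0.
lra.
Qed.

Variables (T : eqType) (kd : T -> bool) (Am : T -> M).
Local Notation wm := (wm kd Am).
Local Notation trp := (trp kd Am).
Local Notation dwm := (dwm kd Am).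
Local Notation dtrp := (dtrp kd Am).

Section Entry.
Variables (P : seq T) (G : seq (seq T)) (x y : 'I_N).

(** The entry is kept independent of the direction: later [H] becomes the matrix unit with the same
    indices and the sum over these indices is taken. *)
Definition dentry (H : M) : R[i] :=
  haarE (fun X => dwm H X P x y * trp X G + wm X P x y * dtrp H X G).

Let pf_dentry H : polyfun (fun X => dwm H X P x y * trp X G + wm X P x y * dtrp H X G).
Proof.
apply: pf_add; apply: pf_mul; [exact: pf_dwm|exact: pf_trp|exact: pf_wm|exact: pf_dtrp].
Qed.

Lemma dentryP c H H' : dentry (c *: H + H') = c * dentry H + dentry H'.
Proof.
rewrite /dentry -haarEZ // -haarED //; last by apply: pf_mul => //; exact: pf_cst.
by apply: haarE_eq => X _; rewrite dwmP dtrpP !mxE; ring.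
Qed.

(* Invariance under the unitaries [1 + eta E], [|1 + eta| = 1], at first order in [eta]. *)
Lemma dentry_proj E : E *m E = E -> adjmx E = E -> dentry E = 0.
Proof.
move=> EE adjE.
pose f (eta : R[i]) X := wm (rotation E eta *m X) P x y * trp (rotation E eta *m X) G.
have pwt : polyfun (fun X => wm X P x y * trp X G).
  by apply: pf_mul; [exact: pf_wm|exact: pf_trp].
apply: (@jet_expectation f).
- by move=> eta _; apply: (pf_shift (rotation E eta) pwt).
- exact: pf_dentry.
- apply: jet_eq (jetM (mjet_wm kd Am adjE P x y) (jet_trp kd Am adjE G)) => X _.
  by rewrite rotation0 mul1mx.
- have inv eta : admissible eta -> haarE (f eta) = haarE (fun X => wm X P x y * trp X G).
    by move=> ae; exact: (haarE_shift HU (rotation_unitary EE adjE ae) pwt).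
  by move=> eta ae; apply: (etrans (inv eta ae)); symmetry; apply: (inv 0 (@admissible0 R)).
Qed.

Lemma dentry_rank1 (u : 'cV[R[i]]_N) (r : R[i]) : r != 0 -> Num.conj r = r ->
  (map_mx Num.conj u)^T *m u = r%:M ->
  dentry (u *m (map_mx Num.conj u)^T) = 0.
Proof.
move=> r0 cr ur; pose E := r^-1 *: (u *m (map_mx Num.conj u)^T).
have E0 : dentry 0 = 0.
  have := dentryP 0 0 0; rewrite scale0r addr0 mul0r add0r.
  by have := dentryP 1 0 0; rewrite scaler0 addr0 mul1r => /eqP; rewrite -subr_eq0 opprD addrA subrr sub0r oppr_eq0 => /eqP.
have : dentry E = 0.
  apply: dentry_proj.
    rewrite -scalemxAl -scalemxAr mulmxA -(mulmxA u) ur scalerA.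
    by rewrite mul_mx_scalar -scalemxAl scalerA mulfVK.
  by rewrite /E adjmxZ adjmx_rank1 fmorphV [X in X^-1]cr.
have -> : u *m (map_mx Num.conj u)^T = r *: E + 0 by rewrite addr0 scalerA divff // scale1r.
by rewrite dentryP E0 addr0 => ->; rewrite mulr0.
Qed.

(** Polarization: the rank one case is applied to the basis vectors and to [e_a + c e_b]. With
    [c = 1] it shows antisymmetry in [a] and [b], with [c = i] symmetry. *)
Lemma dentry_delta (a b : 'I_N) : dentry (delta_mx a b) = 0.
Proof.
have D H H' : dentry (H + H') = dentry H + dentry H'.
  by rewrite -[H in LHS]scale1r dentryP mul1r.
have Z c H : dentry (c *: H) = c * dentry H.
  have E0 : dentry 0 = 0 by apply: (addrI (dentry 0)); rewrite -D !addr0.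
  by rewrite -[_ *: _]addr0 dentryP E0 addr0.
have cdelta (m n : nat) (i : 'I_m) (j : 'I_n) :
    (map_mx Num.conj (delta_mx i j : 'M[R[i]]_(m, n)))^T = delta_mx j i.
  by apply/matrixP => i' j'; rewrite !mxE rmorph_nat andbC.
have diag e : dentry (delta_mx e e) = 0.
  have := @dentry_rank1 (delta_mx e 0) 1; rewrite cdelta !mul_delta_mx; apply.
  - exact: oner_neq0.
  - exact: rmorph1.
  - by apply/matrixP => i j; rewrite !mxE !ord1.
have [->//|ab] := eqVneq a b.
have h (c : R[i]) : c * Num.conj c = 1 ->
    Num.conj c * dentry (delta_mx a b) + c * dentry (delta_mx b a) = 0.
  move=> cc; pose u : 'cV[R[i]]_N := delta_mx a 0 + c *: delta_mx b 0.
  have uc : (map_mx Num.conj u)^T = delta_mx 0 a + Num.conj c *: delta_mx 0 b.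
    by apply/matrixP => i j; rewrite !mxE rmorphD rmorphM /= !rmorph_nat !(andbC (i == 0)).
  have := @dentry_rank1 u 2; rewrite uc /u !mulmxDl !mulmxDr -!scalemxAl -!scalemxAr.
  rewrite !mul_delta_mx !mul_delta_mx_cond (negbTE ab) (eq_sym b) (negbTE ab).
  rewrite !mulr0n !scaler0 addr0 add0r !scalerA cc (mulrC (Num.conj c)) cc !scale1r.
  rewrite !D !Z !diag addr0 add0r; apply.
  - by rewrite pnatr_eq0.
  - exact: rmorph_nat.
  - by apply/matrixP => i j; rewrite !mxE !ord1.
have := h 1; rewrite rmorph1 mulr1 !mul1r => /(_ erefl) h1.
have ii : 'i%C * Num.conj 'i%C = 1 :> R[i].
  by apply: complex_ext; rewrite ?cReM ?cImM ?cRe_conj ?cIm_conj /=; ring.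
have := h 'i%C ii.
have -> : dentry (delta_mx b a) = - dentry (delta_mx a b) by apply/eqP; rewrite -addr_eq0 addrC h1.
have ci : Num.conj 'i%C = - 'i%C :> R[i].
  by apply: complex_ext; rewrite ?cRe_conj ?cIm_conj /= ?oppr0.
rewrite ci mulrN mulNr -opprD => /eqP; rewrite oppr_eq0 -mulr2n mulrn_eq0 /= mulf_eq0.
case/orP => /eqP // i0; move: ii; rewrite i0 mul0r => /eqP.
by rewrite eq_sym oner_eq0.
Qed.
End Entry.
End HaarDerivation.

(** * Contraction of the derivatives over matrix units *)

Section Contractions.
Variables (R : realType) (N : nat) (T : eqType) (kd : T -> bool).
Local Notation M := 'M[R[i]]_N.
Variable Am : T -> M.
Local Notation lm := (lm kd Am).
Local Notation wm := (wm kd Am).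
Local Notation trp := (trp kd Am).
Local Notation dwm := (dwm kd Am).
Local Notation dtrp := (dtrp kd Am).

Lemma mul_delta_entry (A C : M) (a b x y : 'I_N) :
  (A *m delta_mx a b *m C) x y = A x a * C b y.
Proof.
rewrite -(mul_delta_mx (0 : 'I_1)) mulmxA -mulmxA -colE -rowE mxE big_ord1.
by rewrite !mxE.
Qed.

Lemma sum_mul_delta (A C : M) :
  \sum_a \sum_b (A *m delta_mx a b *m C) a b = \tr A * \tr C.
Proof.
rewrite /mxtrace mulr_suml; apply: eq_bigr => a _; rewrite mulr_sumr.
by apply: eq_bigr => b _; exact: mul_delta_entry.
Qed.

Lemma big_kind_cons (F : nat -> R[i]) t w :
  \sum_(i <- iota 0 (size (t :: w)) | nth false (map kd (t :: w)) i) F i =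
  (if kd t then F 0 else 0) + \sum_(i <- iota 0 (size w) | nth false (map kd w) i) F i.+1.
Proof.
rewrite /= big_cons -[1%N]addn0 iotaDl big_map.
by case: (kd t) => /=; rewrite ?add0r.
Qed.

(** The matrix unit inserted in the word separates its two sides: summing the matching entries gives
    a product of two traces. Normalizing these two traces creates the factor [N^2] of the loop
    equation. *)
Lemma contract_word (X A : M) w :
  \sum_a \sum_b (A *m dwm (delta_mx a b) X w) a b =
  \sum_(i <- iota 0 (size w) | nth false (map kd w) i)
    (\tr (A *m wm X (take i w)) * \tr (wm X (drop i w))
     - \tr (A *m wm X (take i.+1 w)) * \tr (wm X (drop i.+1 w))).
Proof.
elim: w A => [|t w IH] A.
  rewrite big_nil big1 // => a _; rewrite big1 // => b _.
  by rewrite mulmx0 mxE.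
rewrite big_kind_cons /=.
have -> : \sum_a \sum_b (A *m (dlm kd Am (delta_mx a b) X t *m wm X w
      + lm X t *m dwm (delta_mx a b) X w)) a b =
   \sum_a \sum_b (A *m dlm kd Am (delta_mx a b) X t *m wm X w) a b
   + \sum_a \sum_b (A *m lm X t *m dwm (delta_mx a b) X w) a b.
  rewrite -big_split; apply: eq_bigr => a _; rewrite -big_split; apply: eq_bigr => b _.
  by rewrite mulmxDr !mulmxA mxE.
rewrite IH; congr (_ + _); last first.
  by apply: eq_bigr => i _; rewrite !wm_cons !mulmxA.
case kt : (kd t); last first.
  rewrite big1 // => a _; rewrite big1 // => b _.
  by rewrite /dlm kt mulmx0 mul0mx mxE.
rewrite take0 drop0 wm_nil mulmx1 [wm X [:: t]]wm_cons wm_nil mulmx1 wm_cons.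
rewrite -!sum_mul_delta -sumrB; apply: eq_bigr => a _; rewrite -sumrB; apply: eq_bigr => b _.
by rewrite /dlm kt mulmxBr mulmxBl !mulmxA [LHS]mxE [X in _ + X]mxE.
Qed.

Lemma trace_dwm (H X A : M) w :
  \tr (A *m dwm H X w) = \sum_(i <- iota 0 (size w) | nth false (map kd w) i)
    (\tr (H *m (wm X (drop i w) *m A *m wm X (take i w)))
     - \tr (H *m (wm X (drop i.+1 w) *m A *m wm X (take i.+1 w)))).
Proof.
elim: w A => [|t w IH] A; first by rewrite big_nil mulmx0 mxtrace0.
rewrite big_kind_cons /= mulmxDr mxtraceD !mulmxA IH; congr (_ + _); last first.
  by apply: eq_bigr => i _; rewrite !wm_cons !mulmxA.
case kt : (kd t); last by rewrite /dlm kt mulmx0 mul0mx mxtrace0.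
rewrite take0 drop0 wm_nil mulmx1 [wm X [:: t]]wm_cons wm_nil mulmx1 wm_cons.
rewrite /dlm kt mulmxBr mulmxBl raddfB /= !mulmxA; congr (_ - _).
  by rewrite -!mulmxA mxtrace_mulC !mulmxA.
by rewrite -[in LHS]mulmxA mxtrace_mulC !mulmxA.
Qed.

(** The matrix units weighted by the entries of [P] add up to [P], which is thereby inserted into
    the cyclic word [q]. A single trace is left, hence no power of [N] appears. *)
Lemma trN_dwm (P : M) (X : M) q :
  \sum_a \sum_b P a b * trN (dwm (delta_mx a b) X q) =
  \sum_(i <- iota 0 (size q) | nth false (map kd q) i)
    (trN (P *m wm X (rot i q)) - trN (P *m wm X (rot i.+1 q))).
Proof.
have tr_delta (a b : 'I_N) (K : M) : \tr (delta_mx a b *m K) = K b a.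
  rewrite -[delta_mx a b]mul1mx /mxtrace (bigD1 a) //= big1.
    by rewrite addr0 mul_delta_entry mxE eqxx mul1r.
  by move=> e ea; rewrite mul_delta_entry mxE (negbTE ea) mul0r.
have trPK (K : M) : \sum_a \sum_b P a b * \tr (delta_mx a b *m K) = \tr (P *m K).
  rewrite [RHS]/mxtrace; apply: eq_bigr => a _; rewrite [RHS]mxE.
  by apply: eq_bigr => b _; rewrite tr_delta.
have e a b : P a b * trN (dwm (delta_mx a b) X q) =
    \sum_(i <- iota 0 (size q) | nth false (map kd q) i)
     (P a b * \tr (delta_mx a b *m wm X (rot i q))
      - P a b * \tr (delta_mx a b *m wm X (rot i.+1 q))) / N%:R.
  rewrite /trN -[dwm _ _ _]mul1mx trace_dwm mulrA mulr_sumr mulr_suml; apply: eq_bigr => i _.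
  by rewrite !mulmx1 -!wm_cat mulrBr.
under eq_bigr => a _.
  under eq_bigr => b _ do rewrite e.
  rewrite exchange_big /=; over.
rewrite exchange_big /=; apply: eq_bigr => i _.
rewrite /trN -mulrBl -!trPK -sumrB mulr_suml; apply: eq_bigr => a _.
by rewrite -sumrB mulr_suml.
Qed.

Lemma sum_dtrp (X : M) P G :
  \sum_a \sum_b wm X P a b * dtrp (delta_mx a b) X G =
  \sum_(p <- merge_config (merge_terms R kd true P) G) p.1 * trp X p.2.
Proof.
elim: G => [|Q G IH] /=.
  rewrite big_nil big1 // => a _; rewrite big1 // => b _; exact: mulr0.
rewrite big_cat !big_map /=.
have -> : \sum_a \sum_b wm X P a b * (trN (dwm (delta_mx a b) X Q) * trp X G
      + trN (wm X Q) * dtrp (delta_mx a b) X G) =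
   (\sum_a \sum_b wm X P a b * trN (dwm (delta_mx a b) X Q)) * trp X G
   + trN (wm X Q) * (\sum_a \sum_b wm X P a b * dtrp (delta_mx a b) X G).
  rewrite mulr_suml mulr_sumr -big_split; apply: eq_bigr => a _.
  rewrite mulr_suml mulr_sumr -big_split; apply: eq_bigr => b _ /=.
  by move: (trp X G) => z; ring.
rewrite IH trN_dwm mulr_sumr; congr (_ + _).
  rewrite /merge_terms big_flatten big_map big_filter.
  under [in RHS]eq_bigl do rewrite eqb_id.
  rewrite mulr_suml; apply: eq_bigr => i _.
  by rewrite !big_cons big_nil /= !trp_cons !wm_cat mul1r mulN1r addr0 mulrBl.
by apply: eq_bigr => p _; rewrite trp_cons mulrCA.
Qed.

Lemma telescope_iota (f : nat -> R[i]) m n :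
  \sum_(i <- iota m n) (f i - f i.+1) = f m - f (m + n)%N.
Proof.
elim: n m => [|n IH] m /=; first by rewrite big_nil addn0 subrr.
by rewrite big_cons IH addrA subrK addSnnS.
Qed.

Lemma sum_both_kinds (F : nat -> R[i]) w :
  \sum_(i <- iota 0 (size w) | nth false (map kd w) i == true) F i
  + \sum_(i <- iota 0 (size w) | nth false (map kd w) i == false) F i = \sum_(i <- iota 0 (size w)) F i.
Proof.
rewrite [RHS](bigID (fun i => nth false (map kd w) i)) /=; congr (_ + _); apply: eq_bigl => i.
  by rewrite eqb_id.
by rewrite eqbF_neg.
Qed.

(** Over the letters of both kinds the sum telescopes, and its two ends are the same product, that
    of the traces of [P] and of the empty word. The equation for deterministic letters is thus the
    opposite of the one for conjugated letters. *)
Lemma split_both (X : M) P G :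
  \sum_(i <- iota 0 (size P) | nth false (map kd P) i == false)
    (trp X (take i P :: drop i P :: G) - trp X (take i.+1 P :: drop i.+1 P :: G)) =
  - \sum_(i <- iota 0 (size P) | nth false (map kd P) i == true)
    (trp X (take i P :: drop i P :: G) - trp X (take i.+1 P :: drop i.+1 P :: G)).
Proof.
apply/eqP; rewrite -addr_eq0 addrC; apply/eqP.
rewrite sum_both_kinds.
rewrite (telescope_iota (fun i => trp X (take i P :: drop i P :: G))).
rewrite add0n take0 drop0 take_size drop_size !trp_cons mulrCA; apply/eqP.
by rewrite subr_eq0 mulrCA.
Qed.

(** The same telescoping, now along a full turn of each cyclic word [Q], whose rotations by 0 and by
    its size coincide. *)
Lemma merge_both (X : M) P G :
  \sum_(p <- merge_config (merge_terms R kd false P) G) p.1 * trp X p.2 =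
  - \sum_(p <- merge_config (merge_terms R kd true P) G) p.1 * trp X p.2.
Proof.
elim: G => [|Q G IH] /=; first by rewrite !big_nil oppr0.
rewrite !big_cat !big_map /= opprD; congr (_ + _); last first.
  under eq_bigr do rewrite trp_cons mulrCA.
  rewrite -mulr_sumr IH mulrN mulr_sumr; congr (- _).
  by apply: eq_bigr => p _; rewrite trp_cons mulrCA.
have e kappa : \sum_(p <- merge_terms R kd kappa P Q) p.1 * trp X (p.2 :: G) =
    (\sum_(i <- iota 0 (size Q) | nth false (map kd Q) i == kappa)
       (trp X ((P ++ rot i Q) :: G) - trp X ((P ++ rot i.+1 Q) :: G))).
  rewrite /merge_terms big_flatten big_map big_filter; apply: eq_bigr => i _.
  by rewrite !big_cons big_nil /= mul1r mulN1r addr0.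
rewrite !e; apply/eqP; rewrite -addr_eq0 addrC; apply/eqP.
rewrite sum_both_kinds.
rewrite (telescope_iota (fun i => trp X ((P ++ rot i Q) :: G))).
by rewrite add0n rot0 rot_size subrr.
Qed.
End Contractions.

Section HaarLoopEquation.
Variables (R : realType) (d : measure_display) (Omega : measurableType d).
Variables (Pr : probability Omega R) (N : nat).
Local Notation M := 'M[R[i]]_N.
Variable U : Omega -> M.
Hypothesis HU : haar_unitary Pr U.
Variables (T : eqType) (kd : T -> bool) (Am : T -> M).
Local Notation wm := (wm kd Am).
Local Notation trp := (trp kd Am).

Lemma haar_loop_equation kappa P G : (0 < N)%N ->
  N%:R ^+ 2 * (\sum_(i <- iota 0 (size P) | nth false (map kd P) i == kappa)
    (haarE Pr U (fun X => trp X (take i P :: drop i P :: G))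
     - haarE Pr U (fun X => trp X (take i.+1 P :: drop i.+1 P :: G))))
  + \sum_(p <- merge_config (merge_terms R kd kappa P) G) p.1 * haarE Pr U (fun X => trp X p.2) = 0.
Proof.
move=> N0.
have pt H : polyfun (fun X => trp X H) := pf_trp kd Am H.
have pB A B : polyfun (fun X => trp X A - trp X B) by apply: pf_sub.
pose S k X := \sum_(i <- iota 0 (size P) | nth false (map kd P) i == k)
  (trp X (take i P :: drop i P :: G) - trp X (take i.+1 P :: drop i.+1 P :: G)).
pose Mg k X := \sum_(p <- merge_config (merge_terms R kd k P) G) p.1 * trp X p.2.
have pS k : polyfun (S k) by apply: pf_sum => i; exact: pB.
have pM k : polyfun (Mg k).
  by apply: pf_sum => p; apply: pf_mul => //; exact: pf_cst.
have pNS k : polyfun (fun X => N%:R ^+ 2 * S k X) by apply: pf_mul => //; exact: pf_cst.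
suff main k : haarE Pr U (fun X => N%:R ^+ 2 * S k X + Mg k X) = 0.
  rewrite -[RHS](main kappa) (haarED HU (pNS _) (pM _)) (haarEZ HU _ (pS _)); congr (_ * _ + _).
    rewrite /S (haarE_sum HU); last by move=> i; exact: pB.
    by apply: eq_bigr => i _; rewrite (haarEB HU).
  have pp (p : R[i] * seq (seq T)) : polyfun (fun X => p.1 * trp X p.2).
    by apply: pf_mul => //; exact: pf_cst.
  symmetry; apply: (etrans (haarE_sum HU _ xpredT pp)).
  by apply: eq_bigr => p _; rewrite (haarEZ HU).
have mt : haarE Pr U (fun X => N%:R ^+ 2 * S true X + Mg true X) = 0.
  have NR : (N%:R : R[i]) != 0 by rewrite pnatr_eq0 -lt0n.
  (* Each [F a b] has expectation zero by [dentry_delta]; their sum over [a] and [b] contracts to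
     the integrand of the loop equation. *)
  pose F a b X := dwm kd Am (delta_mx a b) X P a b * trp X G
      + wm X P a b * dtrp kd Am (delta_mx a b) X G.
  have pF a b : polyfun (F a b).
    by apply: pf_add; apply: pf_mul; [exact: pf_dwm|exact: pf_trp|exact: pf_wm|exact: pf_dtrp].
  have -> : (fun X => N%:R ^+ 2 * S true X + Mg true X) = (fun X => \sum_a \sum_b F a b X).
    apply/funext => X; rewrite /Mg -sum_dtrp.
    have -> : \sum_a \sum_b F a b X = (\sum_a \sum_b (1%:M *m dwm kd Am (delta_mx a b) X P) a b) * trp X G
       + \sum_a \sum_b wm X P a b * dtrp kd Am (delta_mx a b) X G.
      rewrite mulr_suml -big_split; apply: eq_bigr => a _.
      rewrite mulr_suml -big_split; apply: eq_bigr => b _ /=.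
      by rewrite mul1mx.
    congr (_ + _); rewrite contract_word mulr_suml mulr_sumr.
    apply: eq_big => [i|i _]; first by rewrite eqb_id.
    rewrite !mul1mx !trp_cons /trN mulrBr mulrBl.
    by congr (_ - _); move: (trp X G) (\tr _) (\tr _) => z u v; field.
  have pFs a : polyfun (fun X => \sum_b F a b X) by apply: pf_sum.
  apply: (etrans (haarE_sum HU (index_enum _) xpredT pFs)); apply: big1 => a _.
  apply: (etrans (haarE_sum HU (index_enum _) xpredT (pF a))); apply: big1 => b _.
  exact: dentry_delta.
case: k => //.
have -> : (fun X => N%:R ^+ 2 * S false X + Mg false X) =
   (fun X => -1 * (N%:R ^+ 2 * S true X + Mg true X)).
  apply/funext => X; rewrite /S /Mg split_both merge_both.
  by rewrite mulrN mulN1r opprD.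
by rewrite (haarEZ HU) ?mt ?mulr0 //; apply: pf_add.
Qed.
End HaarLoopEquation.

(** * Mixed moments of deterministic and conjugated matrices *)

Section MatrixModel.
Variables (R : realType) (d : measure_display) (Omega : measurableType d).
Variable Pr : probability Omega R.
Variable U : forall N : nat, Omega -> 'M[R[i]]_N.
Hypothesis HU : forall N, haar_unitary Pr (U N).
Variables (T : eqType) (mk kd : T -> bool).
Variable Am : forall N : nat, T -> 'M[R[i]]_N.

Local Notation trpN N := (@trp R N T kd (@Am N)).
Local Notation wmN N := (@wm R N T kd (@Am N)).

Definition mixed N (G : seq (seq T)) : R[i] := haarE Pr (U N) (fun X => trpN N X G).

Definition detw N (W : seq T) : R[i] := trN (\prod_(t <- W) Am N t).

Lemma trN_mulC N (A B : 'M[R[i]]_N) : trN (A *m B) = trN (B *m A).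
Proof. by rewrite /trN mxtrace_mulC. Qed.

Lemma unitary_adjl N (X : 'M[R[i]]_N) : unitary X -> adjmx X *m X = 1%:M.
Proof. exact: mulmx1C. Qed.

Lemma trN1 N : (0 < N)%N -> trN (1%:M : 'M[R[i]]_N) = 1.
Proof. by move=> N0; rewrite /trN mxtrace1 divff // pnatr_eq0 -lt0n. Qed.

(** Between conjugated letters the factors [X* X] cancel, and the outer [X] and [X*] meet by
    cyclicity of the trace. *)
Lemma trN_wm_pure N X W : unitary X -> pure kd W -> trN (wmN N X W) = detw N W.
Proof.
move=> uX /orP[] h; last first.
  rewrite /detw /wm; congr trN; apply: eq_big_seq => t tW.
  by move/allP: h => /(_ t tW) /= /negbTE kt; rewrite /lm kt.
have : wmN N X W *m X = X *m \prod_(t <- W) Am N t.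
  elim: W h => [_|t W IH /= /andP[kt /IH h]].
    by rewrite wm_nil big_nil mul1mx mulmx1.
  rewrite wm_cons -mulmxA h /lm kt big_cons -!mulmxA; congr (_ *m (_ *m _)).
  by rewrite mulmxA unitary_adjl // mul1mx.
move=> E; rewrite /detw -[in LHS](mulmx1 (wmN N X W)) -[in LHS]uX mulmxA E.
by rewrite trN_mulC mulmxA unitary_adjl // mul1mx.
Qed.

Lemma mixed_perm N G G' : perm_eq G G' -> mixed N G = mixed N G'.
Proof. by move=> h; apply: haarE_eq => X _; exact: perm_big. Qed.

Lemma mixed_rot N u v G : mixed N ((u ++ v) :: G) = mixed N ((v ++ u) :: G).
Proof. by apply: haarE_eq => X _; rewrite !trp_cons !wm_cat trN_mulC. Qed.

Lemma mixed_cons_pure N W G : pure kd W -> mixed N (W :: G) = detw N W * mixed N G.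
Proof.
move=> pW; rewrite /mixed -(haarEZ (HU N)); last exact: pf_trp.
by apply: haarE_eq => X uX; rewrite trp_cons trN_wm_pure.
Qed.

Lemma mixed_nil N : mixed N [::] = 1.
Proof.
rewrite -[RHS](haarE_cst Pr (U N)).
by apply: haarE_eq => X _; rewrite /trp big_nil.
Qed.

Lemma mixed1_pure N W : pure kd W -> mixed N [:: W] = detw N W.
Proof. by move=> pW; rewrite mixed_cons_pure // mixed_nil mulr1. Qed.

Lemma mixed_pure N W G : (0 < N)%N -> pure kd W -> mixed N (W :: G) = mixed N [:: W] * mixed N G.
Proof. by move=> _ pW; rewrite mixed_cons_pure // mixed1_pure. Qed.

Lemma mixed_nilw N : (0 < N)%N -> mixed N [:: [::]] = 1.
Proof. by move=> N0; rewrite mixed1_pure // /detw big_nil trN1. Qed.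

Lemma mixed_loop N kappa P G : (0 < N)%N ->
  N%:R ^+ 2 * (\sum_(i <- iota 0 (size P) | nth false (map kd P) i == kappa)
    (mixed N (take i P :: drop i P :: G) - mixed N (take i.+1 P :: drop i.+1 P :: G)))
  + \sum_(p <- merge_config (merge_terms R kd kappa P) G) p.1 * mixed N p.2 = 0.
Proof. exact: haar_loop_equation. Qed.

Hypothesis pure_cvg : forall W, pure kd W -> exists c, cvgC (fun N => detw N W) c.
Hypothesis pure_cvg_mk : forall W, pure kd W -> has mk W ->
  exists c, cvgC (fun N => N%:R * detw N W) c.

Lemma weighted_pure_bounded W : pure kd W -> bigON 0 (fun N => wx mk mixed N [:: W]).
Proof.
move=> pW; have e N : wx mk mixed N [:: W] = (wt mk N W)%:R * detw N W.
  by rewrite /wx /wtc big_seq1 mixed1_pure.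
under eq_fun do rewrite e.
rewrite /wt; case: (boolP (has mk W)) => mW.
  by have [c hc] := pure_cvg_mk pW mW; exact: cvgC_bigON hc.
have [c hc] := pure_cvg pW.
by apply: bigON_eq (cvgC_bigON hc) => N _; rewrite mul1r.
Qed.

Let weighted_bounded G : [::] \notin G -> bigON 0 (fun N => wx mk mixed N G) :=
  @wx_bounded R T mk kd mixed mixed_perm mixed_rot mixed_pure (fun N _ => mixed_nil N)
    mixed_nilw mixed_loop weighted_pure_bounded G.

Lemma wtc_ge1 N G : (0 < N)%N -> (1 <= wtc mk N G)%N.
Proof. by move=> N0; rewrite prodn_cond_gt0 // => w _; exact: wt_gt0. Qed.

Lemma wtc_geN N G : (0 < N)%N -> has mk (flatten G) -> (N <= wtc mk N G)%N.
Proof.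
move=> N0; elim: G => //= w G IH; rewrite has_cat wtc_cons => /orP[mw|/IH h].
  by rewrite /wt mw leq_pmulr // wtc_ge1.
by rewrite (leq_trans h) // leq_pmull // wt_gt0.
Qed.

Lemma mixed_pure_config_cvg G : all (pure kd) G -> exists c, cvgC (fun N => mixed N G) c.
Proof.
elim: G => [_|W G IH /= /andP[pW /IH[c hc]]].
  by exists 1; apply: (@cvgC_eq _ 0 _ _ _ _ (cvgC_cst 1)) => N _; rewrite mixed_nil.
have [b hb] := pure_cvg pW; exists (b * c).
by apply: (@cvgC_eq _ 0 _ _ _ _ (cvgCM hb hc)) => N _; rewrite mixed_cons_pure.
Qed.

Lemma mixed_pure_config_cvg_mk G : all (pure kd) G -> has mk (flatten G) ->
  exists c, cvgC (fun N => N%:R * mixed N G) c.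
Proof.
elim: G => [//|W G IH /= /andP[pW pG]]; rewrite has_cat.
case: (boolP (has mk W)) => [mW _|_ /(IH pG)[c hc]].
  have [b hb] := pure_cvg_mk pW mW; have [c hc] := mixed_pure_config_cvg pG.
  exists (b * c); apply: (@cvgC_eq _ 0 _ _ _ _ (cvgCM hb hc)) => N _.
  by rewrite mixed_cons_pure // mulrA.
have [b hb] := pure_cvg pW; exists (b * c).
apply: (@cvgC_eq _ 0 _ _ _ _ (cvgCM hb hc)) => N _.
by rewrite mixed_cons_pure // mulrCA.
Qed.

Lemma mixed_cvg W : W != [::] -> exists c, cvgC (fun N => mixed N [:: W]) c.
Proof.
move=> W0.
have [|||c hc] := @cvg_configs R T mk kd mixed mixed_perm mixed_rot mixed_pure
    mixed_nilw mixed_loop (fun=> 1) W _ _ [:: W].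
- move=> G; rewrite mem_configs => /andP[G0 _].
  have h := @bigON_wt R 0 (fun=> 1%N) _ _ (fun N N0 => wtc_ge1 G N0) (weighted_bounded G0).
  exact: h.
- move=> G _ pG; have [c hc] := mixed_pure_config_cvg pG; exists c.
  by apply: (@cvgC_eq _ 0 _ _ _ _ hc) => N _; rewrite mul1r.
- by rewrite mem_configs /= cats0 perm_refl inE eq_sym W0.
by exists c; apply: (@cvgC_eq _ 0 _ _ _ _ hc) => N _; rewrite mul1r.
Qed.

Lemma mixed_cvg_mk W : has mk W -> exists c, cvgC (fun N => N%:R * mixed N [:: W]) c.
Proof.
move=> mW; have W0 : W != [::] by case: W mW.
have [|||c hc] := @cvg_configs R T mk kd mixed mixed_perm mixed_rot mixed_pure
    mixed_nilw mixed_loop (fun N => N%:R) W _ _ [:: W].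
- move=> G; rewrite mem_configs => /andP[G0 Gs].
  have mG : has mk (flatten G) by rewrite (perm_has _ Gs).
  exact: (@bigON_wt R 0 id _ _ (fun N N0 => wtc_geN N0 mG) (weighted_bounded G0)).
- move=> G; rewrite mem_configs => /andP[G0 Gs] pG.
  by apply: mixed_pure_config_cvg_mk => //; rewrite (perm_has _ Gs).
- by rewrite mem_configs /= cats0 perm_refl inE eq_sym W0.
by exists c.
Qed.

(** This is the covariance bound [ckap1] with [v] as the only centred word. *)
Lemma mixed_factor u v : u != [::] -> v != [::] ->
  bigON 1 (fun N => (wt mk N u * wt mk N v)%:R * (mixed N [:: u; v] - mixed N [:: u] * mixed N [:: v])).
Proof.
move=> u0 v0.
have := @ckap1 R T mk kd mixed mixed_perm mixed_rot mixed_pure (fun N _ => mixed_nil N)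
    mixed_nilw mixed_loop weighted_pure_bounded [:: v] [:: u] erefl.
rewrite !inE !(eq_sym [::]) u0 v0 => /(_ isT isT).
apply: bigON_eq => N N0; rewrite /wtc !big_seq1 /ckap /= mixed_nil mulr1 subrr mulr0 subr0.
rewrite (@mixed_perm N [:: v; u] [:: u; v]) 1?(mulrC (mixed N [:: v])) //.
by apply/permP => a /=; rewrite addnCA.
Qed.

Lemma mixed_loop_word N (t : T) w : (0 < N)%N -> kd (last t w) != kd t ->
  mixed N [:: t :: w] = mixed N [:: [:: t]; w]
   - \sum_(i <- iota 1 (size w) | nth false (map kd (t :: w)) i == kd t)
       (mixed N [:: take i (t :: w); drop i (t :: w)]
        - mixed N [:: take i.+1 (t :: w); drop i.+1 (t :: w)]).
Proof.
move=> N0 lw.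
rewrite (@loop_split R T kd mixed mixed_pure mixed_nilw mixed_loop N t w [::] N0 lw) /=.
by rewrite [X in _ - _ * X]big_nil mulr0 subr0.
Qed.

Lemma kap_haarE N G Fs : kap mixed N G Fs =
  haarE Pr (U N) (fun X => trpN N X G * \prod_(f <- Fs) (trN (wmN N X f) - mixed N [:: f])).
Proof.
elim: Fs G => [|f Fs IH] G /=.
  by apply: haarE_eq => X _; rewrite big_nil mulr1.
pose Q X := \prod_(f <- Fs) (trN (wmN N X f) - mixed N [:: f]).
have pQ : polyfun Q.
  rewrite /Q; elim: (Fs) => [|g Gs IHg]; first by under eq_fun do rewrite big_nil; exact: pf_cst.
  under eq_fun do rewrite big_cons.
  apply: pf_mul => //; apply: pf_sub; last exact: pf_cst.
  by apply: pf_trN; exact: pf_wm.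
have p1 H : polyfun (fun X => trpN N X H * Q X) by apply: pf_mul => //; exact: pf_trp.
have p2 : polyfun (fun X => mixed N [:: f] * (trpN N X G * Q X)).
  by apply: pf_mul => //; exact: pf_cst.
rewrite !IH -(haarEZ (HU N) _ (p1 G)) -(haarEB (HU N) (p1 (f :: G)) p2).
by apply: haarE_eq => X _; rewrite big_cons trp_cons -/(Q X); ring.
Qed.

Lemma fourth_moment Fs : size Fs = 4 -> [::] \notin Fs ->
  bigON 2 (fun N => (wtc mk N Fs)%:R *
    haarE Pr (U N) (fun X => \prod_(f <- Fs) (trN (wmN N X f) - mixed N [:: f]))).
Proof.
case: Fs => [//|f Fs] [s3] F0.
have := @fourth_moment_bound R T mk kd mixed mixed_perm mixed_rot mixed_pure (fun N _ => mixed_nil N)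
    mixed_nilw mixed_loop weighted_pure_bounded f Fs s3 F0.
apply: bigON_eq => N N0; rewrite kap_haarE; congr (_ * _).
by apply: haarE_eq => X _; rewrite /trp big_nil mul1r.
Qed.
End MatrixModel.

(** * Noncommutative polynomials *)

Section Evaluation.
Variables (R : realType) (k l N : nat).
Implicit Types (p q : ncpoly R k l).
Variable f : letter k l -> 'M[R[i]]_N.
Local Notation mon m := (\prod_(x <- (m : seq (letter k l))) f x).

Lemma ev_wide (E : {fset {fmonom (letter k l)}}) p : (msupp p `<=` E)%fset ->
  ev f p = \sum_(m <- E) p@_m *: mon m.
Proof.
move=> le; rewrite /ev; apply: (big_fset_incl _ le) => x xE /mcoeff_outdom ->.
by rewrite scale0r.
Qed.

Lemma evD p q : ev f (p + q) = ev f p + ev f q.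
Proof.
pose E := (msupp p `|` msupp q)%fset.
have hp : (msupp p `<=` E)%fset by exact: fsubsetUl.
have hq : (msupp q `<=` E)%fset by exact: fsubsetUr.
rewrite (ev_wide hp) (ev_wide hq) (ev_wide (msuppD_le _ _)) -big_split /=.
by apply: eq_bigr => m _; rewrite mcoeffD scalerDl.
Qed.

Lemma evZ c p : ev f (c *: p) = c *: ev f p.
Proof.
rewrite (ev_wide (msuppZ_le _ _)) /ev scaler_sumr.
by apply: eq_bigr => m _; rewrite mcoeffZ scalerA.
Qed.

Lemma evU c m : ev f (<< c *g m >> : ncpoly R k l) = c *: mon m.
Proof. by rewrite (ev_wide msuppU_le) big_seq_fset1 mcoeffUU. Qed.

Lemma ev0 : ev f (0 : ncpoly R k l) = 0.
Proof. by rewrite -(scale0r (0 : ncpoly R k l)) evZ scale0r. Qed.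

Lemma ev_sum (I : Type) (r : seq I) (F : I -> ncpoly R k l) :
  ev f (\sum_(i <- r) F i) = \sum_(i <- r) ev f (F i).
Proof. by elim: r => [|i r IH]; rewrite ?big_nil ?ev0 // !big_cons evD IH. Qed.

Lemma evM p q : ev f (p * q) = ev f p * ev f q.
Proof.
rewrite malgME ev_sum [ev f p]/ev mulr_suml; apply: eq_bigr => m _.
rewrite ev_sum [ev f q]/ev mulr_sumr; apply: eq_bigr => m' _.
by rewrite evU fmM big_cat /= -!mulmxE -scalemxAl -scalemxAr scalerA.
Qed.

Lemma ev1 : ev f (1 : ncpoly R k l) = 1.
Proof.
have -> : (1 : ncpoly R k l) = << (1 : R[i]) *g (@fmone (letter k l)) >> by [].
by rewrite evU fmoneE big_nil scale1r.
Qed.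

Lemma ev_prod (I : Type) (r : seq I) (F : I -> ncpoly R k l) :
  ev f (\prod_(i <- r) F i) = \prod_(i <- r) ev f (F i).
Proof. by elim: r => [|i r IH]; rewrite ?big_nil ?ev1 // !big_cons evM IH. Qed.
End Evaluation.

Section GeneratedIdeals.
Variable A : pzRingType.
Implicit Types B S Q : A -> Prop.

Lemma ideal_gen_mono B B' S S' :
  (forall x, B x -> B' x) -> (forall x, S x -> S' x) ->
  forall x, ideal_gen B S x -> ideal_gen B' S' x.
Proof.
move=> BB SS x; elim=> [|y z _ h _ h'|a g c ha hg hc]; first exact: ideal_gen0.
  exact: ideal_genD.
by apply: ideal_genM; [exact: BB|exact: SS|exact: BB].
Qed.

Lemma ideal_gen_span B S Q : Q 0 -> (forall x y, Q x -> Q y -> Q (x + y)) ->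
  (forall a g c, S g -> Q (a * g * c)) ->
  forall x, ideal_gen B S x -> forall a c, Q (a * x * c).
Proof.
move=> Q0 QD QS x; elim=> [a c|y z _ hy _ hz a c|a' g c' _ hg _ a c].
- by rewrite mulr0 mul0r.
- by rewrite mulrDr mulrDl; apply: QD.
- by rewrite !mulrA -[_ * c' * c]mulrA; apply: QS.
Qed.

Lemma ideal_gen_ind_span B S Q : Q 0 -> (forall x y, Q x -> Q y -> Q (x + y)) ->
  (forall a g c, S g -> Q (a * g * c)) -> forall x, ideal_gen B S x -> Q x.
Proof.
move=> Q0 QD QS x hx; rewrite -[x]mul1r -[1 * x]mulr1.
exact: (ideal_gen_span Q0 QD QS hx).
Qed.

Lemma ideal_genMl B S a x : (forall y z, B y -> B z -> B (y * z)) -> B a ->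
  ideal_gen B S x -> ideal_gen B S (a * x).
Proof.
move=> BM ha; elim=> [|y z _ hy _ hz|c g e hc hg he].
- by rewrite mulr0; exact: ideal_gen0.
- by rewrite mulrDr; exact: ideal_genD.
- by rewrite !mulrA; apply: ideal_genM => //; exact: BM.
Qed.

Lemma ideal_genMr B S a x : (forall y z, B y -> B z -> B (y * z)) -> B a ->
  ideal_gen B S x -> ideal_gen B S (x * a).
Proof.
move=> BM ha; elim=> [|y z _ hy _ hz|c g e hc hg he].
- by rewrite mul0r; exact: ideal_gen0.
- by rewrite mulrDl; exact: ideal_genD.
- by rewrite -mulrA; apply: ideal_genM => //; exact: BM.
Qed.

Lemma ideal_gen_gen B S g : B 1 -> S g -> ideal_gen B S g.
Proof. by move=> B1 hg; rewrite -[g]mul1r -[1 * g]mulr1; exact: ideal_genM. Qed.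
End GeneratedIdeals.

Section Subalgebras.
Variables (R : realType) (k l : nat).
Implicit Types (p q : ncpoly R k l) (b : bool).

(* [false] indexes C<X>, [true] indexes C<Y>. *)
Definition of_kind b (x : letter k l) : bool := if x is inl _ then ~~ b else b.

Definition inSub b p := forall m : {fmonom (letter k l)}, p@_m != 0 -> all (of_kind b) (m : seq (letter k l)).

Lemma inSubE b p : in_sub (@inA1 R k l) (@inA2 R k l) b p <-> inSub b p.
Proof.
by case: b; split=> h m /h; apply: sub_all => -[].
Qed.

Lemma inSub0 b : inSub b 0.
Proof. by move=> m; rewrite mcoeff0 eqxx. Qed.

Lemma inSubU b (c : R[i]) (m : {fmonom (letter k l)}) : all (of_kind b) (m : seq (letter k l)) -> inSub b (<< c *g m >> : ncpoly R k l).
Proof.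
move=> h m'; rewrite mcoeffU; have [<- //|] := eqVneq m m'.
by rewrite mulr0n eqxx.
Qed.

Lemma inSub1 b : inSub b 1.
Proof.
have -> : (1 : ncpoly R k l) = << (1 : R[i]) *g (@fmone (letter k l)) >> by [].
by apply: inSubU; rewrite fmoneE.
Qed.

Lemma inSubD b p q : inSub b p -> inSub b q -> inSub b (p + q).
Proof.
move=> hp hq m; rewrite mcoeffD; have [p0|/hp //] := eqVneq p@_m 0.
by rewrite p0 add0r; exact: hq.
Qed.

Lemma inSubZ b c p : inSub b p -> inSub b (c *: p).
Proof.
by move=> hp m; rewrite mcoeffZ mulf_eq0 negb_or => /andP[_ /hp].
Qed.

Lemma inSub_sum b (I : eqType) (r : seq I) (F : I -> ncpoly R k l) :
  (forall i, i \in r -> inSub b (F i)) -> inSub b (\sum_(i <- r) F i).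
Proof.
elim: r => [|i r IH] h; first by rewrite big_nil; exact: inSub0.
rewrite big_cons; apply: inSubD; first by apply: h; rewrite mem_head.
by apply: IH => j jr; apply: h; rewrite inE jr orbT.
Qed.

Lemma inSubM b p q : inSub b p -> inSub b q -> inSub b (p * q).
Proof.
move=> hp hq; rewrite malgME; apply: inSub_sum => m1; rewrite -mcoeff_neq0 => /hp h1.
apply: inSub_sum => m2; rewrite -mcoeff_neq0 => /hq h2.
by apply: inSubU; rewrite fmM all_cat h1.
Qed.

Lemma inSub_prod b (I : eqType) (r : seq I) (F : I -> ncpoly R k l) :
  (forall i, i \in r -> inSub b (F i)) -> inSub b (\prod_(i <- r) F i).
Proof.
elim: r => [|i r IH] h; first by rewrite big_nil; exact: inSub1.
rewrite big_cons; apply: inSubM; first by apply: h; rewrite mem_head.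
by apply: IH => j jr; apply: h; rewrite inE jr orbT.
Qed.

Lemma inSub_center b p c : inSub b p -> inSub b (p - c *: 1).
Proof.
move=> h; apply: inSubD => //; rewrite -scaleNr; apply: inSubZ; exact: inSub1.
Qed.

Lemma ncpoly_scaleAr c p q : p * (c *: q) = c *: (p * q).
Proof.
apply/malgP => m; rewrite [RHS]mcoeffZ (mcoeffMl p q).
rewrite (mcoeffMlw m (fsubset_refl (msupp p)) (msuppZ_le c q)).
rewrite mulr_sumr; apply: eq_bigr => m1 _; rewrite mulr_sumr; apply: eq_bigr => m2 _.
by rewrite mcoeffZ mulrCA mulrnAr.
Qed.

Definition single (x : letter k l) : ncpoly R k l := << fmu x >>.

Lemma inSub_single b x : of_kind b x -> inSub b (single x).
Proof. by move=> h; apply: inSubU; rewrite fmU /= h. Qed.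

Lemma monomial_prod (m : {fmonom (letter k l)}) :
  (<< m >> : ncpoly R k l) = \prod_(x <- (m : seq (letter k l))) single x.
Proof.
case: m => s; elim: s => [|x s IH]; rewrite /= ?big_nil ?big_cons.
  by congr (<< _ >>); rewrite -[LHS]fmK; apply/eqP; rewrite fmP fm1.
rewrite -IH /single; apply/malgP => m.
rewrite malgM_def fgmulUU mulr1; congr (mcoeff _ (<< _ >>)).
by apply/eqP; rewrite fmP fmM fmU.
Qed.

Lemma ncpoly_ind (Q : ncpoly R k l -> Prop) :
  Q 0 -> (forall p q, Q p -> Q q -> Q (p + q)) -> (forall c p, Q p -> Q (c *: p)) ->
  (forall w : seq (letter k l), Q (\prod_(x <- w) single x)) -> forall p, Q p.
Proof.
move=> Q0 QD QZ Qm p; rewrite (monalgE p); elim: (enum_fset _) => [|m r IH].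
  by rewrite big_nil.
rewrite big_cons; apply: QD => //.
have -> : << p@_m *g m >> = p@_m *: << m >> :> ncpoly R k l.
  by apply/malgP => m'; rewrite mcoeffZ !mcoeffU mulr_natr.
by apply: QZ; rewrite monomial_prod.
Qed.

Variables (k' l' : nat).
Definition special (x : letter k l) : bool :=
  match x with inl i => (i < k')%N | inr j => (j < l')%N end.

Definition inIdl b : ncpoly R k l -> Prop :=
  ideal_gen (inSub b) (fun g => exists x, [/\ special x, of_kind b x & g = single x]).

Lemma inIdlE b p : in_sub (@inI1 R k l k') (@inI2 R k l l') b p <-> inIdl b p.
Proof.
case: b; split; apply: ideal_gen_mono.
- by move=> x /(inSubE true).
- by move=> x [j [jl ->]]; exists (inr j).
- by move=> x /(inSubE true).
- by move=> x [[i|j] [//= sj _ ->]]; exists j.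
- by move=> x /(inSubE false).
- by move=> x [j [jl ->]]; exists (inl j).
- by move=> x /(inSubE false).
- by move=> x [[i|j] [//= sj _ ->]]; exists i.
Qed.

Lemma inIdl_sub b p : inIdl b p -> inSub b p.
Proof.
elim=> [|x y _ hx _ hy|a g c ha [x [_ hx ->]] hc]; first exact: inSub0.
  exact: inSubD.
by do 2!apply: inSubM => //; exact: inSub_single.
Qed.

Lemma inIdlMl b a p : inSub b a -> inIdl b p -> inIdl b (a * p).
Proof. by apply: ideal_genMl; exact: inSubM. Qed.

Lemma inIdlMr b a p : inSub b a -> inIdl b p -> inIdl b (p * a).
Proof. by apply: ideal_genMr; exact: inSubM. Qed.

(** Linearity in the two outer factors reduces [a * single x * c] to monomials [a] and [c], hence to
    words containing the special letter [x]. *)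
Lemma inI_ind (Q : ncpoly R k l -> Prop) :
  Q 0 -> (forall p q, Q p -> Q q -> Q (p + q)) -> (forall c p, Q p -> Q (c *: p)) ->
  (forall w : seq (letter k l), has special w -> Q (\prod_(x <- w) single x)) ->
  forall p, inI k' l' p -> Q p.
Proof.
move=> Q0 QD QZ Qm.
have Q3 x : special x -> forall a c : ncpoly R k l, Q (a * single x * c).
  move=> sx; elim/ncpoly_ind => [c|p q hp hq c|e p hp c|w].
  - by rewrite !mul0r.
  - by rewrite 2!mulrDl; apply: QD.
  - by rewrite -!scalerAl; apply: QZ.
  elim/ncpoly_ind => [|p q hp hq|e p hp|w'].
  - by rewrite mulr0.
  - by rewrite mulrDr; apply: QD.
  - by rewrite ncpoly_scaleAr; apply: QZ.
  have := Qm (w ++ x :: w'); rewrite has_cat /= sx orbT => /(_ isT).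
  by rewrite big_cat big_cons /= mulrA.
have Q4 b g : inIdl b g -> forall a c : ncpoly R k l, Q (a * g * c).
  by apply: (ideal_gen_span Q0 QD) => a _ c [x [sx _ ->]]; exact: (Q3 x sx).
move=> p; apply: (ideal_gen_ind_span Q0 QD) => a g c.
case=> [/(inIdlE false)|/(inIdlE true)] hg; exact: Q4 hg a c.
Qed.

Lemma inI_idl b p : inIdl b p -> inI k' l' p.
Proof.
move=> h; apply: ideal_gen_gen => //.
by case: b h => h; [right; apply/(inIdlE true)|left; apply/(inIdlE false)].
Qed.
End Subalgebras.

Section Limits.
Variable R : realType.

(** The default value 0 lets the functional on the ideal be a total function on polynomials; it is
    meaningful only where the limit exists. *)
Definition limC (u : nat -> R[i]) : R[i] := xget 0 [set c | cvgC u c]%classic.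

Lemma limCP u c : cvgC u c -> limC u = c.
Proof.
move=> h; apply: (cvgC_uniq _ h).
exact: (xgetPex 0 (ex_intro [set c | cvgC u c]%classic c h)).
Qed.

Lemma limC_cvg u : (exists c, cvgC u c) -> cvgC u (limC u).
Proof. by move=> [c h]; rewrite (limCP h). Qed.

Lemma eq_oNinvE (u : nat -> R[i]) c : eq_oNinv u c <-> cvgC (fun N => N%:R * u N) c.
Proof.
have e N : (1 <= N)%N -> N%:R * (u N - c / N%:R) = N%:R * u N - c.
  by move=> N0; rewrite mulrBr mulrCA divff ?mulr1 // pnatr_eq0 -lt0n.
rewrite /eq_oNinv; split=> h.
  by apply/cvgC_sub0; apply: (@cvgC_eq _ 1 _ _ _ _ h) => N N0; exact: e.
have h' : cvgC (fun N => N%:R * u N - c) 0 by case: (cvgC_sub0 (fun N => N%:R * u N) c) => + _; apply.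
by apply: (@cvgC_eq _ 1 _ _ _ _ h') => N N0; rewrite e.
Qed.
End Limits.

(** * Polynomials of the two algebras as letters of the matrix model *)

Section Model.
Variables (R : realType) (k l : nat).
Variable A : forall N : nat, 'I_k -> 'M[R[i]]_N.
Variable B : forall N : nat, 'I_l -> 'M[R[i]]_N.
Local Notation poly := (ncpoly R k l).

Definition conj_letters N (X : 'M[R[i]]_N) : letter k l -> 'M[R[i]]_N :=
  lettermap (A N) (fun j => X *m B N j *m adjmx X).

Definition pure_letters N (b : bool) : letter k l -> 'M[R[i]]_N :=
  if b then lettermap (fun=> 0) (B N) else lettermap (A N) (fun=> 0).

Lemma ev_pure_false N X (p : poly) : inSub false p ->
  ev (@conj_letters N X) p = ev (@pure_letters N false) p.
Proof.
move=> hp; apply: eq_big_seq => m; rewrite -mcoeff_neq0 => /hp /allP hm.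
congr (_ *: _); apply: eq_big_seq => x /hm.
by case: x.
Qed.

Lemma ev_pure_true N X (p : poly) : unitary X -> inSub true p ->
  ev (@conj_letters N X) p = X *m ev (@pure_letters N true) p *m adjmx X.
Proof.
move=> uX hp; rewrite /ev mulmx_sumr mulmx_suml.
apply: eq_big_seq => m; rewrite -mcoeff_neq0 => /hp hm.
rewrite -scalemxAr -scalemxAl; congr (_ *: _).
elim: (m : seq _) hm => [_|x w IH /= /andP[hx /IH hw]]; first by rewrite !big_nil mulmx1.
rewrite !big_cons hw; case: x hx => // j _ /=.
by rewrite -!mulmxE !mulmxA -(mulmxA (X *m B N j)) unitary_adjl // mulmx1.
Qed.

(** Letters are plain pairs, with no proof that the polynomial has the announced kind. Ill-formed
    pairs receive the zero matrix, so that the convergence hypotheses on pure words hold for all of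
    them. *)
Definition valid (t : bool * poly) : bool := `[< inSub t.1 t.2 >].

Definition letter_mx N (t : bool * poly) : 'M[R[i]]_N :=
  if valid t then ev (@pure_letters N t.1) t.2 else 0.

Definition wprod (w : seq (bool * poly)) : poly := \prod_(t <- w) t.2.

Lemma wprod_cons t w : wprod (t :: w) = t.2 * wprod w.
Proof. exact: big_cons. Qed.

Lemma wprod_cat u v : wprod (u ++ v) = wprod u * wprod v.
Proof. exact: big_cat. Qed.

Local Notation wmT N := (@wm R N _ (@fst bool poly) (@letter_mx N)).

Lemma wm_valid N X w : unitary X -> all valid w -> wmT N X w = ev (@conj_letters N X) (wprod w).
Proof.
move=> uX hw; rewrite /wprod ev_prod; apply: eq_big_seq => t /(allP hw) vt.
rewrite /lm /letter_mx vt; move/asboolP: vt; case: t => -[] p /= vt.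
  by rewrite ev_pure_true.
by rewrite ev_pure_false.
Qed.

Lemma inSub_wprod b w : all valid w -> (forall t, t \in w -> t.1 = b) -> inSub b (wprod w).
Proof.
move=> vw kw; apply: inSub_prod => t tw; rewrite -(kw t tw).
by apply/asboolP; exact: (allP vw).
Qed.

Lemma pure_kind (w : seq (bool * poly)) : pure fst w -> exists b, forall t, t \in w -> t.1 = b.
Proof.
case/orP => /allP h; [exists true|exists false] => t /h /=; first by [].
exact: negbTE.
Qed.

Lemma detw_valid N b w : all valid w -> (forall t, t \in w -> t.1 = b) ->
  detw letter_mx N w = trN (ev (@pure_letters N b) (wprod w)).
Proof.
move=> vw kw; rewrite /detw /wprod ev_prod; congr trN; apply: eq_big_seq => t tw.
by rewrite /letter_mx (allP vw) // (kw t tw).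
Qed.

Lemma detw_invalid N w : ~~ all valid w -> detw letter_mx N w = 0.
Proof.
rewrite -has_predC => /hasP[t tw /= /negbTE vt].
rewrite /detw (_ : \prod_(_ <- _) _ = 0) ?/trN ?mxtrace0 ?mul0r //.
have z : letter_mx N t = 0 by rewrite /letter_mx vt.
by case/splitPr: tw => w1 w2; rewrite big_cat big_cons /= z mul0r mulr0.
Qed.

Lemma pf_ev N (p : poly) : pf_mx (fun X => ev (@conj_letters N X) p).
Proof.
move=> i j; rewrite /ev; under eq_fun do rewrite summxE.
apply: pf_sum => m; under eq_fun do rewrite mxE.
apply: pf_mul; first exact: pf_cst.
have : pf_mx (fun X : 'M[R[i]]_N => \prod_(x <- (m : seq (letter k l))) conj_letters X x).
  elim: (m : seq _) => [|x w IH] i' j'.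
    by under eq_fun do rewrite big_nil; exact: pf_cst.
  under eq_fun do rewrite big_cons.
  apply: (pf_mx_mul _ IH); case: x => [a|b] /=; first exact: pf_mx_cst.
  apply: pf_mx_mul; last exact: pf_mx_adj.
  by apply: pf_mx_mul; [exact: pf_mx_id|exact: pf_mx_cst].
exact.
Qed.

Variables (d : measure_display) (Omega : measurableType d) (Pr : probability Omega R).
Variable U : forall N : nat, Omega -> 'M[R[i]]_N.
Hypothesis HU : forall N, haar_unitary Pr (U N).

Definition mean N (p : poly) : R[i] :=
  haarE Pr (U N) (fun X => trN (ev (@conj_letters N X) p)).

Lemma pf_trN_ev N (p : poly) : polyfun (fun X => trN (ev (@conj_letters N X) p)).
Proof. by apply: pf_trN; exact: pf_ev. Qed.

Lemma expC_mean N (p : poly) :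
  expC Pr (fun w => trN (ev (conj_letters (U N w)) p)) = mean N p.
Proof. exact: (haarE_expC (HU N) (pf_trN_ev N p)). Qed.

Lemma meanD N p q : mean N (p + q) = mean N p + mean N q.
Proof.
rewrite /mean -(haarED (HU N) (pf_trN_ev N p) (pf_trN_ev N q)).
by apply: haarE_eq => X _; rewrite evD trND.
Qed.

Lemma meanZ N c p : mean N (c *: p) = c * mean N p.
Proof.
rewrite /mean -(haarEZ (HU N) _ (pf_trN_ev N p)).
by apply: haarE_eq => X _; rewrite evZ trNZ.
Qed.

Lemma mean0 N : mean N 0 = 0.
Proof. by rewrite -(scale0r (0 : poly)) meanZ mul0r. Qed.

Lemma mean_mulC N p q : mean N (p * q) = mean N (q * p).
Proof. by apply: haarE_eq => X _; rewrite (evM _ p q) (evM _ q p); exact: trN_mulC. Qed.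

Lemma mean1 N : (0 < N)%N -> mean N 1 = 1.
Proof.
move=> N0; rewrite -[RHS](haarE_cst Pr (U N)).
by apply: haarE_eq => X _; rewrite ev1 trN1.
Qed.

Lemma mean_pure N b p : inSub b p -> mean N p = trN (ev (@pure_letters N b) p).
Proof.
move=> hp; rewrite -[RHS](haarE_cst Pr (U N)); apply: haarE_eq => X uX.
case: b hp => hp; last by rewrite ev_pure_false.
by rewrite ev_pure_true // trN_mulC mulmxA unitary_adjl // mul1mx.
Qed.

Local Notation mixedT := (mixed Pr U (@fst bool poly) letter_mx).

Lemma mixed_valid N w : all valid w -> mixedT N [:: w] = mean N (wprod w).
Proof.
move=> vw; apply: haarE_eq => X uX.
by rewrite /trp big_seq1 wm_valid.
Qed.

Variables (k' l' : nat) (tau tau' : poly -> R[i]).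
Hypothesis tau_pure : forall b p, inSub b p -> cvgC (fun N => trN (ev (@pure_letters N b) p)) (tau p).
Hypothesis tau'_pure : forall b p, inIdl k' l' b p ->
  cvgC (fun N => N%:R * trN (ev (@pure_letters N b) p)) (tau' p).

Definition marked (t : bool * poly) : bool := `[< inIdl k' l' t.1 t.2 >].

Lemma wprod_idl b w : all valid w -> (forall t, t \in w -> t.1 = b) -> has marked w ->
  inIdl k' l' b (wprod w).
Proof.
move=> vw kw /hasP[t tw /asboolP mt]; case/splitPr: tw vw kw => w1 w2 vw kw.
have tb : t.1 = b by apply: kw; rewrite mem_cat mem_head orbT.
have [v1 v2] : all valid w1 /\ all valid w2.
  by move: vw; rewrite all_cat /= => /and3P[].
rewrite wprod_cat wprod_cons; apply: inIdlMl.
  by apply: inSub_wprod => // s sw; apply: kw; rewrite mem_cat sw.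
apply: inIdlMr; last by rewrite -tb.
by apply: inSub_wprod => // s sw; apply: kw; rewrite mem_cat inE sw !orbT.
Qed.

Lemma pure_word_cvg w : pure fst w -> exists c, cvgC (fun N => detw letter_mx N w) c.
Proof.
move=> /pure_kind[b kw]; case: (boolP (all valid w)) => vw.
  exists (tau (wprod w)); apply: (@cvgC_eq _ 0 _ _ _ _ (tau_pure (inSub_wprod vw kw))) => N _.
  by rewrite (detw_valid _ vw kw).
by exists 0; apply: (@cvgC_eq _ 0 _ _ _ _ (cvgC_cst 0)) => N _; rewrite detw_invalid.
Qed.

Lemma pure_word_cvg_marked w : pure fst w -> has marked w ->
  exists c, cvgC (fun N => N%:R * detw letter_mx N w) c.
Proof.
move=> /pure_kind[b kw] mw; case: (boolP (all valid w)) => vw.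
  exists (tau' (wprod w)).
  apply: (@cvgC_eq _ 0 _ _ _ _ (tau'_pure (wprod_idl vw kw mw))) => N _.
  by rewrite (detw_valid _ vw kw).
by exists 0; apply: (@cvgC_eq _ 0 _ _ _ _ (cvgC_cst 0)) => N _; rewrite detw_invalid ?mulr0.
Qed.

(** Monomials become words through this embedding of the variables; the variables that generate the
    ideals give marked letters. *)
Definition basic (x : letter k l) : bool * poly := (if x is inl _ then false else true, single R x).

Lemma basic_valid x : valid (basic x).
Proof. by apply/asboolP; case: x => i; apply: inSub_single. Qed.

Lemma basic_marked x : special k' l' x -> marked (basic x).
Proof.
move=> sx; apply/asboolP; apply: ideal_gen_gen; first exact: inSub1.
by exists x; split=> //; case: x {sx}.
Qed.

Lemma wprod_basic w : wprod (map basic w) = \prod_(x <- w) single R x.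
Proof. by rewrite /wprod big_map; apply: eq_bigr => -[]. Qed.

Lemma all_basic_valid w : all valid (map basic w).
Proof. by rewrite all_map; apply/allP => x _; exact: basic_valid. Qed.

Lemma mean_wprod_cvg w : all valid w -> exists c, cvgC (fun N => mean N (wprod w)) c.
Proof.
move=> vw; case: (eqVneq w [::]) => [->|w0].
  exists 1; rewrite /wprod big_nil.
  by apply: (@cvgC_eq _ 1 _ _ _ _ (cvgC_cst 1)) => N N0; rewrite mean1.
have [c hc] := mixed_cvg HU pure_word_cvg pure_word_cvg_marked w0.
by exists c; apply: (@cvgC_eq _ 0 _ _ _ _ hc) => N _; rewrite mixed_valid.
Qed.

Lemma mean_wprod_cvg_marked w : all valid w -> has marked w ->
  exists c, cvgC (fun N => N%:R * mean N (wprod w)) c.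
Proof.
move=> vw mw.
have [c hc] := mixed_cvg_mk HU pure_word_cvg pure_word_cvg_marked mw.
by exists c; apply: (@cvgC_eq _ 0 _ _ _ _ hc) => N _; rewrite mixed_valid.
Qed.

Lemma mean_cvg p : exists c, cvgC (fun N => mean N p) c.
Proof.
elim/ncpoly_ind: p => [|p q [c hc] [e he]|a p [c hc]|w].
- by exists 0; apply: (@cvgC_eq _ 0 _ _ _ _ (cvgC_cst 0)) => N _; rewrite mean0.
- by exists (c + e); apply: (@cvgC_eq _ 0 _ _ _ _ (cvgCD hc he)) => N _; rewrite meanD.
- by exists (a * c); apply: (@cvgC_eq _ 0 _ _ _ _ (cvgCZ a hc)) => N _; rewrite meanZ.
- by rewrite -wprod_basic; apply: mean_wprod_cvg; exact: all_basic_valid.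
Qed.

Lemma mean_cvg_idl p : inI k' l' p -> exists c, cvgC (fun N => N%:R * mean N p) c.
Proof.
move: p; apply: inI_ind => [|p q [c hc] [e he]|a p [c hc]|w sw].
- by exists 0; apply: (@cvgC_eq _ 0 _ _ _ _ (cvgC_cst 0)) => N _; rewrite mean0 mulr0.
- by exists (c + e); apply: (@cvgC_eq _ 0 _ _ _ _ (cvgCD hc he)) => N _; rewrite meanD mulrDr.
- by exists (a * c); apply: (@cvgC_eq _ 0 _ _ _ _ (cvgCZ a hc)) => N _; rewrite meanZ mulrCA.
- rewrite -wprod_basic; apply: mean_wprod_cvg_marked; first exact: all_basic_valid.
  by rewrite has_map; apply: sub_has sw => x; exact: basic_marked.
Qed.

(** The extensions are defined as limits of mean traces. They agree with the given functionals on
    the subalgebras and their ideals because pure traces do not depend on the unitary matrix. *)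
Definition tau_lim p := limC (fun N => mean N p).
Definition tau'_lim p := limC (fun N => N%:R * mean N p).

Lemma tau_limP p : cvgC (fun N => mean N p) (tau_lim p).
Proof. exact: limC_cvg (mean_cvg p). Qed.

Lemma tau'_limP p : inI k' l' p -> cvgC (fun N => N%:R * mean N p) (tau'_lim p).
Proof. by move=> /mean_cvg_idl; exact: limC_cvg. Qed.

Lemma tau_limE b p : inSub b p -> tau_lim p = tau p.
Proof.
move=> hp; apply: limCP; apply: (@cvgC_eq _ 0 _ _ _ _ (tau_pure hp)) => N _.
by rewrite (mean_pure N hp).
Qed.

Lemma tau'_limE b p : inIdl k' l' b p -> tau'_lim p = tau' p.
Proof.
move=> hp; apply: limCP; apply: (@cvgC_eq _ 0 _ _ _ _ (tau'_pure hp)) => N _.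
by rewrite (mean_pure N (inIdl_sub hp)).
Qed.

Lemma tau_lim_linear a p q : tau_lim (a *: p + q) = a * tau_lim p + tau_lim q.
Proof.
apply: limCP; apply: (@cvgC_eq _ 0 _ _ _ _ (cvgCD (cvgCZ a (tau_limP p)) (tau_limP q))) => N _.
by rewrite meanD meanZ.
Qed.

Lemma tau'_lim_linear a p q : inI k' l' p -> inI k' l' q ->
  tau'_lim (a *: p + q) = a * tau'_lim p + tau'_lim q.
Proof.
move=> hp hq; apply: limCP.
apply: (@cvgC_eq _ 0 _ _ _ _ (cvgCD (cvgCZ a (tau'_limP hp)) (tau'_limP hq))) => N _.
by rewrite meanD meanZ mulrDr mulrCA.
Qed.

Lemma tau_lim1 : tau_lim 1 = 1.
Proof.
by apply: limCP; apply: (@cvgC_eq _ 1 _ _ _ _ (cvgC_cst 1)) => N N0; rewrite mean1.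
Qed.

Lemma tau_lim_mulC p q : tau_lim (p * q) = tau_lim (q * p).
Proof. exact: (congr1 (@limC R) (funext (fun N => mean_mulC N p q))). Qed.

(** The two sequences coincide term by term, hence so do the chosen values, including where [limC]
    takes its default. *)
Lemma tau'_lim_mulC p q : tau'_lim (p * q) = tau'_lim (q * p).
Proof.
exact: (congr1 (@limC R) (funext (fun N => congr1 (fun x => N%:R * x) (mean_mulC N p q)))).
Qed.
End Model.

(** * Type B freeness from the limiting loop equations *)

Section FreenessFromLoops.
Local Notation alternating := Defs.alternating.
Variables (C : numFieldType) (A : lalgType C) (tau tau' : A -> C).
Variables (S V : bool -> A -> Prop) (I : A -> Prop).

Hypothesis tau_lin : forall c p q, tau (c *: p + q) = c * tau p + tau q.
Hypothesis tau1 : tau 1 = 1.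
Hypothesis tauC : forall p q, tau (p * q) = tau (q * p).
Hypothesis SM : forall b p q, S b p -> S b q -> S b (p * q).
Hypothesis Scenter : forall b p c, S b p -> S b (p - c *: 1).
Hypothesis VS : forall b v, V b v -> S b v.
Hypothesis VM : forall b a v, S b a -> V b v -> V b (v * a).
Hypothesis VI : forall b v, V b v -> I v.
Hypothesis IMl : forall a p, I p -> I (a * p).
Hypothesis IMr : forall a p, I p -> I (p * a).
Hypothesis tau'_lin : forall c p q, I p -> I q -> tau' (c *: p + q) = c * tau' p + tau' q.
Hypothesis tau'C : forall p q, tau' (p * q) = tau' (q * p).

Local Notation word := (seq (bool * A)).
Definition prodw (w : word) : A := \prod_(x <- w) x.2.

(** Limit of the loop equation: merging terms have vanished and products of traces have factored.
    The functional [f] is applied to the right pieces because they contain the last letter; when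
    that letter lies in the ideal, they carry the order 1/N and [f] is [tau']. *)
Definition loop_rhs (f : A -> C) (t : bool * A) (w : word) : C :=
  tau t.2 * f (prodw w) -
  \sum_(i <- iota 1 (size w) | nth false (map fst (t :: w)) i == t.1)
    (tau (prodw (take i (t :: w))) * f (prodw (drop i (t :: w)))
     - tau (prodw (take i.+1 (t :: w))) * f (prodw (drop i.+1 (t :: w)))).

Hypothesis loop_tau : forall t w, (forall x, x \in t :: w -> S x.1 x.2) ->
  (last t w).1 != t.1 -> tau (prodw (t :: w)) = loop_rhs tau t w.
Hypothesis loop_tau' : forall t w, (forall x, x \in t :: w -> S x.1 x.2) ->
  (last t w).1 != t.1 -> V (last t w).1 (last t w).2 ->
  tau' (prodw (t :: w)) = loop_rhs tau' t w.

Definition centered (w : word) := forall x, x \in w -> S x.1 x.2 /\ tau x.2 = 0.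

Lemma prodw_cons t w : prodw (t :: w) = t.2 * prodw w.
Proof. exact: big_cons. Qed.

Lemma prodw_cat u v : prodw (u ++ v) = prodw u * prodw v.
Proof. exact: big_cat. Qed.

Lemma prodw_rcons w t : prodw (rcons w t) = prodw w * t.2.
Proof. by rewrite -cats1 prodw_cat prodw_cons /prodw big_nil mulr1. Qed.

Lemma centered_sub u w : {subset u <= w} -> centered w -> centered u.
Proof. by move=> uw hw x /uw /hw. Qed.

Lemma alternating_behead x (s : seq bool) : alternating (x :: s) -> alternating s.
Proof. exact: path_sorted. Qed.

Lemma alternating_head x y (s : seq bool) : alternating (x :: y :: s) -> x != y.
Proof. by case/andP. Qed.

Lemma alternating_take n (w : word) : alternating (map fst w) -> alternating (map fst (take n w)).
Proof. by rewrite map_take; exact: take_sorted. Qed.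

Lemma tau_center p : tau (p - tau p *: 1) = 0.
Proof.
by rewrite addrC -scaleNr tau_lin tau1 mulr1 addNr.
Qed.

Lemma lt_of_kind (t : bool * A) w i : (last t w).1 != t.1 -> i \in iota 1 (size w) ->
  nth false (map fst (t :: w)) i == t.1 -> (0 < i < size w)%N.
Proof.
move=> lw; rewrite mem_iota add1n ltnS => /andP[i1]; rewrite leq_eqVlt => /orP[/eqP iE|->]; last by rewrite i1.
rewrite (nth_map t) /=; last by rewrite iE.
by rewrite iE (nth_last t (t :: w)) /= (negbTE lw).
Qed.

(** Every term of the loop equation contains [tau] of a proper prefix, which is again alternating
    and centred. If the two end letters have the same kind, traciality multiplies them together;
    their product is recentred and the word gets shorter. *)
Lemma free_centered (s : word) : s != [::] -> alternating (map fst s) -> centered s -> tau (prodw s) = 0.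
Proof.
have [n] := ubnP (size s); elim: n s => [//|n IH] [//|t w] /= sn _ alt cen.
have [St t0] := cen t (mem_head _ _).
have [->|w0] := eqVneq w [::]; first by rewrite prodw_cons /prodw big_nil mulr1.
have [lw|lw] := boolP ((last t w).1 != t.1).
  rewrite loop_tau //; last by move=> x /cen[].
  rewrite /loop_rhs t0 mul0r sub0r big_seq_cond big1 ?oppr0 // => i /andP[iI ki].
  have /andP[i1 iw] := lt_of_kind lw iI ki.
  have z j : (0 < j <= size w)%N -> tau (prodw (take j (t :: w))) = 0.
    move=> /andP[j0 jw]; apply: IH.
    - by rewrite size_take /= ltnS jw; exact: leq_ltn_trans jw sn.
    - by case: (j) j0.
    - exact: (alternating_take j (w := t :: w)).
    - by apply: centered_sub cen => x; exact: mem_take.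
  by rewrite !z ?i1 ?iw 1?ltnW // !mul0r subrr.
move: lw; rewrite negbK; case/lastP: w w0 sn alt cen => [//|u z] _ sn alt cen.
rewrite last_rcons => /eqP zt.
have u0 : u != [::].
  by apply: contraTneq alt => ->; rewrite /Defs.alternating /= zt eqxx.
have [Sz z0] : S z.1 z.2 /\ tau z.2 = 0 by apply: cen; rewrite inE mem_rcons mem_head orbT.
rewrite prodw_cons prodw_rcons mulrA tauC mulrA.
set c := tau (z.2 * t.2).
have -> : z.2 * t.2 * prodw u = c *: prodw u + (z.2 * t.2 - c *: 1) * prodw u.
  by rewrite mulrBl -scalerAl mul1r addrC subrK.
rewrite size_rcons in sn.
have alt' : alternating (t.1 :: map fst u).
  have := alternating_take (size u).+1 (w := t :: rcons u z) alt.
  by rewrite /= -cats1 take_size_cat.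
rewrite tau_lin IH //; last 3 first.
- exact: ltnW.
- exact: alternating_behead alt'.
- by apply: centered_sub cen => x xu; rewrite inE mem_rcons inE xu !orbT.
rewrite mulr0 add0r.
have := IH ((t.1, z.2 * t.2 - c *: 1) :: u); rewrite prodw_cons /=; apply=> //.
move=> x; rewrite inE => /orP[/eqP -> /=|xu]; last first.
  by apply: cen; rewrite inE mem_rcons inE xu !orbT.
split; last exact: tau_center.
by apply: Scenter; apply: SM => //; rewrite -zt.
Qed.

(** With [v] as last letter, the prefixes in the loop equation all stop before [v], so
    [free_centered] annihilates every term. *)
Lemma free_centered_ideal (s : word) h v : s != [::] -> alternating (map fst s) -> centered s ->
  head false (map fst s) != h -> V h v -> tau' (prodw s * v) = 0.
Proof.
case: s => [//|t w] _ alt cen /= th Vv.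
have e : prodw (t :: w) * v = prodw (t :: rcons w (h, v)).
  by rewrite !prodw_cons prodw_rcons mulrA.
have lh : (last t (rcons w (h, v))).1 != t.1 by rewrite last_rcons eq_sym.
have Sw x : x \in t :: rcons w (h, v) -> S x.1 x.2.
  by rewrite -rcons_cons mem_rcons inE => /orP[/eqP -> /=|/cen[]]; first exact: VS.
rewrite e (loop_tau' Sw lh); last by rewrite last_rcons.
have [_ t0] := cen t (mem_head _ _).
rewrite /loop_rhs t0 mul0r sub0r big_seq_cond big1 ?oppr0 // => i /andP[iI ki].
have /andP[i1 iw] := lt_of_kind lh iI ki.
have z j : (0 < j <= (size w).+1)%N -> tau (prodw (take j (t :: rcons w (h, v)))) = 0.
  move=> /andP[j0 jw].
  have -> : take j (t :: rcons w (h, v)) = take j (t :: w).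
    by rewrite -rcons_cons -cats1 takel_cat.
  apply: free_centered.
  - by case: (j) j0.
  - exact: (alternating_take j (w := t :: w)).
  - by apply: centered_sub cen => x; exact: mem_take.
rewrite size_rcons in iw.
by rewrite !z ?i1 ?iw 1?ltnW // !mul0r subrr.
Qed.

(** Traciality brings the outermost letters [a] and [b] together. If their kinds differ, the word
    read cyclically after [v] is alternating and centred, and gives 0. Otherwise [b a] is a scalar
    plus a centred element: the scalar leaves the formula for the inner word, and the centred
    element gives 0. *)
Lemma typeB_formula (as_ : word) h v bs :
  alternating (map fst as_ ++ h :: map fst bs) -> centered as_ -> centered bs -> V h v ->
  tau' (prodw as_ * v * prodw bs) =
    if (size as_ == size bs) && (map fst (rev as_) == map fst bs)
    then (\prod_(xy <- zip (rev as_) bs) tau (xy.1.2 * xy.2.2)) * tau' v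
    else 0.
Proof.
move=> alt ca cb Vv; elim: as_ bs alt ca cb => [|a as_ IH] bs alt ca cb.
  case: bs alt cb => [|b bs] alt cb.
    by rewrite /= /prodw !big_nil !mul1r mulr1.
  rewrite tau'C /prodw [X in _ * (X * v)]big_nil mul1r.
  apply: (@free_centered_ideal _ h) => //.
    exact: alternating_behead alt.
  by rewrite eq_sym; exact: alternating_head alt.
case/lastP: bs alt cb => [|bs b] alt cb.
  rewrite [prodw [::]]/prodw big_nil mulr1.
  rewrite cats1 in alt.
  have alta : alternating (map fst (a :: as_)).
    by have := take_sorted (size (map fst (a :: as_))) alt; rewrite -cats1 take_size_cat.
  have [ah|ah] := eqVneq a.1 h; last exact: (@free_centered_ideal _ h).
  have as0 : as_ != [::] by apply: contraTneq alt => ->; rewrite /Defs.alternating /= ah eqxx.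
  (* Cyclically [a] stands next to [v] and has its kind, so [v * a] is absorbed as a new element of
     the ideal. *)
  rewrite prodw_cons -mulrA tau'C -mulrA.
  have [Sa _] := ca a (mem_head _ _).
  apply: (@free_centered_ideal _ h) => //.
  - exact: alternating_behead alta.
  - by apply: centered_sub ca => x xu; rewrite inE xu orbT.
  - by case: (as_) as0 alta => // x ? _ alt'; rewrite -ah eq_sym; exact: alternating_head alt'.
  - by apply: VM => //; rewrite -ah.
have altbs : alternating (h :: map fst (rcons bs b)).
  by have := drop_sorted (size (map fst (a :: as_))) alt; rewrite drop_size_cat.
have alta : alternating (map fst (a :: as_)).
  by have := take_sorted (size (map fst (a :: as_))) alt; rewrite take_size_cat.
have [[Sa a0] [Sb b0]] : (S a.1 a.2 /\ tau a.2 = 0) /\ (S b.1 b.2 /\ tau b.2 = 0).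
  by split; [apply: ca; rewrite mem_head|apply: cb; rewrite mem_rcons mem_head].
have altb := alternating_behead altbs.
have headb : head false (map fst (rcons bs b)) != h.
  by case: (bs) altbs => [|x bs'] alt'; rewrite eq_sym; exact: alternating_head alt'.
have join (x : bool * A) : x.1 = a.1 -> b.1 = a.1 -> alternating (map fst (bs ++ x :: as_)).
  move=> xa ba; rewrite map_cat /= xa; move: altb alta.
  rewrite map_rcons /Defs.alternating /= -cats1; case: (map fst bs) => [//|y l] /=.
  by rewrite !cat_path /= ba => /andP[-> /andP[-> _]] ->.
have cenbs : centered bs by apply: centered_sub cb => x xu; rewrite mem_rcons inE xu orbT.
have cenas : centered as_ by apply: centered_sub ca => x xu; rewrite inE xu orbT.
rewrite size_rcons /= eqSS rev_cons !map_rcons eqseq_rcons.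
rewrite tau'C mulrA -prodw_cat.
have [ba|ba] := eqVneq b.1 a.1; last first.
  rewrite !andbF; apply: (@free_centered_ideal _ h) => //.
  - by case: (bs).
  - rewrite map_cat /Defs.alternating.
    move: altb alta; rewrite map_rcons /Defs.alternating /= -cats1; case: (map fst bs) => [|y l] /=.
      by move=> _ ->; rewrite ba.
    by rewrite !cat_path /= => /andP[-> ->] ->; rewrite last_cat /= ba.
  - by move=> x; rewrite mem_cat => /orP[/cb|/ca].
  - by case: (bs) headb.
rewrite andbT.
set c := tau (b.2 * a.2).
have -> : prodw (rcons bs b ++ a :: as_) * v = prodw bs * ((b.2 * a.2) * (prodw as_ * v)).
  by rewrite prodw_cat prodw_rcons prodw_cons !mulrA.
pose d := b.2 * a.2 - c *: 1.
rewrite tau'C.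
have -> : b.2 * a.2 * (prodw as_ * v) * prodw bs =
    c *: (prodw as_ * v * prodw bs) + d * (prodw as_ * v) * prodw bs.
  by rewrite /d mulrBl -scalerAl mul1r mulrBl -scalerAl addrC subrK.
have Iv : I v := VI Vv.
have altin : alternating (map fst as_ ++ h :: map fst bs).
  have := drop_sorted 1 alt => /=; rewrite drop0 map_rcons -cats1 => h1.
  have := take_sorted (size (map fst as_ ++ h :: map fst bs)) h1.
  by rewrite -cat_cons catA take_size_cat.
rewrite tau'_lin; last 2 first.
- by apply: IMr; apply: IMl.
- by apply: IMr; apply: IMl; apply: IMl.
have -> : tau' (d * (prodw as_ * v) * prodw bs) = 0.
  rewrite tau'C.
  have -> : prodw bs * (d * (prodw as_ * v)) = prodw (bs ++ (a.1, d) :: as_) * v.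
    by rewrite prodw_cat prodw_cons /= !mulrA.
  apply: (@free_centered_ideal _ h) => //.
  - by case: (bs).
  - exact: join.
  - move=> x; rewrite mem_cat inE => /or3P[/cenbs //|/eqP -> /=|/cenas //].
    split; last exact: tau_center.
    by apply: Scenter; apply: SM => //; rewrite -ba.
  - by case: (bs) headb => //= ; rewrite -ba.
rewrite addr0 (IH _ altin cenas cenbs).
case: ifP => [/andP[/eqP sz _]|_]; last by rewrite mulr0.
rewrite zip_rcons ?size_rev // -cats1 big_cat big_seq1 /= mulrA; congr (_ * _).
by rewrite mulrC /c tauC.
Qed.

Lemma typeB_freeness (S1 S2 V1 V2 : A -> Prop) :
  (forall b p, in_sub S1 S2 b p -> S b p) -> (forall b p, in_sub V1 V2 b p -> V b p) ->
  free_typeB tau I tau' S1 V1 S2 V2.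
Proof.
move=> hS hV; split.
  move=> s s0 alt cen; apply: free_centered => // x /cen[h1 h2].
  by split=> //; exact: hS.
move=> as_ h v bs alt ca cb Vv; apply: (typeB_formula alt _ _ (hV _ _ Vv)).
- by move=> x /ca[h1 h2]; split=> //; exact: hS.
- by move=> x /cb[h1 h2]; split=> //; exact: hS.
Qed.
End FreenessFromLoops.

(** * Almost sure convergence *)

Section BorelCantelli.
Import numFieldNormedType.Exports.
Variables (R : realType) (d : measure_display) (Omega : measurableType d).
Variable Pr : probability Omega R.

Lemma sum_inv_sq_le m : \sum_(0 <= n < m) ((n.+1)%:R ^+ 2)^-1 <= 2 :> R.
Proof.
(* After the first term, [1 / (n + 1)^2] is compared with the telescoping difference
   [1 / n - 1 / (n + 1)]. *)
have main e : \sum_(0 <= n < e.+1) ((n.+1)%:R ^+ 2)^-1 <= 2 - (e.+1%:R)^-1 :> R.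
  elim: e => [|e IH]; first by rewrite big_nat1 expr1n invr1; lra.
  rewrite big_nat_recr //=; apply: le_trans (lerD IH (lexx _)) _.
  have -> : (e.+2%:R : R) = e.+1%:R + 1 by rewrite -natr1.
  have : (1 : R) <= e.+1%:R by rewrite ler1n.
  move: (e.+1%:R) => x x1.
  have x0 : 0 < x by lra.
  have -> : 2 - x^-1 + ((x + 1) ^+ 2)^-1 = 2 - (x + 1)^-1 - (x * (x + 1) ^+ 2)^-1.
    by field; apply/andP; split; lra.
  by rewrite gerBl invr_ge0 mulr_ge0 ?exprn_ge0 //; lra.
case: m => [|m]; first by rewrite big_geq.
by apply: le_trans (main m) _; rewrite gerBl invr_ge0.
Qed.

(** By monotone convergence the sum of all [f N] is integrable, hence finite almost surely, and the
    terms of a convergent series tend to 0. *)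
Lemma ae_cvg0_of_summable (f : nat -> Omega -> R) (K : R) :
  (forall N, measurable_fun setT (f N)) -> (forall N w, 0 <= f N w) ->
  (forall N, (0 < N)%N -> (\int[Pr]_w (f N w)%:E <= (K / N%:R ^+ 2)%:E)%E) ->
  {ae Pr, forall w, forall e : R, 0 < e -> exists N0, forall N, (N0 <= N)%N -> f N w < e}.
Proof.
move=> mf f0 fK.
pose F n w := (f n.+1 w)%:E.
have mF n : measurable_fun setT (F n) by apply/measurable_EFinP; exact: mf.
have F0 n w : (0 <= F n w)%E by rewrite lee_fin.
pose S w := (\sum_(n <oo) F n w)%E.
have S0 w : (0 <= S w)%E by apply: nneseries_ge0.
have mS : measurable_fun setT S by apply: ge0_emeasurable_sum.
have K0 : 0 <= K.
  have := fK 1 isT; rewrite expr1n divr1 -lee_fin; apply: le_trans.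
  by apply: integral_ge0 => w _; rewrite lee_fin.
have intS : (\int[Pr]_w S w < +oo)%E.
  rewrite integral_nneseries //; apply: (@le_lt_trans _ _ (2 * K)%:E); last exact: ltry.
  apply: lime_le.
    by apply: is_cvg_nneseries => n _ _; apply: integral_ge0.
  apply: nearW => m; apply: (@le_trans _ _ (\sum_(0 <= n < m) (K / (n.+1)%:R ^+ 2)%:E)%E).
    by apply: lee_sum => n _; exact: fK.
  rewrite sumEFin lee_fin -mulr_sumr mulrC ler_wpM2r //.
  exact: sum_inv_sq_le.
have iS : Pr.-integrable setT S.
  apply/integrableP; split=> //.
  by under eq_integral do rewrite gee0_abs //.
have := integrable_ae measurableT iS; apply: filterS => w /(_ I) fin e e0.
have : cvgn (series (fun n => f n.+1 w)).
  apply: nnseries_is_cvg => //.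
  by rewrite -ge0_fin_numE; [exact: fin|exact: (S0 w)].
move=> /cvg_series_cvg_0 /cvgr0Pnorm_lt /(_ e e0) [n0 _ h].
exists n0.+1 => -[//|N]; rewrite ltnS => /h /=.
by rewrite ger0_norm.
Qed.
End BorelCantelli.

(** * The loop equations in the limit of large matrices *)

Section LimitLoops.
Variables (R : realType) (k l : nat).
Variable A : forall N : nat, 'I_k -> 'M[R[i]]_N.
Variable B : forall N : nat, 'I_l -> 'M[R[i]]_N.
Local Notation poly := (ncpoly R k l).
Variables (d : measure_display) (Omega : measurableType d) (Pr : probability Omega R).
Variable U : forall N : nat, Omega -> 'M[R[i]]_N.
Hypothesis HU : forall N, haar_unitary Pr (U N).
Variables (k' l' : nat) (tau tau' : poly -> R[i]).
Hypothesis tau_pure : forall b p, inSub b p -> cvgC (fun N => trN (ev (pure_letters A B N b) p)) (tau p).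
Hypothesis tau'_pure : forall b p, inIdl k' l' b p ->
  cvgC (fun N => N%:R * trN (ev (pure_letters A B N b) p)) (tau' p).

Local Notation mixedT := (mixed Pr U (@fst bool poly) (letter_mx A B)).
Local Notation mk := (@marked R k l k' l').
Local Notation tlim := (tau_lim A B Pr U).
Local Notation tlim' := (tau'_lim A B Pr U).
Local Notation validp := (@valid R k l).
Local Notation wcvg := (pure_word_cvg tau_pure).
Local Notation wcvg' := (pure_word_cvg_marked tau'_pure).

Lemma tlim_wprod w : all validp w -> cvgC (fun N => mean A B Pr U N (wprod w)) (tlim (wprod w)).
Proof. by move=> vw; apply: limC_cvg; exact: (mean_wprod_cvg HU tau_pure tau'_pure vw). Qed.

Lemma tlim'_wprod w : all validp w -> has mk w ->
  cvgC (fun N => N%:R * mean A B Pr U N (wprod w)) (tlim' (wprod w)).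
Proof. by move=> vw mw; apply: limC_cvg; exact: (mean_wprod_cvg_marked HU tau_pure tau'_pure vw mw). Qed.

Lemma wprod_nil : wprod [::] = 1 :> poly.
Proof. exact: big_nil. Qed.

Lemma mixed_cons_nil N v : (0 < N)%N -> mixedT N [:: [::]; v] = mixedT N [:: v].
Proof.
by move=> N0; rewrite (mixed_cons_pure HU) // /detw big_nil trN1 // mul1r.
Qed.

(** The covariance is O(1/N), so traces factor in the limit. The empty word, outside the range of
    that bound, is treated apart. *)
Lemma factor_cvg u v : all validp u -> all validp v ->
  cvgC (fun N => mixedT N [:: u; v]) (tlim (wprod u) * tlim (wprod v)).
Proof.
move=> vu vv.
case: (eqVneq u [::]) => [->|u0].
  rewrite wprod_nil (tau_lim1 A B Pr U) mul1r.
  apply: (@cvgC_eq _ 1 _ _ _ _ (tlim_wprod vv)) => N N0.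
  by rewrite mixed_cons_nil // mixed_valid.
case: (eqVneq v [::]) => [->|v0].
  rewrite wprod_nil (tau_lim1 A B Pr U) mulr1.
  apply: (@cvgC_eq _ 1 _ _ _ _ (tlim_wprod vu)) => N N0.
  rewrite (@mixed_perm _ _ _ _ _ _ _ _ N [:: u; [::]] [:: [::]; u]).
    by rewrite mixed_cons_nil // mixed_valid.
  by apply/permP => a /=; rewrite addnCA.
have h := mixed_factor HU wcvg wcvg' u0 v0.
have h1 : bigON 1 (fun N => mixedT N [:: u; v] - mixedT N [:: u] * mixedT N [:: v]).
  apply: bigON_eq (@bigON_wt R 1 (fun=> 1%N) _ _ _ h) => N N0; first by rewrite mul1r.
  by rewrite muln_gt0 !wt_gt0.
rewrite -[X in cvgC _ X]addr0.
have lim := cvgCD (cvgCM (tlim_wprod vu) (tlim_wprod vv)) (bigON_cvg0 h1).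
apply: (@cvgC_eq _ 0 _ _ _ _ lim) => N _.
by rewrite -!mixed_valid // addrC subrK.
Qed.

(** The factor [N] is absorbed by the weight of the marked word [v], and the weighted covariance is
    still O(1/N). *)
Lemma factor_cvg_marked u v : all validp u -> all validp v -> has mk v ->
  cvgC (fun N => N%:R * mixedT N [:: u; v]) (tlim (wprod u) * tlim' (wprod v)).
Proof.
move=> vu vv mv.
case: (eqVneq u [::]) => [->|u0].
  rewrite wprod_nil (tau_lim1 A B Pr U) mul1r.
  apply: (@cvgC_eq _ 1 _ _ _ _ (tlim'_wprod vv mv)) => N N0.
  by rewrite mixed_cons_nil // mixed_valid.
have v0 : v != [::] by case: (v) mv.
have h := mixed_factor HU wcvg wcvg' u0 v0.
have h1 : bigON 1 (fun N => N%:R * (mixedT N [:: u; v] - mixedT N [:: u] * mixedT N [:: v])).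
  apply: (@bigON_wt R 1 id _ _ _ h) => N N0.
  by rewrite [wt _ _ v]/wt mv leq_pmull // wt_gt0.
rewrite -[X in cvgC _ X]addr0.
have lim := cvgCD (cvgCM (tlim_wprod vu) (tlim'_wprod vv mv)) (bigON_cvg0 h1).
apply: (@cvgC_eq _ 0 _ _ _ _ lim) => N _.
by rewrite -!mixed_valid // mulrBr mulrCA addrC subrK.
Qed.

Lemma all_take_drop (T : eqType) (P : pred T) i (w : seq T) : all P w -> all P (take i w) /\ all P (drop i w).
Proof. by rewrite -{1}(cat_take_drop i w) all_cat => /andP[]. Qed.

Lemma limit_loop (t : bool * poly) w : all validp (t :: w) -> (last t w).1 != t.1 ->
  tlim (wprod (t :: w)) = tlim t.2 * tlim (wprod w) -
   \sum_(i <- iota 1 (size w) | nth false (map fst (t :: w)) i == t.1)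
    (tlim (wprod (take i (t :: w))) * tlim (wprod (drop i (t :: w)))
     - tlim (wprod (take i.+1 (t :: w))) * tlim (wprod (drop i.+1 (t :: w)))).
Proof.
move=> vw lw; have /andP[vt vw'] := vw.
have e1 : t.2 = wprod [:: t] by rewrite wprod_cons wprod_nil mulr1.
rewrite {1}e1; apply: (cvgC_uniq (tlim_wprod vw)).
rewrite -big_filter; set r := seq.filter _ _.
have lim := cvgCB (@factor_cvg [:: t] w _ vw') (@cvgC_sum _ _ r _ _ (fun i _ =>
  cvgCB (factor_cvg (all_take_drop i vw).1 (all_take_drop i vw).2)
        (factor_cvg (all_take_drop i.+1 vw).1 (all_take_drop i.+1 vw).2))).
apply: (@cvgC_eq _ 1 _ _ _ _ (lim _)) => [N N0|]; last by rewrite /= vt.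
by rewrite -mixed_valid // (mixed_loop_word HU _ N0 lw) /r big_filter.
Qed.

Lemma limit_loop' (t : bool * poly) w : all validp (t :: w) -> (last t w).1 != t.1 -> mk (last t w) ->
  tlim' (wprod (t :: w)) = tlim t.2 * tlim' (wprod w) -
   \sum_(i <- iota 1 (size w) | nth false (map fst (t :: w)) i == t.1)
    (tlim (wprod (take i (t :: w))) * tlim' (wprod (drop i (t :: w)))
     - tlim (wprod (take i.+1 (t :: w))) * tlim' (wprod (drop i.+1 (t :: w)))).
Proof.
move=> vw lw ml; have /andP[vt vw'] := vw.
have e1 : t.2 = wprod [:: t] by rewrite wprod_cons wprod_nil mulr1.
have mw : has mk w.
  case/lastP: w lw ml {vw vw'} => [|u z]; first by rewrite /= eqxx.
  by rewrite last_rcons has_rcons => _ ->.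
have mtw : has mk (t :: w) by rewrite /= mw orbT.
rewrite {1}e1; apply: (cvgC_uniq (tlim'_wprod vw mtw)).
rewrite -big_filter; set r := seq.filter _ _.
(* All right pieces retain the marked last letter, so the factor [N] always goes to them. *)
have md i : (i <= size w)%N -> has mk (drop i (t :: w)).
  move=> iw; have : size (drop i (t :: w)) != 0%N by rewrite size_drop /= subn_eq0 -ltnNge ltnS.
  move=> sz; apply/hasP; exists (last t w) => //.
  have -> : last t w = last t (t :: w) by [].
  rewrite -[X in last t X](cat_take_drop i (t :: w)) last_cat.
  by case: (drop i (t :: w)) sz => //= a s _; exact: mem_last.
have ir i : i \in r -> (i < size w)%N.
  rewrite mem_filter => /andP[ki iI]; have /andP[_] // := lt_of_kind lw iI ki.
have lim := cvgCB (@factor_cvg_marked [:: t] w _ vw' mw) (@cvgC_sum _ _ r _ _ (fun i hi =>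
  cvgCB (factor_cvg_marked (all_take_drop i vw).1 (all_take_drop i vw).2 (md _ (ltnW (ir i hi))))
        (factor_cvg_marked (all_take_drop i.+1 vw).1 (all_take_drop i.+1 vw).2 (md _ (ir i hi))))).
apply: (@cvgC_eq _ 1 _ _ _ _ (lim _)) => [N N0|]; last by rewrite /= vt.
rewrite -mixed_valid // (mixed_loop_word HU _ N0 lw) mulrBr mulr_sumr /r big_filter; congr (_ - _).
by apply: eq_bigr => i _; rewrite mulrBr.
Qed.
End LimitLoops.

(** * Almost sure convergence for self-adjoint matrices *)

Section AlmostSure.
Variables (R : realType) (k l : nat).
Variable A : forall N : nat, 'I_k -> 'M[R[i]]_N.
Variable B : forall N : nat, 'I_l -> 'M[R[i]]_N.
Local Notation poly := (ncpoly R k l).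
Variables (d : measure_display) (Omega : measurableType d) (Pr : probability Omega R).
Variable U : forall N : nat, Omega -> 'M[R[i]]_N.
Hypothesis HU : forall N, haar_unitary Pr (U N).
Variables (k' l' : nat) (tau tau' : poly -> R[i]).
Hypothesis tau_pure : forall b p, inSub b p -> cvgC (fun N => trN (ev (pure_letters A B N b) p)) (tau p).
Hypothesis tau'_pure : forall b p, inIdl k' l' b p ->
  cvgC (fun N => N%:R * trN (ev (pure_letters A B N b) p)) (tau' p).
Hypothesis saA : forall N i, selfadjoint (@A N i).
Hypothesis saB : forall N j, selfadjoint (@B N j).

Local Notation mixedT := (mixed Pr U (@fst bool poly) (letter_mx A B)).
Local Notation mk := (@marked R k l k' l').
Local Notation wmT N := (@wm R N _ (@fst bool poly) (letter_mx A B N)).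
Local Notation CL := (conj_letters A B).

Lemma adjmxK N (X : 'M[R[i]]_N) : adjmx (adjmx X) = X.
Proof. by apply/matrixP => i j; rewrite !mxE conjCK. Qed.

Lemma trN_adj N (X : 'M[R[i]]_N) : trN (adjmx X) = Num.conj (trN X).
Proof.
rewrite /trN rmorphM fmorphV rmorph_nat /mxtrace rmorph_sum; congr (_ * _).
by apply: eq_bigr => j _; rewrite !mxE.
Qed.

Lemma adj_conj_letters N (X : 'M[R[i]]_N) x : adjmx (CL X x) = CL X x.
Proof. by case: x => [a|b] /=; rewrite ?saA // !adjmxM adjmxK saB mulmxA. Qed.

Lemma adj_word N (X : 'M[R[i]]_N) (w : seq (letter k l)) :
  adjmx (\prod_(x <- w) CL X x) = \prod_(x <- rev w) CL X x.
Proof.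
elim: w => [|x w IH]; first by rewrite !big_nil; exact: adjmx1.
by rewrite rev_cons -cats1 big_cat big_cons big_seq1 /= -mulmxE adjmxM IH adj_conj_letters.
Qed.

Lemma ev_single N (X : 'M[R[i]]_N) x : ev (CL X) (single R x) = CL X x.
Proof. by rewrite evU fmU big_seq1 scale1r. Qed.

Lemma wm_basic N X (w : seq (letter k l)) : unitary X ->
  wmT N X (map (@basic R k l) w) = \prod_(x <- w) CL X x.
Proof.
move=> uX; rewrite (wm_valid A B uX (all_basic_valid _ _)) wprod_basic ev_prod.
by apply: eq_bigr => x _; rewrite ev_single.
Qed.

Lemma haarE_conj N (f : 'M[R[i]]_N -> R[i]) : polyfun f ->
  haarE Pr (U N) (fun X => Num.conj (f X)) = Num.conj (haarE Pr (U N) f).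
Proof. by move=> pf; apply: expC_conj; exact: (pf_bmeasC (HU N) pf). Qed.

Lemma mixed_rev N (w : seq (letter k l)) :
  mixedT N [:: map (@basic R k l) (rev w)] = Num.conj (mixedT N [:: map (@basic R k l) w]).
Proof.
rewrite /mixed -haarE_conj; last exact: pf_trp.
apply: haarE_eq => X uX; rewrite /trp !big_seq1 !wm_basic //.
by rewrite -trN_adj adj_word.
Qed.

(** The conjugate of the deviation of [w] is the deviation of the reversed word, so the fourth power
    of its modulus is a product of four centred traces. The weight treats words with and without
    special letters at once. *)
Lemma ae_word (w : seq (letter k l)) : w != [::] ->
  {ae Pr, forall omega, cvgC (fun N => (wt mk N (map (@basic R k l) w))%:R *
     (trN (\prod_(x <- w) CL (U N omega) x) - mixedT N [:: map (@basic R k l) w])) 0}.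
Proof.
move=> w0; set W := map _ w; pose W' := map (@basic R k l) (rev w).
pose D N (X : 'M[R[i]]_N) : R[i] := trN (\prod_(x <- w) CL X x) - mixedT N [:: W].
have pD N : polyfun (D N).
  apply: pf_sub; last exact: pf_cst.
  have -> : (fun X => trN (\prod_(x <- w) CL X x)) =
      (fun X : 'M[R[i]]_N => trN (ev (CL X) (\prod_(x <- w) single R x))).
    apply/funext => X; rewrite ev_prod; congr trN; apply: eq_bigr => x _.
    by rewrite ev_single.
  exact: pf_trN_ev.
pose G N (X : 'M[R[i]]_N) : R[i] := D N X * Num.conj (D N X) * (D N X * Num.conj (D N X)).
have pG N : polyfun (G N) by do 2!apply: pf_mul => //; exact: pf_conjf.
have GE N X : G N X = ((nm (D N X) ^+ 4)%:C)%C.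
  by rewrite /G -normCK norm_nm -exprD -rmorphXn.
have [K hK] : bigON 2 (fun N => (wtc mk N [:: W; W'; W; W'])%:R * haarE Pr (U N) (G N)).
  have W0 : W != [::] by rewrite -size_eq0 size_map size_eq0.
  have W'0 : W' != [::] by rewrite -size_eq0 size_map size_rev size_eq0.
  have := @fourth_moment R d Omega Pr U HU _ mk fst (letter_mx A B)
    (pure_word_cvg tau_pure) (pure_word_cvg_marked tau'_pure) [:: W; W'; W; W'] erefl.
  rewrite !inE !(eq_sym [::]) (negbTE W0) (negbTE W'0) => /(_ isT).
  apply: bigON_eq => N N0; congr (_ * _); apply: haarE_eq => X uX.
  rewrite !big_cons big_nil mulr1 !wm_basic // mixed_rev -adj_word trN_adj -rmorphB.
  by rewrite -/(D N X) /G !mulrA.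
have wtE N : (wtc mk N [:: W; W'; W; W'])%:R = (wt mk N W)%:R ^+ 4 :> R.
  have -> : wtc mk N [:: W; W'; W; W'] = (wt mk N W * wt mk N W * wt mk N W * wt mk N W)%N.
    have e : wt mk N W' = wt mk N W by apply: wt_perm; rewrite /W' /W perm_map // perm_rev.
    by rewrite /wtc !big_cons big_nil e muln1 !mulnA.
  by rewrite !natrM !exprS expr0 mulr1 !mulrA.
pose f N omega := (wt mk N W)%:R ^+ 4 * complex.Re (G N (unitarized (U N) omega)).
have fE N omega : f N omega = ((wt mk N W)%:R * nm (D N (unitarized (U N) omega))) ^+ 4.
  by rewrite /f GE /= exprMn.
have mG N : measurable_fun setT (fun omega => complex.Re (G N (unitarized (U N) omega))).
  by case: (pf_bmeasC (HU N) (pG N)) => -[].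
have iG N : Pr.-integrable setT (EFin \o (fun omega => complex.Re (G N (unitarized (U N) omega)))).
  by case: (bmeasC_int Pr (pf_bmeasC (HU N) (pG N))).
have aeS : {ae Pr, forall w, forall e : R, 0 < e -> exists N0, forall N, (N0 <= N)%N -> f N w < e}.
  apply: (@ae_cvg0_of_summable _ _ _ _ f K).
  - move=> N; apply: measurable_funM => //; exact: measurable_cst.
  - by move=> N omega; rewrite fE exprn_ge0 // mulr_ge0 // nm_ge0.
  - move=> N N0.
    have iF : Pr.-integrable setT (EFin \o f N).
      exact: (integrableZl _ ((wt mk N W)%:R ^+ 4) (iG N)).
    have -> : (\int[Pr]_omega (f N omega)%:E)%E = (Rintegral Pr setT (f N))%:E.
      by rewrite /Rintegral fineK //; exact: integrable_fin_num.
    rewrite lee_fin ler_pdivlMr ?exprn_gt0 ?ltr0n //.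
    apply: le_trans (hK N N0); rewrite ler_wpM2r ?exprn_ge0 //.
    rewrite /f RintegralZl // -wtE nmM nm_nat ler_wpM2l //.
    apply: le_trans (Re_le_nm _); exact: ler_norm.
(* The exceptional sets of the countably many [U N] are discarded together. *)
have aeU := ae_foralln (fun N => unitarized_ae (HU N)).
apply: filterS2 aeS aeU => omega hS hU; apply/cvgCP => e e0.
have [|N0 h] := hS (e ^+ 4); first exact: exprn_gt0.
exists N0 => N /h; rewrite fE hU subr0 nmM nm_nat.
by rewrite ltr_pXn2r // nnegrE ?mulr_ge0 ?nm_ge0 // ltW.
Qed.

Lemma ae_centered (p : poly) :
  {ae Pr, forall omega, cvgC (fun N => trN (ev (CL (U N omega)) p) - mean A B Pr U N p) 0}.
Proof.
elim/ncpoly_ind: p => [|p q hp hq|a p hp|w].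
- apply: aeW => omega; apply: (@cvgC_eq _ 0 _ _ _ _ (cvgC_cst 0)) => N _.
  by rewrite ev0 (mean0 A B HU) /trN mxtrace0 mul0r subr0.
- apply: filterS2 hp hq => omega hp hq; rewrite -[X in cvgC _ X]addr0.
  apply: (@cvgC_eq _ 0 _ _ _ _ (cvgCD hp hq)) => N _.
  by rewrite evD (meanD A B HU) trND opprD addrACA.
- apply: filterS hp => omega hp; rewrite -[X in cvgC _ X](mulr0 a).
  apply: (@cvgC_eq _ 0 _ _ _ _ (cvgCZ a hp)) => N _.
  by rewrite evZ (meanZ A B HU) trNZ mulrBr.
- case: (eqVneq w [::]) => [->|w0].
    rewrite big_nil; apply: aeW => omega; apply: (@cvgC_eq _ 1 _ _ _ _ (cvgC_cst 0)) => N N0.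
    by rewrite ev1 mean1 // trN1 // subrr.
  apply: filterS (ae_word w0) => omega /cvgCP h; apply/cvgCP => e /h[N0 {}h].
  exists (maxn 1 N0) => N; rewrite geq_max => /andP[N1 /h].
  rewrite !subr0 nmM nm_nat; apply: le_lt_trans.
  rewrite (mixed_valid A B Pr U N (all_basic_valid _ _)) wprod_basic ev_prod.
  under [in leLHS]eq_bigr do rewrite ev_single.
  by rewrite ler_peMl ?nm_ge0 // ler1n wt_gt0.
Qed.

Lemma ae_centered_idl (p : poly) : inI k' l' p ->
  {ae Pr, forall omega, cvgC (fun N => N%:R * (trN (ev (CL (U N omega)) p) - mean A B Pr U N p)) 0}.
Proof.
move: p; apply: inI_ind => [|p q hp hq|a p hp|w sw].
- apply: aeW => omega; apply: (@cvgC_eq _ 0 _ _ _ _ (cvgC_cst 0)) => N _.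
  by rewrite ev0 (mean0 A B HU) /trN mxtrace0 mul0r subr0 mulr0.
- apply: filterS2 hp hq => omega hp hq; rewrite -[X in cvgC _ X]addr0.
  apply: (@cvgC_eq _ 0 _ _ _ _ (cvgCD hp hq)) => N _.
  by rewrite evD (meanD A B HU) trND opprD -mulrDr addrACA.
- apply: filterS hp => omega hp; rewrite -[X in cvgC _ X](mulr0 a).
  apply: (@cvgC_eq _ 0 _ _ _ _ (cvgCZ a hp)) => N _.
  by rewrite evZ (meanZ A B HU) trNZ -mulrBr mulrCA.
- have w0 : w != [::] by case: (w) sw.
  apply: filterS (ae_word w0) => omega h.
  apply: (@cvgC_eq _ 0 _ _ _ _ h) => N _.
  have -> : wt mk N (map (@basic R k l) w) = N.
    rewrite /wt has_map (_ : has _ _ = true) //.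
    by apply: sub_has sw => x; exact: basic_marked.
  rewrite (mixed_valid A B Pr U N (all_basic_valid _ _)) wprod_basic ev_prod.
  by congr (_ * (trN _ - _)); apply: eq_bigr => x _; rewrite ev_single.
Qed.
End AlmostSure.

(** * Asymptotic freeness of type B *)

Theorem theorem3p5 (R : realType) (k l k' l' : nat)
  (hk : (k' <= k)%N) (hl : (l' <= l)%N)
  (A : forall N : nat, 'I_k -> 'M[R[i]]_N)
  (B : forall N : nat, 'I_l -> 'M[R[i]]_N)
  (tau tau' : ncpoly R k l -> R[i])
  (HA : forall P, inA1 P ->
     eq_o1 (fun N => trN (ev (lettermap (A N) (fun _ => 0)) P)) (tau P))
  (HA' : forall P, inI1 k' P ->
     eq_oNinv (fun N => trN (ev (lettermap (A N) (fun _ => 0)) P)) (tau' P))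
  (HB : forall P, inA2 P ->
     eq_o1 (fun N => trN (ev (lettermap (fun _ => 0) (B N)) P)) (tau P))
  (HB' : forall P, inI2 l' P ->
     eq_oNinv (fun N => trN (ev (lettermap (fun _ => 0) (B N)) P)) (tau' P))
  (d : measure_display) (Omega : measurableType d) (Pr : probability Omega R)
  (U : forall N : nat, Omega -> 'M[R[i]]_N)
  (HU : forall N, haar_unitary Pr (U N)) :
  let LAB N w := lettermap (A N) (fun j => U N w *m B N j *m adjmx (U N w)) in
  exists tau_e tau'_e : ncpoly R k l -> R[i],
    (* tau_e is a linear functional on A extending tau *)
    (forall (a : R[i]) (p q : ncpoly R k l), tau_e (a *: p + q) = a * tau_e p + tau_e q) /\
    (forall P, inA1 P \/ inA2 P -> tau_e P = tau P) /\
    (* tau'_e is a linear functional on I extending tau' *)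
    (forall (a : R[i]) (p q : ncpoly R k l), inI k' l' p -> inI k' l' q ->
        tau'_e (a *: p + q) = a * tau'_e p + tau'_e q) /\
    (forall P, inI1 k' P \/ inI2 l' P -> tau'_e P = tau' P) /\
    (* asymptotics in expectation *)
    (forall P, eq_o1 (fun N => expC Pr (fun w => trN (ev (LAB N w) P))) (tau_e P)) /\
    (forall P, inI k' l' P ->
        eq_oNinv (fun N => expC Pr (fun w => trN (ev (LAB N w) P))) (tau'_e P)) /\
    (* freeness of type B *)
    free_typeB tau_e (inI k' l') tau'_e (@inA1 R k l) (inI1 k') (@inA2 R k l) (inI2 l') /\
    (* almost sure asymptotics in the self-adjoint case *)
    ((forall N (i : 'I_k), selfadjoint (A N i)) ->
     (forall N (j : 'I_l), selfadjoint (B N j)) ->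
       (forall P, {ae Pr, forall w,
           eq_o1 (fun N => trN (ev (LAB N w) P)) (tau_e P)}) /\
       (forall P, inI k' l' P -> {ae Pr, forall w,
           eq_oNinv (fun N => trN (ev (LAB N w) P)) (tau'_e P)})).
Proof.
have tp b P : inSub b P -> cvgC (fun N => trN (ev (pure_letters A B N b) P)) (tau P).
  by case: b => /(inSubE _ _).2 h; [exact: HB|exact: HA].
have tp' b P : inIdl k' l' b P ->
    cvgC (fun N => N%:R * trN (ev (pure_letters A B N b) P)) (tau' P).
  by case: b => /(inIdlE _ _ _ _).2 h; [case: (eq_oNinvE (fun N => trN (ev (pure_letters A B N true) P)) (tau' P)) => + _; apply; exact: HB'
    |case: (eq_oNinvE (fun N => trN (ev (pure_letters A B N false) P)) (tau' P)) => + _; apply; exact: HA'].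
exists (tau_lim A B Pr U), (tau'_lim A B Pr U).
split; first exact: (tau_lim_linear HU tp tp').
split; first by move=> P [/(inSubE false)|/(inSubE true)] h; exact: (tau_limE Pr U tp h).
split; first exact: (tau'_lim_linear HU tp tp').
split; first by move=> P [/(inIdlE k' l' false)|/(inIdlE k' l' true)] h; exact: (tau'_limE Pr U tp' h).
split.
  move=> P; apply: (@cvgC_eq _ 0 _ _ _ _ (tau_limP HU tp tp' P)) => N _.
  by rewrite -(expC_mean A B HU).
split.
  move=> P hP; apply/eq_oNinvE.
  apply: (@cvgC_eq _ 0 _ _ _ _ (tau'_limP HU tp tp' hP)) => N _.
  by rewrite -(expC_mean A B HU).
split.
  have valid_all (w : seq (bool * ncpoly R k l)) :
      (forall x, x \in w -> inSub x.1 x.2) -> all (@valid R k l) w.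
    by move=> h; apply/allP => x /h hx; apply/asboolP.
  apply: (@typeB_freeness _ _ _ _ (@inSub R k l) (inIdl k' l')).
  - exact: (tau_lim_linear HU tp tp').
  - exact: tau_lim1.
  - exact: tau_lim_mulC.
  - exact: inSubM.
  - by move=> b p c; exact: inSub_center.
  - exact: inIdl_sub.
  - by move=> b a v; exact: inIdlMr.
  - exact: inI_idl.
  - by move=> a p; apply: ideal_genMl.
  - by move=> a p; apply: ideal_genMr.
  - exact: (tau'_lim_linear HU tp tp').
  - exact: tau'_lim_mulC.
  - by move=> t w /valid_all vw lw; exact: (limit_loop HU tp tp' vw lw).
  - move=> t w /valid_all vw lw hV; apply: (limit_loop' HU tp tp' vw lw).
    exact/asboolP.
  - by move=> b p /inSubE.
  - by move=> b p /inIdlE.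
move=> saA saB; split.
  move=> P; apply: filterS (ae_centered HU tp tp' saA saB P) => w h.
  rewrite /eq_o1 -[X in cvgC _ X]add0r.
  apply: (@cvgC_eq _ 0 _ _ _ _ (cvgCD h (tau_limP HU tp tp' P))) => N _.
  by rewrite subrK.
move=> P hP; apply: filterS (ae_centered_idl HU tp tp' saA saB hP) => w h.
apply/eq_oNinvE; rewrite -[X in cvgC _ X]add0r.
apply: (@cvgC_eq _ 0 _ _ _ _ (cvgCD h (tau'_limP HU tp tp' hP))) => N _.
by rewrite -mulrDr subrK.
Qed.
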